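(* Let $T>0$, let $g_0,g_1$ be boundary data with compact support in $(0,T)$, and let $$W_b[g_0,g_1](x,t)=\int_{\partial D^+}E(k;x,t)\,G(k;T)\,dk,$$ with $D^+$, $E$, $G$ and the functions $\Psi_1,\dots,\Psi_5$ on $\mathbb{R}$ (depending on $g_0,g_1$) as defined in the context. Then for every $r\in[2,\infty]$, with $\frac1r+\frac1{r'}=1$, $$\left\|W_b[g_0,g_1](\cdot,t)\right\|_{L^r_x(\mathbb{R}_+)}\lesssim t^{-\left(\frac14-\frac1{2r}\right)}\sum_{i=1}^5\|\Psi_i\|_{L^{r'}(\mathbb{R})},\qquad 0<t\le 1,$$ where $\lesssim$ means inequality up to a multiplicative constant independent of $t$ and of $g_0,g_1$.
   Context: Notation: $\mathbb{R}_+=(0,\infty)$, $\mathbb{C}_+=\{k\in\mathbb{C}:\operatorname{Im}k>0\}$. $W_b$ is the boundary integral operator (with zero initial datum) for $y_t-i(\partial_x^4+\partial_x^2)y=0$ on $\mathbb{R}_+\times(0,T)$ with $y(0,t)=g_0(t)$, $y_x(0,t)=g_1(t)$. $w(k)=-i(k^4-k^2)$, $D=\{k\in\mathbb{C}:\operatorname{Re}(w(k))<0\}$, $D^+=D\cap\mathbb{C}_+$; $\partial D^+$ is oriented so that $D^+$ remains at the left as the boundary is traversed. $E(k;x,t)=-\frac{1}{2\pi}e^{ikx-w(k)t}$. $\tilde g_j(k,t)=\int_0^t e^{ks}g_j(s)\,ds$ for $j=0,1$. Rotated square root: for some fixed and sufficiently small $\epsilon>0$, set $\sqrt{z}^*:=|z|^{1/2}e^{i\frac{\arg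 z}{2}}$ with $\arg z\in[\epsilon,2\pi+\epsilon)$. Then $\nu(k)=\sqrt{1-k^2}^*$. $G(k;t)=-2ik(k+\nu(k))\,\tilde g_1(w(k),t)-2k\nu(k)(k+\nu(k))\,\tilde g_0(w(k),t)$; one also writes $G(k,T)=G(k;T)$. The Fourier transform convention is $\hat\Psi(s)=\int_{-\infty}^\infty e^{-isy}\Psi(y)\,dy$. The functions $\Psi_i$ are the inverse Fourier transforms of the following functions of $s\in\mathbb{R}$: - $\hat\Psi_1(s)=G(is,T)$ for $s\ge0$, and $\hat\Psi_1(s)=0$ for $s<0$; - $\hat\Psi_2(s)=G(s,T)$ for $0\le s\le\frac1{\sqrt2}$, and $\hat\Psi_2(s)=0$ otherwise; - $\hat\Psi_3(s)=G\big(s+i(s^2-\tfrac12)^{1/2},T\big)\Big(1+\dfrac{is}{(s^2-\frac12)^{1/2}}\Big)$ for $s\ge\frac1{\sqrt2}$, and $\hat\Psi_3(s)=0$ for $s<\frac1{\sqrt2}$; - $\hat\Psi_4(s)=G\big(-s+i(s^2-\tfrac12)^{1/2},T\big)\Big(-1+\dfrac{is}{(s^2-\frac12)^{1/2}}\Big)$ for $s\ge\frac1{\sqrt2}$, and $\hat\Psi_4(s)=0$ for $s<\frac1{\sqrt2}$; - $\hat\Psi_5(s)=G(s,T)$ for $s\le-\frac1{\sqrt2}$, and $\hat\Psi_5(s)=0$ for $s>-\frac1{\sqrt2}$. *)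

(* Defs.v *)
From HB Require Import structures.
From mathcomp Require Import all_boot all_order all_algebra.
From mathcomp Require Import all_classical all_reals all_analysis.
From mathcomp Require Import complex ring lra.

Set Implicit Arguments.
Unset Strict Implicit.
Unset Printing Implicit Defensive.

Import Order.TTheory GRing.Theory Num.Theory.
Import numFieldNormedType.Exports.

Local Open Scope classical_set_scope.
Local Open Scope ring_scope.
Local Open Scope complex_scope.

Section Definitions.
Context {R : realType}.
Implicit Types (k z : R[i]) (s t x y T eps : R) (g : R -> R[i]).

Local Notation mu := (@lebesgue_measure R).
Local Notation Re := complex.Re.
Local Notation Im := complex.Im.

Definition modulus z : R := ComplexField.Normc.normc z.

Definition cexp z : R[i] :=
  (expR (Re z) * cos (Im z)) +i* (expR (Re z) * sin (Im z)).

Definition cintegrable (A : set R) (f : R -> R[i]) : Prop :=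
  mu.-integrable A (EFin \o (fun s => Re (f s))) /\
  mu.-integrable A (EFin \o (fun s => Im (f s))).

Definition cintegral (A : set R) (f : R -> R[i]) : R[i] :=
  (\int[mu]_(s in A) Re (f s)) +i* (\int[mu]_(s in A) Im (f s)).

Definition cderive (f : R -> R[i]) s : R[i] :=
  derive1 (fun u => Re (f u)) s +i* derive1 (fun u => Im (f u)) s.

(* a parametrised arc, traversed in the direction of increasing parameter *)
Record arc := Arc { arc_dom : set R; arc_path : R -> R[i] }.

Definition arc_integral (c : arc) (F : R[i] -> R[i]) : R[i] :=
  cintegral (arc_dom c)
    (fun s => F (arc_path c s) * cderive (arc_path c) s).

Definition w k : R[i] := - 'i * (k ^+ 4 - k ^+ 2).

Definition D : set R[i] := [set k | Re (w k) < 0].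

Definition Dplus : set R[i] := D `&` [set k | 0 < Im k].

(* [bnd_Dplus] and [left_Dplus] below show that these arcs cover the boundary
   of D^+ and that D^+ lies on their left. *)
Definition bnd_arc (j : 'I_5) : arc :=
  tnth [tuple
    Arc `]-oo, 0] (fun s => 0 +i* (- s));
    Arc `[0, (Num.sqrt 2)^-1] (fun s => s%:C);
    Arc `[(Num.sqrt 2)^-1, +oo[ (fun s => s +i* Num.sqrt (s ^+ 2 - 2^-1));
    Arc `[(Num.sqrt 2)^-1, +oo[ (fun s => (- s) +i* Num.sqrt (s ^+ 2 - 2^-1));
    Arc `]-oo, - (Num.sqrt 2)^-1] (fun s => s%:C)] j.

Definition bnd_integral (F : R[i] -> R[i]) : R[i] :=
  \sum_(j < 5) arc_integral (bnd_arc j) F.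

Definition E k x t : R[i] :=
  - ((2 * pi)^-1)%:C * cexp ('i * k * x%:C - w k * t%:C).

Definition gtilde g k t : R[i] :=
  cintegral `[0, t] (fun s => cexp (k * s%:C) * g s).

(* the argument of z in [eps, 2 pi + eps); arbitrary if z = 0 *)
Definition rot_arg eps z : R :=
  get [set th | eps <= th < 2 * pi + eps /\
                z = (modulus z)%:C * (cos th +i* sin th)].

Definition rot_sqrt eps z : R[i] :=
  (Num.sqrt (modulus z))%:C * cexp ('i * (rot_arg eps z / 2)%:C).

Definition nu eps k : R[i] := rot_sqrt eps (1 - k ^+ 2).

Definition G eps g0 g1 k t : R[i] :=
  - 2 * 'i * k * (k + nu eps k) * gtilde g1 (w k) t
  - 2 * k * nu eps k * (k + nu eps k) * gtilde g0 (w k) t.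

Definition Wb eps T g0 g1 x t : R[i] :=
  bnd_integral (fun k => E k x t * G eps g0 g1 k T).

Definition Psi_hat1 eps T g0 g1 s : R[i] :=
  if 0 <= s then G eps g0 g1 (0 +i* s) T else 0.

Definition Psi_hat2 eps T g0 g1 s : R[i] :=
  if 0 <= s <= (Num.sqrt 2)^-1 then G eps g0 g1 s%:C T else 0.

Definition Psi_hat3 eps T g0 g1 s : R[i] :=
  if (Num.sqrt 2)^-1 <= s then
    G eps g0 g1 (s +i* Num.sqrt (s ^+ 2 - 2^-1)) T
      * (1 +i* (s / Num.sqrt (s ^+ 2 - 2^-1)))
  else 0.

Definition Psi_hat4 eps T g0 g1 s : R[i] :=
  if (Num.sqrt 2)^-1 <= s then
    G eps g0 g1 ((- s) +i* Num.sqrt (s ^+ 2 - 2^-1)) T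
      * ((- 1) +i* (s / Num.sqrt (s ^+ 2 - 2^-1)))
  else 0.

Definition Psi_hat5 eps T g0 g1 s : R[i] :=
  if s <= - (Num.sqrt 2)^-1 then G eps g0 g1 s%:C T else 0.

Definition Psi_hat eps T g0 g1 (i : 'I_5) : R -> R[i] :=
  tnth [tuple Psi_hat1 eps T g0 g1; Psi_hat2 eps T g0 g1;
              Psi_hat3 eps T g0 g1; Psi_hat4 eps T g0 g1;
              Psi_hat5 eps T g0 g1] i.

(* inverse of  f |-> (s |-> \int e^{-isy} f(y) dy) *)
Definition inv_fourier (f : R -> R[i]) y : R[i] :=
  ((2 * pi)^-1)%:C * cintegral setT (fun s => cexp ('i * (s * y)%:C) * f s).

Definition Psi eps T g0 g1 (i : 'I_5) : R -> R[i] :=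
  inv_fourier (Psi_hat eps T g0 g1 i).

Definition compact_support_in (A : set R) g : Prop :=
  compact (closure [set s | g s != 0]) /\ closure [set s | g s != 0] `<=` A.

(* Last clause: the integrals defining the Psi_i converge absolutely; as
   |E(k;x,t)| <= 1/(2 pi) on the boundary of D^+ when x >= 0, so does the one
   defining W_b[g0,g1](x,t). Smooth data with compact support satisfy it. *)
Definition boundary_data eps T g0 g1 : Prop :=
  [/\ compact_support_in `]0, T[ g0 /\ compact_support_in `]0, T[ g1,
      cintegrable `]0, T[ g0 /\ cintegrable `]0, T[ g1 &
      forall i, cintegrable setT (Psi_hat eps T g0 g1 i)].

(* the L^p norm on the subset A of the line *)
Definition Lnorm_on (A : set R) (p : \bar R) (f : R -> R[i]) : \bar R :=
  'N[mu]_p [ (EFin \o (fun x => modulus (f x))) \_ A ]%E.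

End Definitions.

Lemma rot_argP (R : realType) (eps : R) (z : R[i]) : 0 <= eps <= 2 * pi ->
  eps <= rot_arg eps z < 2 * pi + eps /\
  z = (modulus z)%:C * (cos (rot_arg eps z) +i* sin (rot_arg eps z)).
Proof.
move=> /andP[e0 e2].
set P : set R := [set th | eps <= th < 2 * pi + eps /\
                z = (modulus z)%:C * (cos th +i* sin th)].
suff [th Pth] : exists th, P th by exact: (@getPex _ P (ex_intro _ th Pth)).
have pi0 : 0 < pi :> R := pi_gt0 R.
suff [th [th0 th2 zE]] : exists th : R, [/\ 0 <= th, th < 2 * pi &
    z = (modulus z)%:C * (cos th +i* sin th)].
  have [eth|the] := leP eps th; first by exists th; split => //; lra.
  exists (th + 2 * pi); split; first lra.
  by rewrite mulr_natl cosD2pi sinD2pi.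
have [z0|z0] := eqVneq (modulus z) 0.
  exists 0; split; [by []|lra|].
  by move/ComplexField.Normc.eq0_normc: z0 => ->; rewrite /modulus /= expr0n /= addr0 sqrtr0 mul0r.
clear P; case: z z0 => a b; rewrite /modulus /=; set n := Num.sqrt _ => n0.
have n_gt0 : 0 < n by rewrite lt_neqAle eq_sym n0 sqrtr_ge0.
have n2 : n ^+ 2 = a ^+ 2 + b ^+ 2 by rewrite sqr_sqrtr// addr_ge0// sqr_ge0.
set x := a / n; have ax : a = n * x by rewrite /x; field.
have xb : (n * n) * (1 - x ^+ 2) = b ^+ 2.
  by rewrite mulrBr mulr1 -expr2 -exprMn -ax n2; ring.
have x1 : x ^+ 2 <= 1.
  by rewrite -subr_ge0 -(pmulr_rge0 _ (mulr_gt0 n_gt0 n_gt0)) xb sqr_ge0.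
have x1' : -1 <= x <= 1 by nra.
have sE : n * sin (acos x) = `|b|.
  rewrite sin_acos// -(sqrtr_sqr b) -xb sqrtrM ?mulr_ge0 ?ltW//.
  by rewrite -expr2 sqrtr_sqr gtr0_norm.
have [b0|b0] := leP 0 b.
  exists (acos x); split; [exact: acos_ge0|have := acos_lepi x1'; lra|].
  by simpc; rewrite acosK// sE -ax ger0_norm.
exists (2 * pi - acos x); split; [have := acos_lepi x1'; lra| |].
  rewrite gtrBl; have := acos_ge0 x1'; rewrite le_eqVlt => /orP[/eqP h|//].
  by move: sE; rewrite -h sin0 mulr0 => /eqP; rewrite eq_sym normr_eq0 lt_eqF.
have -> : 2 * pi - acos x = - acos x + pi *+ 2 by rewrite addrC mulr_natl.
rewrite cosD2pi sinD2pi cosN sinN; simpc; rewrite acosK// -ax.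
by rewrite ?mulrN sE ltr0_norm// opprK.
Qed.

Section Boundary.
Context {R : realType}.
Local Notation Re := (@complex.Re R).
Local Notation Im := (@complex.Im R).
Local Notation C := (R[i] : numFieldType).

Let mem_Dplus (a b : R) :
  Dplus (a +i* b) <-> 0 < b /\ a * (a ^+ 2 - b ^+ 2 - 2^-1) < 0.
Proof.
rewrite /Dplus /D /w /= !exprS expr0 /=; simpc.
set e := (X in X < 0); have -> : e = 4 * b * (a * (a ^+ 2 - b ^+ 2 - 2^-1)).
  by rewrite /e; field.
split=> -[h b0]; split => //.
  by move: h; rewrite pmulr_rlt0// mulr_gt0.
by rewrite pmulr_rlt0// mulr_gt0.
Qed.

Let abs_Re_Im_le (z : R[i]) : `|Re z|%:C <= `|z| /\ `|Im z|%:C <= `|z|.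
Proof.
split; first exact: normc_ge_Re.
case: z => a b; rewrite normc_def lecR /= -sqrtr_sqr ler_wsqrtr//.
by rewrite lerDr sqr_ge0.
Qed.

Let continuous_Re_Im :
  continuous (@complex.Re R : C -> R) /\ continuous (@complex.Im R : C -> R).
Proof.
split=> z B /nbhs_ballP[e /= e0 eB]; apply/nbhs_ballP;
  (exists e%:C; first by rewrite /= ltcR).
- move=> u ze; have {}ze : `|z - u| < e%:C by [].
  apply: eB; rewrite -ball_normE /= -ltcR; apply: le_lt_trans ze.
  by have [+ _] := abs_Re_Im_le (z - u); move: (z) (u) => [? ?] [? ?].
- move=> u ze; have {}ze : `|z - u| < e%:C by [].
  apply: eB; rewrite -ball_normE /= -ltcR; apply: le_lt_trans ze.
  by have [_ +] := abs_Re_Im_le (z - u); move: (z) (u) => [? ?] [? ?].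
Qed.

Let F (z : C) : R := Re z * (Re z ^+ 2 - Im z ^+ 2 - 2^-1).

Let continuous_F : continuous F.
Proof.
have [cR cI] := continuous_Re_Im.
have H (K : topologicalType) (f g : K -> R) : continuous f -> continuous g ->
    continuous (fun z => f z * (f z ^+ 2 - g z ^+ 2 - 2^-1) : R).
  move=> cf cg z; apply: cvgM; first exact: cf.
  apply: cvgB; last exact: cvg_cst.
  by apply: cvgB; under eq_fun do rewrite expr2; rewrite expr2;
    apply: cvgM; (exact: cf || exact: cg).
exact: H cR cI.
Qed.

Let DplusE : Dplus = [set z : C | 0 < Im z] `&` [set z | F z < 0].
Proof. by apply/seteqP; split=> -[a b] /mem_Dplus. Qed.

Let open_Dplus : open (Dplus : set C).
Proof.
have [cR cI] := continuous_Re_Im; rewrite DplusE; apply: openI.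
- exact: (open_comp (fun z _ => cI z) (@open_gt R 0)).
- exact: (open_comp (fun z _ => @continuous_F z) (@open_lt R 0)).
Qed.

Let closure_DplusE :
  closure (Dplus : set C) = [set z | 0 <= Im z] `&` [set z | F z <= 0].
Proof.
have [cR cI] := continuous_Re_Im; apply/seteqP; split.
  rewrite closureE; apply: smallest_sub; last first.
    by rewrite DplusE => z [/= h1 h2]; split; exact: ltW.
  apply: closedI.
  - exact: (preimage_closed (fun z _ => cI z) (@closed_ge R 0)).
  - exact: (preimage_closed (fun z _ => @continuous_F z) (@closed_le R 0)).
move=> [a b] [/= b0]; rewrite /F /= => F0 B /nbhs_ballP[e /= e0 eB].
have [d d0 ed] : exists2 d : R, 0 < d & (d + d)%:C < e.
  move: e e0 {eB} => [e e']; rewrite ltcE /= => /andP[/eqP-> e0].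
  by exists (e / 3); [lra | rewrite ltcR; lra].
suff [x [y [/= xd yd Dxy]]] : exists x y : R,
    [/\ `|x - a| <= d, `|y - b| <= d & Dplus (x +i* y)].
  exists (x +i* y); split => //; apply: eB; change (`|(a +i* b) - (x +i* y)| < e).
  apply: le_lt_trans ed; rewrite normc_def lecR /=.
  rewrite -[leRHS]ger0_norm; last lra.
  rewrite -sqrtr_sqr ler_wsqrtr//.
  move: xd yd; rewrite !ler_norml; nra.
have [a0|a0|a0] := ltgtP a 0.
- have h : 0 <= a ^+ 2 - b ^+ 2 - 2^-1 by rewrite -(nmulr_rle0 _ a0).
  exists (a - d), (b + d); split; [by rewrite ler_norml; lra..|].
  by apply/mem_Dplus; split; [lra|rewrite nmulr_rlt0; [nra|lra]].
- have h : a ^+ 2 - b ^+ 2 - 2^-1 <= 0 by rewrite -(pmulr_rle0 _ a0).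
  exists a, (b + d); split; [by rewrite ler_norml; lra..|].
  by apply/mem_Dplus; split; [lra|rewrite pmulr_rlt0; [nra|lra]].
- exists d, (b + d); split; [by rewrite ler_norml; lra..|].
  by apply/mem_Dplus; split; [lra|rewrite pmulr_rlt0; [nra|lra]].
Qed.

Let q : R := (Num.sqrt 2)^-1.

Let q_gt0 : 0 < q. Proof. by rewrite invr_gt0 sqrtr_gt0. Qed.

Let sqr_q : q ^+ 2 = 2^-1. Proof. by rewrite exprVn sqr_sqrtr. Qed.

Let leq_q (x : R) : 0 <= x -> (q <= x) = (0 <= x ^+ 2 - 2^-1).
Proof.
by move=> x0; rewrite subr_ge0 -sqr_q ler_sqr// nnegrE ?ltW.
Qed.

Let arcE j : bnd_arc j = nth (bnd_arc 0)
  [:: Arc `]-oo, 0] (fun s : R => 0 +i* (- s));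
      Arc `[0, q] (fun s => s%:C);
      Arc `[q, +oo[ (fun s => s +i* Num.sqrt (s ^+ 2 - 2^-1));
      Arc `[q, +oo[ (fun s => (- s) +i* Num.sqrt (s ^+ 2 - 2^-1));
      Arc `]-oo, - q] (fun s => s%:C)] j.
Proof. by rewrite {1}/bnd_arc (tnth_nth (bnd_arc 0)). Qed.

Lemma bnd_Dplus :
  closure (Dplus : set C) `\` interior (Dplus : set C) =
    \bigcup_j (arc_path (bnd_arc j) @` arc_dom (bnd_arc j)).
Proof.
rewrite (interior_id _).1// closure_DplusE DplusE.
apply/seteqP; split => [[a b] [[/= b0]]|_ [[[|[|[|[|[|//]]]]] jlt] _ [s + <-]]].
- rewrite /F /= => F0 /not_andP FD.
  have {}FD : b = 0 \/ a * (a ^+ 2 - b ^+ 2 - 2^-1) = 0.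
    case: FD => /= /negP; rewrite -leNgt => h; [left|right];
    by apply/eqP; rewrite eq_le h ?b0 ?F0.
  have bE c : b ^+ 2 = c -> Num.sqrt c = b.
    by move=> <-; rewrite sqrtr_sqr ger0_norm.
  have [a0|a0|a0] := ltgtP a 0.
  + have h : 0 <= a ^+ 2 - b ^+ 2 - 2^-1 by rewrite -(nmulr_rle0 _ a0).
    have aq : q <= - a by rewrite leq_q; [nra|lra].
    case: FD => [->|/eqP].
      exists (inord 4) => //; exists a; rewrite arcE inordK//= in_itv/= -/q; lra.
    rewrite mulf_eq0 lt_eqF//= => /eqP ab.
    exists (inord 3) => //; exists (- a); rewrite arcE inordK//= ?in_itv/= ?andbT//.
    by rewrite opprK; congr (_ +i* _); apply: bE; lra.
  + have h : a ^+ 2 - b ^+ 2 - 2^-1 <= 0 by rewrite -(pmulr_rle0 _ a0).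
    case: FD => [bb|/eqP].
      exists (inord 1) => //; exists a; rewrite arcE inordK//= ?bb// in_itv/= -/q ltW//=.
      by rewrite -ler_sqr ?nnegrE ?(ltW a0) ?(ltW q_gt0)// sqr_q; move: h; rewrite bb; lra.
    rewrite mulf_eq0 gt_eqF//= => /eqP ab.
    exists (inord 2) => //; exists a; rewrite arcE inordK//= ?in_itv/= ?andbT//.
      by rewrite -/q leq_q; [nra|lra].
    by congr (_ +i* _); apply: bE; lra.
  + exists (inord 0) => //; exists (- b); rewrite arcE inordK//= ?in_itv/= ?opprK ?a0//.
    by rewrite oppr_le0.
- rewrite arcE /= in_itv /= => s0.
  split; first by split => /=; [lra|rewrite /F /= mul0r].
  by move=> [_] /=; rewrite /F /= mul0r ltxx.
- rewrite arcE /= in_itv /= -/q => /andP[s0 sq].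
  split; last by move=> [] /=; rewrite ltxx.
  split => //=; rewrite /F /=.
  have : s ^+ 2 <= 2^-1 by rewrite -sqr_q; have := q_gt0; nra.
  by nra.
- rewrite arcE /= in_itv /= -/q andbT => sq.
  have s0 : 0 <= s by have := q_gt0; lra.
  have FE : F (s +i* Num.sqrt (s ^+ 2 - 2^-1)) = 0.
    by rewrite /F /= sqr_sqrtr -?leq_q//; lra.
  by split; [split => /=; rewrite ?FE ?sqrtr_ge0|move=> [] /= _; rewrite FE ltxx].
- rewrite arcE /= in_itv /= -/q andbT => sq.
  have s0 : 0 <= s by have := q_gt0; lra.
  have FE : F ((- s) +i* Num.sqrt (s ^+ 2 - 2^-1)) = 0.
    by rewrite /F /= sqr_sqrtr -?leq_q//; lra.
  by split; [split => /=; rewrite ?FE ?sqrtr_ge0|move=> [] /= _; rewrite FE ltxx].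
- rewrite arcE /= in_itv /= -/q => sq.
  split; last by move=> [] /=; rewrite ltxx.
  split => //=; rewrite /F /=.
  have : 2^-1 <= s ^+ 2 by rewrite -sqr_q; have := q_gt0; nra.
  have s0 : s <= 0 by have := q_gt0; lra.
  by nra.
Qed.

Let derive_height (s : R) : q < s ->
  derive1 (fun u : R => Num.sqrt (u ^+ 2 - 2^-1)) s = s / Num.sqrt (s ^+ 2 - 2^-1).
Proof.
move=> qs; have h : 0 < s ^+ 2 - 2^-1 by rewrite -sqr_q; have := q_gt0; nra.
rewrite derive1E; apply: derive_val.
have H := @is_derive1_sqrt R (s ^+ 2 - 2^-1) h.
have K : is_derive s 1 (fun u : R => u ^+ 2 - 2^-1 : R) (2 * s).
  apply: is_derive_eq; rewrite scaler0 subr0 /GRing.scale/=; ring.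
have -> : s / Num.sqrt (s ^+ 2 - 2^-1) =
    (2 * Num.sqrt (s ^+ 2 - 2^-1))^-1 * (2 * s).
  by field; rewrite gt_eqF ?sqrtr_gt0.
exact: is_derive1_comp.
Qed.

Lemma left_Dplus (j : 'I_5) (s : R) : interior (arc_dom (bnd_arc j)) s ->
  \forall d \near 0^'+, Dplus (arc_path (bnd_arc j) s +
                              'i * cderive (arc_path (bnd_arc j)) s * d%:C).
Proof.
have dcst c : derive1 (fun=> c : R) s = 0 by rewrite derive1_cst.
have did : derive1 (fun u : R => u) s = 1 by rewrite derive1E derive_id.
have dopp : derive1 (fun u : R => - u) s = - 1.
  by rewrite derive1E deriveN// derive_id.
have sq0 := q_gt0; have sq2 := sqr_q.
have height x : q < x -> 0 < Num.sqrt (x ^+ 2 - 2^-1) /\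
    Num.sqrt (x ^+ 2 - 2^-1) ^+ 2 = x ^+ 2 - 2^-1.
  move=> qx; have h : 0 < x ^+ 2 - 2^-1 by rewrite -sqr_q; nra.
  by rewrite sqrtr_gt0 sqr_sqrtr// ltW.
have mem (z : R[i]) (a b : R) : z = a +i* b -> 0 < b -> a * (a ^+ 2 - b ^+ 2 - 2^-1) < 0 -> Dplus z.
  by move=> -> b0 ab; apply/mem_Dplus.
rewrite /cderive; case: j => [[|[|[|[|[|//]]]]] jlt];
  rewrite arcE /= interior_itv /= in_itv /= -/q ?andbT => sq;
  rewrite ?dcst ?did ?dopp ?derive_height//.
- near=> d; have d0 : 0 < d by near: d; exact: nbhs_right_gt.
  have dq : d < q by near: d; exact: nbhs_right_lt.
  apply: (mem _ d (- s)); first by (congr (_ +i* _); ring).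
    by lra.
  by rewrite pmulr_rlt0//; nra.
- near=> d; have d0 : 0 < d by near: d; exact: nbhs_right_gt.
  move: sq => /andP[s0 sq].
  apply: (mem _ s d) => //; first by (congr (_ +i* _); ring).
  by rewrite pmulr_rlt0//; nra.
- have [] := height _ sq; set h := Num.sqrt _ => h0 h2.
  near=> d; have d0 : 0 < d by near: d; exact: nbhs_right_gt.
  have dh : d < h by near: d; exact: nbhs_right_lt.
  have h1 : h / h = 1 by rewrite divff ?gt_eqF.
  have hi : 0 < h^-1 by rewrite invr_gt0.
  set u := d / h; have u0 : 0 < u by rewrite divr_gt0.
  have u1 : u < 1 by rewrite ltr_pdivrMr ?mul1r.
  apply: (mem _ (s * (1 - u)) (h + d)).
  + by rewrite /u; congr (_ +i* _); ring.
  + lra.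
  + have s0 : 0 < s by lra.
    have su : 0 < s * u by rewrite mulr_gt0.
    have s1u : 0 < s * (1 - u) by rewrite mulr_gt0// subr_gt0.
    have : (s * (1 - u)) ^+ 2 < s ^+ 2 by rewrite ltr_pXn2r ?nnegrE//; lra.
    have : h ^+ 2 < (h + d) ^+ 2 by nra.
    by rewrite pmulr_rlt0 ?mulr_gt0 ?subr_gt0//; lra.
- have [] := height _ sq; set h := Num.sqrt _ => h0 h2.
  near=> d; have d0 : 0 < d by near: d; exact: nbhs_right_gt.
  have dh : d < h by near: d; exact: nbhs_right_lt.
  set u := d / h; have u0 : 0 < u by rewrite divr_gt0.
  apply: (mem _ (- (s * (1 + u))) (h - d)).
  + by rewrite /u; congr (_ +i* _); ring.
  + lra.
  + have s0 : 0 < s by lra.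
    have su : 0 < s * u by rewrite mulr_gt0.
    have : s ^+ 2 < (s * (1 + u)) ^+ 2 by rewrite ltr_pXn2r ?nnegrE//; lra.
    have : (h - d) ^+ 2 < h ^+ 2 by nra.
    rewrite -(sqrrN (s * (1 + u))) => *; rewrite nmulr_rlt0; first lra.
    by rewrite oppr_lt0 mulr_gt0//; lra.
- have Nsq : q < - s by lra.
  have [] := height _ Nsq; set h := Num.sqrt _ => h0 h2.
  near=> d; have d0 : 0 < d by near: d; exact: nbhs_right_gt.
  have dh : d < h by near: d; exact: nbhs_right_lt.
  apply: (mem _ s d) => //; first by (congr (_ +i* _); ring).
  rewrite nmulr_rlt0; last lra.
  by move: h2; rewrite sqrrN; nra.
Unshelve. all: end_near. Qed.

End Boundary.

(* Main.v *)
(* Parametrised by Re k or Im k, each arc of the boundary of D^+ turns its part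
   of W_b into a superposition of the waves
   exp(-eta(s) x + i (kappa s x + t P(s))) with amplitude \hat\Psi_j(s), that
   is, into an operator applied to \Psi_j.  Since |P''(s)| >= s^2 for s >= 1,
   van der Corput's lemma for |s| >= t^(-1/4) and the trivial estimate for
   smaller s bound its kernel by a multiple of t^(-1/4), which gives
   L^1 -> L^\infty.  The bound L^2 -> L^2 is Plancherel's theorem on the real
   arcs, and on the others, where eta(s) >= s - p, the L^2 boundedness of the
   Laplace transform (Schur's test).  Interpolating gives L^{r'} -> L^r with norm
   of order t^(-(1/4 - 1/(2r))).  As \hat\Psi_j is only assumed integrable, the
   operator is first applied to \Psi_j(y) exp(-epsilon |y|), and epsilon -> 0 by
   Fatou's lemma. *)

Require Import Defs.
From HB Require Import structures.
From mathcomp Require Import all_boot all_order all_algebra.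
From mathcomp Require Import all_classical all_reals all_analysis.
From mathcomp Require Import ess_sup_inf measurable_realfun complex ring lra.

Import Order.TTheory GRing.Theory Num.Theory.
Import numFieldNormedType.Exports.

Local Open Scope classical_set_scope.
Local Open Scope ring_scope.

Set Implicit Arguments.
Unset Strict Implicit.
Unset Printing Implicit Defensive.

(** * Complex-valued integrals *)

(** With $\tau=t^{1/4}$ the phases are $\tau^4P$, and $|\tau^4P''|\ge\tau^2$ once $s\ge1/\tau$; this
    fixes the splitting point, and $t\le1$ puts it in the range $s\ge1$ where $P''$ is controlled.
    The $L^2$ bound is free of $\tau$, so the kernel bound $A=O(1/\tau)$ enters with the power
    $1-2/r$. Interpolation goes by truncation, as in Marcinkiewicz's theorem; its constant blows up
    as $r\to2$, and $r=2$ is kept apart.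

    The obstacle is that $\Psi_j$ need not be integrable, so Fourier inversion cannot be applied to
    it. On the frequency side the factor $e^{-\varepsilon|y|}$ becomes a convolution with a Poisson
    kernel, and this convolution is put on the multiplier, not on $\hat\Psi_j$. Cut off to a compact
    interval, the multiplier is bounded and continuous off two points, so the convolution converges
    almost everywhere. The endpoint singularities and the infinite ends of the arcs are reached
    afterwards, by exhaustion with the same constants. *)

Section ComplexBasics.
Context {R : realType}.
Local Notation Re := complex.Re.
Local Notation Im := complex.Im.
Implicit Types (z u : R[i]).
Local Open Scope complex_scope.

Lemma modulus_ge0 z : 0 <= modulus z.
Proof. by case: z => a b; rewrite /modulus /= sqrtr_ge0. Qed.

Lemma modulusE z : modulus z = Num.sqrt (Re z ^+ 2 + Im z ^+ 2).
Proof. by case: z. Qed.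

Lemma sqr_modulus z : modulus z ^+ 2 = Re z ^+ 2 + Im z ^+ 2.
Proof. by rewrite modulusE sqr_sqrtr// addr_ge0// sqr_ge0. Qed.

Lemma modulusM z u : modulus (z * u) = modulus z * modulus u.
Proof. exact: ComplexField.Normc.normcM. Qed.

Lemma modulusD z u : modulus (z + u) <= modulus z + modulus u.
Proof. exact: le_normcD. Qed.

Lemma modulusN z : modulus (- z) = modulus z.
Proof. exact: normcN. Qed.

Lemma modulus0 : modulus (0 : R[i]) = 0.
Proof. exact: ComplexField.Normc.normc0. Qed.

Lemma modulus_conj z : modulus (z^*)%C = modulus z.
Proof. by case: z => a b; rewrite !modulusE /= sqrrN. Qed.

Lemma modulus_real (x : R) : modulus x%:C = `|x|.
Proof. by rewrite modulusE /= expr0n addr0 sqrtr_sqr. Qed.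

Lemma Re_le_modulus z : `|Re z| <= modulus z.
Proof. by rewrite modulusE -sqrtr_sqr ler_wsqrtr// lerDl sqr_ge0. Qed.

Lemma Im_le_modulus z : `|Im z| <= modulus z.
Proof. by rewrite modulusE -sqrtr_sqr ler_wsqrtr// lerDr sqr_ge0. Qed.

Lemma modulus_le_ReIm z : modulus z <= `|Re z| + `|Im z|.
Proof.
rewrite -ler_sqr ?nnegrE ?modulus_ge0 ?addr_ge0//.
rewrite sqr_modulus -(real_normK (num_real (Re z))) -(real_normK (num_real (Im z))).
by have := mulr_ge0 (normr_ge0 (Re z)) (normr_ge0 (Im z)); nra.
Qed.

Lemma mul_conj z : z * (z^*)%C = (modulus z ^+ 2)%:C.
Proof.
by rewrite sqr_modulus; case: z => a b; rewrite /=; simpc; congr (_ +i* _); ring.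
Qed.

Lemma conj_mul z u : ((z * u)^*)%C = (z^*)%C * (u^*)%C.
Proof. by case: z u => a b [c d]; simpc; congr (_ +i* _); ring. Qed.

Definition expi (th : R) : R[i] := cos th +i* sin th.

Lemma expiD a b : expi (a + b) = expi a * expi b.
Proof.
by rewrite /expi; simpc; rewrite cosD sinD; congr (_ +i* _); ring.
Qed.

Lemma conj_expi a : ((expi a)^*)%C = expi (- a).
Proof. by rewrite /expi cosN sinN. Qed.

Lemma modulus_expi a : modulus (expi a) = 1.
Proof. by rewrite modulusE /= cos2Dsin2 sqrtr1. Qed.

Lemma cexpE z : cexp z = (expR (Re z))%:C * expi (Im z).
Proof. by rewrite /cexp /expi; simpc. Qed.

Lemma cexp_i (r : R) : cexp ('i * r%:C) = expi r.
Proof.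
rewrite cexpE (_ : Re _ = 0 :> R); last by rewrite /= mul0r mul1r subr0 ?oppr0.
by rewrite expR0 mul1r /= mulr0 ?mul0r ?mul1r ?add0r ?addr0.
Qed.

End ComplexBasics.

Section ComplexMeasurable.
Context {R : realType} d (T : measurableType d).
Local Notation Re := complex.Re.
Local Notation Im := complex.Im.
Implicit Types f g : T -> R[i].

Definition cmeas f := measurable_fun setT (fun x => Re (f x)) /\
  measurable_fun setT (fun x => Im (f x)).

Lemma cmeas_modulus f : cmeas f -> measurable_fun setT (fun x => modulus (f x)).
Proof.
move=> [mr mi]; under eq_fun do rewrite modulusE.
apply: (measurableT_comp (continuous_measurable_fun (@sqrt_continuous R))).
by apply: measurable_funD; apply: measurable_funX.
Qed.

Lemma cmeasD f g : cmeas f -> cmeas g -> cmeas (fun x => f x + g x).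
Proof.
move=> [fr fi] [gr gi]; split.
  under eq_fun do rewrite raddfD /=; exact: measurable_funD.
under eq_fun do rewrite raddfD /=; exact: measurable_funD.
Qed.

Lemma cmeasM f g : cmeas f -> cmeas g -> cmeas (fun x => f x * g x).
Proof.
move=> [fr fi] [gr gi]; split.
  rewrite (_ : (fun x => _) = fun x => Re (f x) * Re (g x) - Im (f x) * Im (g x)).
    by apply: measurable_funB; apply: measurable_funM.
  by apply/funext => x; case: (f x) => ? ?; case: (g x).
rewrite (_ : (fun x => _) = fun x => Re (f x) * Im (g x) + Im (f x) * Re (g x)).
  by apply: measurable_funD; apply: measurable_funM.
by apply/funext => x; case: (f x) => ? ?; case: (g x).
Qed.

Lemma cmeas_conj f : cmeas f -> cmeas (fun x => ((f x)^*)%C).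
Proof.
move=> [fr fi]; split.
  by rewrite (_ : (fun x => _) = fun x => Re (f x))//; apply/funext => x; case: (f x).
rewrite (_ : (fun x => _) = fun x => - Im (f x)); first exact: measurableT_comp.
by apply/funext => x; case: (f x).
Qed.

Lemma cmeas_cst z : cmeas (fun=> z).
Proof. by split; exact: measurable_cst. Qed.

Lemma cmeasN f : cmeas f -> cmeas (fun x => - f x).
Proof.
by move=> mf; under eq_fun do rewrite -mulN1r; apply: cmeasM => //; exact: cmeas_cst.
Qed.

Lemma cmeas_real (h : T -> R) : measurable_fun setT h ->
  cmeas (fun x => (h x)%:C%C).
Proof. by move=> mh; split => //=; exact: measurable_cst. Qed.

Lemma cmeas_expi (h : T -> R) : measurable_fun setT h -> cmeas (fun x => expi (h x)).
Proof.
move=> mh; split => /=.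
- exact: (measurableT_comp (continuous_measurable_fun (@continuous_cos R))).
- exact: (measurableT_comp (continuous_measurable_fun (@continuous_sin R))).
Qed.

End ComplexMeasurable.

Lemma cmeas_comp {R : realType} d d' (T : measurableType d) (U : measurableType d')
  (f : T -> R[i]) (h : U -> T) : cmeas f -> measurable_fun setT h ->
  cmeas (fun x => f (h x)).
Proof. by move=> [fr fi] mh; split; [exact: (measurableT_comp fr mh)|exact: (measurableT_comp fi mh)]. Qed.

Section ComplexIntegral.
Context {R : realType}.
Local Notation mu := (@lebesgue_measure R).
Local Notation Re := complex.Re.
Local Notation Im := complex.Im.
Local Notation cint := (@cintegral R setT).
Local Notation cintble := (@cintegrable R setT).
Implicit Types f g : R -> R[i].

(** $|\mathrm{Re}|$ and $|\mathrm{Im}|$ are dominated by the modulus, and the modulus by their sum.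
    From here on integrability is carried by a single nonnegative integral. *)
Lemma cintegrableP f : cintble f <->
  cmeas f /\ (\int[mu]_x (modulus (f x))%:E < +oo)%E.
Proof.
have abs (h : R -> R) : measurable_fun setT h ->
    measurable_fun setT (fun x => (`|h x|)%:E).
  by move=> mh; apply/measurable_EFinP; exact: measurableT_comp.
have lef (h : R -> R) : cmeas f -> measurable_fun setT h ->
    (forall x, `|h x| <= modulus (f x)) ->
    (\int[mu]_x (modulus (f x))%:E < +oo)%E -> mu.-integrable setT (EFin \o h).
  move=> mf mh hf foo; apply/integrableP; split; first exact/measurable_EFinP.
  apply: le_lt_trans foo; apply: ge0_le_integral => //=.
  - exact: abs.
  - by apply/measurable_EFinP; exact: cmeas_modulus.
  - by move=> x _; rewrite lee_fin.
split=> [[ir ii]|[mf foo]]; last first.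
  move: (mf) => [mr mi]; split; apply: lef => // x.
    exact: Re_le_modulus.
  exact: Im_le_modulus.
have [mr mi] : cmeas f.
  by split; apply/measurable_EFinP; exact: measurable_int ir || exact: measurable_int ii.
split=> //.
apply: (@le_lt_trans _ _ (\int[mu]_x ((`|Re (f x)|)%:E + (`|Im (f x)|)%:E))%E).
  apply: ge0_le_integral => //=.
  - by move=> x _; rewrite lee_fin modulus_ge0.
  - by apply/measurable_EFinP; exact: cmeas_modulus.
  - by apply: emeasurable_funD; exact: abs.
  - by move=> x _; rewrite lee_fin modulus_le_ReIm.
rewrite ge0_integralD//=; [|exact: abs..].
by apply: lte_add_pinfty; [case/integrableP: ir|case/integrableP: ii].
Qed.

Lemma cintegrable_le f (h : R -> R) : cmeas f ->
  (forall x, modulus (f x) <= h x) -> mu.-integrable setT (EFin \o h) -> cintble f.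
Proof.
move=> mf fh /integrableP[mh hoo]; apply/cintegrableP; split => //.
apply: le_lt_trans hoo; apply: ge0_le_integral => //=.
- by move=> x _; rewrite lee_fin modulus_ge0.
- by apply/measurable_EFinP; exact: cmeas_modulus.
- by apply/measurable_EFinP; apply: measurableT_comp => //; exact/measurable_EFinP.
- by move=> x _; rewrite lee_fin (le_trans (fh x))// ler_norm.
Qed.

Lemma cintegrable_modulus f : cintble f ->
  mu.-integrable setT (EFin \o (fun x => modulus (f x))).
Proof.
move=> /cintegrableP[mf foo]; apply/integrableP; split.
  by apply/measurable_EFinP; exact: cmeas_modulus.
by apply: le_lt_trans foo; under eq_integral do rewrite /= ger0_norm ?modulus_ge0//.
Qed.

Lemma cintegrable_leZ f g (M : R) : cmeas f ->
  (forall x, modulus (f x) <= M * modulus (g x)) -> cintble g -> cintble f.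
Proof.
move=> mf fg ig; apply: (cintegrable_le mf fg).
rewrite (_ : EFin \o _ = (fun x => M%:E * (EFin \o (fun x => modulus (g x))) x)%E)//.
by apply: integrableZl => //; exact: cintegrable_modulus.
Qed.

Lemma cintegrable_meas f : cintble f -> cmeas f.
Proof. by move/cintegrableP => []. Qed.

Lemma cintegrableD f g : cintble f -> cintble g -> cintble (fun x => f x + g x).
Proof.
move=> [fr fi] [gr gi]; split.
  rewrite (_ : EFin \o _ = (EFin \o (fun s => Re (f s))) \+ (EFin \o (fun s => Re (g s))))%E.
    exact: integrableD.
  by apply/funext => x; rewrite /= raddfD.
rewrite (_ : EFin \o _ = (EFin \o (fun s => Im (f s))) \+ (EFin \o (fun s => Im (g s))))%E.
  exact: integrableD.
by apply/funext => x; rewrite /= raddfD.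
Qed.

Lemma cintegrableM_bounded f g (M : R) : cmeas f -> (forall x, modulus (f x) <= M) ->
  cintble g -> cintble (fun x => f x * g x).
Proof.
move=> mf fM ig; apply: (@cintegrable_leZ _ g M) => //.
  by apply: cmeasM => //; exact: cintegrable_meas.
by move=> x; rewrite modulusM ler_wpM2r// modulus_ge0.
Qed.

Lemma cintegrableZ f z : cintble f -> cintble (fun x => z * f x).
Proof.
move=> ig; apply: (@cintegrableM_bounded (fun=> z) f (modulus z)) => //.
Qed.

Lemma cintegrable_conj f : cintble f -> cintble (fun x => ((f x)^*)%C).
Proof.
move=> ig; apply: (@cintegrable_leZ _ f 1) => //.
  by apply: cmeas_conj; exact: cintegrable_meas.
by move=> x; rewrite modulus_conj mul1r.
Qed.

Lemma eq_cint f g : (forall x, f x = g x) -> cint f = cint g.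
Proof. by move=> fg; congr cintegral; apply/funext. Qed.

Lemma cintD f g : cintble f -> cintble g ->
  cint (fun x => f x + g x) = cint f + cint g.
Proof.
move=> [fr fi] [gr gi]; rewrite /cintegral.
have ReD x : Re (f x + g x) = Re (f x) + Re (g x) by case: (f x); case: (g x).
have ImD x : Im (f x + g x) = Im (f x) + Im (g x) by case: (f x); case: (g x).
simpc; congr (_ +i* _)%C.
  by under eq_Rintegral do rewrite ReD; rewrite RintegralD.
by under eq_Rintegral do rewrite ImD; rewrite RintegralD.
Qed.

Lemma cintZ f z : cintble f -> cint (fun x => z * f x) = z * cint f.
Proof.
move=> [fr fi]; case: z => a b; rewrite /cintegral /=; simpc.
have ReE x : Re ((a +i* b)%C * f x) = a * Re (f x) - b * Im (f x) by case: (f x).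
have ImE x : Im ((a +i* b)%C * f x) = a * Im (f x) + b * Re (f x) by case: (f x).
have iZ (h : R -> R) c : mu.-integrable setT (EFin \o h) ->
    mu.-integrable setT (EFin \o (fun x => c * h x)).
  move=> ih; rewrite (_ : EFin \o _ = (fun x => c%:E * (EFin \o h) x)%E)//.
  exact: integrableZl.
congr (_ +i* _)%C.
  under eq_Rintegral do rewrite ReE.
  by rewrite RintegralB// ?RintegralZl//; exact: iZ.
under eq_Rintegral do rewrite ImE.
by rewrite RintegralD// ?RintegralZl//; exact: iZ.
Qed.

Lemma cint_conj f : cintble f -> cint (fun x => ((f x)^*)%C) = ((cint f)^*)%C.
Proof.
move=> [fr fi]; rewrite /cintegral /=; congr (_ +i* _)%C.
  by apply: eq_Rintegral => x _; case: (f x).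
transitivity (\int[mu]_x (-1 * Im (f x))).
  by apply: eq_Rintegral => x _; case: (f x) => ? ?; rewrite mulN1r.
by rewrite RintegralZl// mulN1r.
Qed.

(* Rotating by the phase of the integral reduces the triangle inequality to
   the real part. *)
Lemma modulus_cint_le f : cintble f ->
  ((modulus (cint f))%:E <= \int[mu]_x (modulus (f x))%:E)%E.
Proof.
move=> fi; have [z0|z0] := eqVneq (modulus (cint f)) 0.
  by rewrite z0; apply: integral_ge0 => x _; rewrite lee_fin modulus_ge0.
set z := cint f in z0 *.
have zz : 0 < modulus z by rewrite lt_neqAle eq_sym z0 modulus_ge0.
have izf := cintegrableZ (z^*)%C fi.
have sq : modulus z ^+ 2 = \int[mu]_x Re ((z^*)%C * f x).
  have := cintZ (z^*)%C fi; rewrite -/z mulrC mul_conj => /(congr1 (@complex.Re R)) /=.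
  by move=> <-.
have im := cintegrable_modulus fi.
have imz : mu.-integrable setT (EFin \o (fun x => modulus z * modulus (f x))).
  rewrite (_ : EFin \o _ = (fun x => (modulus z)%:E * (EFin \o (fun x => modulus (f x))) x)%E)//.
  exact: integrableZl.
have : modulus z ^+ 2 <= modulus z * \int[mu]_x modulus (f x).
  rewrite sq -RintegralZl//; apply: le_Rintegral => //; first by case: izf.
  move=> x _; apply: le_trans (ler_norm _) _.
  by apply: le_trans (Re_le_modulus _) _; rewrite modulusM modulus_conj.
rewrite expr2 ler_pM2l// => h.
by rewrite -[leRHS]fineK ?lee_fin//; exact: integrable_fin_num im.
Qed.

Lemma modulus_cint_le_fine f : cintble f ->
  modulus (cint f) <= \int[mu]_x (modulus (f x)).
Proof.
move=> fi; have := modulus_cint_le fi.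
by rewrite -[leRHS]fineK ?lee_fin//; exact: integrable_fin_num (cintegrable_modulus fi).
Qed.

End ComplexIntegral.

(** * Changing the order of integration *)

Section Fubini.
Context {R : realType}.
Local Notation mu := (@lebesgue_measure R).
Local Notation Re := complex.Re.
Local Notation Im := complex.Im.
Local Notation cint := (@cintegral R setT).
Local Notation cintble := (@cintegrable R setT).

(** [Rintegral] is [fine] of an extended integral. Integrability of the sections at every point, not
    just almost everywhere, lets the inner [fine] be removed pointwise before Fubini's theorem is
    applied. *)
Lemma Rintegral_Fubini (h : R * R -> R) :
  (mu \x mu)%E.-integrable setT (EFin \o h) ->
  (forall s, mu.-integrable setT (EFin \o (fun y => h (s, y)))) ->
  (forall y, mu.-integrable setT (EFin \o (fun s => h (s, y)))) ->
  \int[mu]_s (\int[mu]_y h (s, y)) = \int[mu]_y (\int[mu]_s h (s, y)).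
Proof.
move=> ih h1 h2; rewrite /Rintegral; congr fine.
transitivity (\int[mu]_s \int[mu]_y (EFin \o h) (s, y))%E.
  by apply: eq_integral => s _; rewrite fineK//; exact: integrable_fin_num (h1 s).
rewrite Fubini//.
by apply: eq_integral => y _; rewrite fineK//; exact: integrable_fin_num (h2 y).
Qed.

Lemma cint_Fubini (h : R * R -> R[i]) : cmeas h ->
  (\int[mu]_s \int[mu]_y (modulus (h (s, y)))%:E < +oo)%E ->
  (forall s, cintble (fun y => h (s, y))) ->
  (forall y, cintble (fun s => h (s, y))) ->
  cint (fun s => cint (fun y => h (s, y))) = cint (fun y => cint (fun s => h (s, y))).
Proof.
move=> mh hoo h1 h2; have [mr mi] := mh.
have H (g : R * R -> R) : measurable_fun setT g ->
    (forall z, `|g z| <= modulus (h z)) -> (mu \x mu)%E.-integrable setT (EFin \o g).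
  move=> mg gh; apply/integrable12ltyP; first exact/measurable_EFinP.
  have ma : measurable_fun setT (fun z => `|(EFin \o g) z|%E).
    by apply: measurableT_comp => //; exact/measurable_EFinP.
  have mm : measurable_fun setT (fun z => (modulus (h z))%:E).
    by apply/measurable_EFinP; exact: cmeas_modulus.
  apply: le_lt_trans hoo; apply: ge0_le_integral => //=.
  - by move=> s _; apply: integral_ge0.
  - exact: (measurable_fun_fubini_tonelli_F (m2 := mu) (fun z => `|(EFin \o g) z|%E)).
  - apply: (measurable_fun_fubini_tonelli_F (m2 := mu) (fun z => (modulus (h z))%:E)) => //.
    by move=> z; rewrite lee_fin modulus_ge0.
  - move=> s _; apply: ge0_le_integral => //=.
    + by apply: (measurableT_comp ma) => //; exact: measurable_pair1.
    + by apply: (measurableT_comp mm) => //; exact: measurable_pair1.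
    + by move=> y _; rewrite lee_fin.
rewrite /cintegral; apply: (f_equal2 (@Complex R)).
- apply: (@Rintegral_Fubini (fun z => Re (h z))).
  + by apply: H => // z; exact: Re_le_modulus.
  + by move=> s; case: (h1 s).
  + by move=> y; case: (h2 y).
- apply: (@Rintegral_Fubini (fun z => Im (h z))).
  + by apply: H => // z; exact: Im_le_modulus.
  + by move=> s; case: (h1 s).
  + by move=> y; case: (h2 y).
Qed.

(** A bounded kernel between two integrable functions: $\iint|p||k||q|\le M\|p\|_1\|q\|_1$. The
    later exchanges of complex integrals are instances in which [k] is an exponential of modulus
    one. *)
Lemma cint_swap (p q : R -> R[i]) (k : R * R -> R[i]) (M : R) :
  cintble p -> cintble q -> cmeas k -> (forall z, modulus (k z) <= M) ->
  cint (fun s => p s * cint (fun y => k (s, y) * q y)) =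
  cint (fun y => q y * cint (fun s => k (s, y) * p s)).
Proof.
move=> ip iq mk kM.
have mp := cintegrable_meas ip; have mq := cintegrable_meas iq.
have M0 : 0 <= M by apply: le_trans (kM (0, 0)); exact: modulus_ge0.
have ikq s : cintble (fun y => k (s, y) * q y).
  apply: (cintegrableM_bounded (M := M)) => //.
  by apply: (cmeas_comp mk); exact: measurable_pair1.
have ikp y : cintble (fun s => k (s, y) * p s).
  apply: (cintegrableM_bounded (M := M)) => //.
  by apply: (cmeas_comp mk); exact: measurable_pair2.
pose h z := p z.1 * (k z * q z.2).
have hE s y : h (s, y) = q y * (k (s, y) * p s) by rewrite /h /=; ring.
transitivity (cint (fun s => cint (fun y => h (s, y)))).
  by apply: eq_cint => s; rewrite -cintZ.
transitivity (cint (fun y => cint (fun s => h (s, y)))); last first.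
  by apply: eq_cint => y; rewrite -cintZ//; apply: eq_cint => s; rewrite hE.
apply: cint_Fubini.
- apply: cmeasM; first exact: cmeas_comp mp measurable_fst.
  by apply: cmeasM => //; exact: cmeas_comp mq measurable_snd.
- have mpm : measurable_fun setT (fun s => (modulus (p s))%:E).
    by apply/measurable_EFinP; exact: cmeas_modulus.
  have mqm : measurable_fun setT (fun s => (modulus (q s))%:E).
    by apply/measurable_EFinP; exact: cmeas_modulus.
  have mhm : measurable_fun setT (fun z => (modulus (h z))%:E).
    apply/measurable_EFinP; apply: cmeas_modulus.
    apply: cmeasM; first exact: cmeas_comp mp measurable_fst.
    by apply: cmeasM => //; exact: cmeas_comp mq measurable_snd.
  apply: (@le_lt_trans _ _ (\int[mu]_s ((modulus (p s))%:E *
      (M%:E * \int[mu]_y (modulus (q y))%:E)))%E).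
    apply: ge0_le_integral => //.
    + by move=> s _; apply: integral_ge0 => y _; rewrite lee_fin modulus_ge0.
    + apply: (measurable_fun_fubini_tonelli_F (m2 := mu) (fun z => (modulus (h z))%:E)) => //.
      by move=> z; rewrite lee_fin modulus_ge0.
    + by apply: emeasurable_funM => //; exact: measurable_cst.
    + move=> s _; rewrite -ge0_integralZl//; last first.
        by move=> y _; rewrite lee_fin modulus_ge0.
      rewrite -ge0_integralZl//; last 3 first.
        by apply: emeasurable_funM => //; exact: measurable_cst.
        by move=> y _; rewrite mule_ge0// lee_fin modulus_ge0.
        by rewrite lee_fin modulus_ge0.
      apply: ge0_le_integral => //.
      * by move=> y _; rewrite lee_fin modulus_ge0.
      * by apply: (measurableT_comp mhm) => //; exact: measurable_pair1.
      * apply: emeasurable_funM; first exact: measurable_cst.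
        by apply: emeasurable_funM => //; exact: measurable_cst.
      * move=> y _; rewrite -!EFinM lee_fin /h /= !modulusM.
        rewrite ler_wpM2l ?modulus_ge0// ler_wpM2r ?modulus_ge0//.
  rewrite ge0_integralZr//.
  + rewrite lte_mul_pinfty//.
    * by apply: integral_ge0 => s _; rewrite lee_fin modulus_ge0.
    * by have [_] := (cintegrableP p).1 ip; rewrite ge0_fin_numE// integral_ge0// => s _; rewrite lee_fin modulus_ge0.
    * by rewrite lte_mul_pinfty//; have [_] := (cintegrableP q).1 iq.
  + by move=> s _; rewrite lee_fin modulus_ge0.
  + by rewrite mule_ge0// integral_ge0// => y _; rewrite lee_fin modulus_ge0.
- by move=> s; exact: (cintegrableZ (p s) (ikq s)).
- move=> y; rewrite (_ : (fun s => _) = fun s => q y * (k (s, y) * p s)).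
    exact: (cintegrableZ (q y) (ikp y)).
  by apply/funext => s.
Qed.

End Fubini.

(** * Derivatives with explicit values *)

Section DerivativeRules.
Context {R : realType}.
Implicit Types (f g : R -> R) (x a b : R).

Lemma isd_id x : is_derive x 1 (fun s : R => s) 1.
Proof. exact: is_derive_id. Qed.

Lemma isd_cst c x : is_derive x 1 (fun=> c : R) 0.
Proof. exact: is_derive_cst. Qed.

Lemma isd_add f g x a b : is_derive x 1 f a -> is_derive x 1 g b ->
  is_derive x 1 (fun s => f s + g s) (a + b).
Proof. by move=> fa gb; exact: is_deriveD. Qed.

Lemma isd_opp f x a : is_derive x 1 f a -> is_derive x 1 (fun s => - f s) (- a).
Proof. by move=> fa; exact: is_deriveN. Qed.

Lemma isd_sub f g x a b : is_derive x 1 f a -> is_derive x 1 g b ->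
  is_derive x 1 (fun s => f s - g s) (a - b).
Proof. by move=> fa gb; exact: is_deriveB. Qed.

Lemma isd_mul f g x a b : is_derive x 1 f a -> is_derive x 1 g b ->
  is_derive x 1 (fun s => f s * g s) (a * g x + f x * b).
Proof.
move=> fa gb; apply: (is_derive_eq (is_deriveM fa gb)).
by rewrite /GRing.scale /=; ring.
Qed.

Lemma isd_scale c x : is_derive x 1 (fun s : R => c * s) c.
Proof.
have := isd_mul (isd_cst c x) (isd_id x).
by rewrite mul0r add0r mulr1.
Qed.

Lemma isd_comp f g x a b : is_derive (g x) 1 f a -> is_derive x 1 g b ->
  is_derive x 1 (fun s => f (g s)) (a * b).
Proof. by move=> fa gb; exact: is_derive1_comp. Qed.

Lemma isd_exp g x b : is_derive x 1 g b ->
  is_derive x 1 (fun s => expR (g s)) (expR (g x) * b).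
Proof. by move=> gb; exact: isd_comp. Qed.

Lemma isd_sin g x b : is_derive x 1 g b ->
  is_derive x 1 (fun s => sin (g s)) (cos (g x) * b).
Proof. by move=> gb; exact: isd_comp. Qed.

Lemma isd_cos g x b : is_derive x 1 g b ->
  is_derive x 1 (fun s => cos (g s)) (- sin (g x) * b).
Proof. by move=> gb; exact: isd_comp. Qed.

Lemma isd_atan g x b : is_derive x 1 g b ->
  is_derive x 1 (fun s => atan (g s)) ((1 + g x ^+ 2)^-1 * b).
Proof. by move=> gb; exact: isd_comp. Qed.

Lemma isd_sqrt g x b : 0 < g x -> is_derive x 1 g b ->
  is_derive x 1 (fun s => Num.sqrt (g s)) ((2 * Num.sqrt (g x))^-1 * b).
Proof. by move=> g0 gb; apply: isd_comp gb; exact: is_derive1_sqrt. Qed.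

Lemma isd_inv g x b : g x != 0 -> is_derive x 1 g b ->
  is_derive x 1 (fun s => (g s)^-1) (- (g x) ^- 2 * b).
Proof.
move=> g0 gb; apply: (is_derive_eq (is_deriveV g0 gb)).
by rewrite /GRing.scale /=.
Qed.

Lemma isd_derive1 f x a : is_derive x 1 f a -> derive1 f x = a.
Proof. by move=> fa; rewrite derive1E; exact: derive_val. Qed.

Lemma isd_continuous f x a : is_derive x 1 f a -> {for x, continuous f}.
Proof. by case=> df _; apply: differentiable_continuous; exact/derivable1_diffP. Qed.

End DerivativeRules.

(** * The substitution $x\mapsto-x$ *)

Section Reflection.
Context {R : realType}.
Local Notation mu := (@lebesgue_measure R).

Lemma ge0_integral_oppr (D : set R) (f : R -> \bar R) : measurable D ->
  measurable_fun D f -> (forall x, D x -> (0 <= f x)%E) ->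
  (\int[mu]_(x in -%R @^-1` D) f (- x)%R = \int[mu]_(x in D) f x)%E.
Proof.
move=> mD mf f0.
transitivity (\int[pushforward mu (-%R : R -> measurableTypeR R)]_(x in D) f x)%E.
  rewrite -[LHS]/(\int[mu]_(x in -%R @^-1` D) (f \o -%R) x)%E.
  rewrite ge0_integral_pushforward//.
  by move=> x; rewrite inE; exact: f0.
by apply: eq_measure_integral => /= A mA AD; exact: lebesgue_measureN.
Qed.

Lemma integral_oppr (D : set R) (f : R -> \bar R) : measurable D ->
  measurable_fun D f ->
  (\int[mu]_(x in -%R @^-1` D) f (- x)%R = \int[mu]_(x in D) f x)%E.
Proof.
move=> mD mf; rewrite integralE [RHS]integralE.
congr (_ - _)%E.
  rewrite -(@ge0_integral_oppr D (f^\+)%E mD (measurable_funepos mf))//.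
  by apply: eq_integral => x _; rewrite !funeposE.
rewrite -(@ge0_integral_oppr D (f^\-)%E mD (measurable_funeneg mf))//.
by apply: eq_integral => x _; rewrite !funenegE.
Qed.

End Reflection.

Lemma cvg0_dominated {R : realType} {T : Type} {F : set_system T} {FF : Filter F}
    (f g : T -> R) (K : R) : (forall x, `|f x| <= K * g x) ->
  g x @[x --> F] --> 0 -> f x @[x --> F] --> 0.
Proof.
move=> fg g0; apply: norm_cvg0.
apply: (@squeeze_cvgr _ _ _ _ (fun=> 0) (fun x => K * g x)).
- by apply: nearW => x; rewrite normr_ge0 fg.
- exact: cvg_cst.
- by rewrite -(mulr0 K); apply: cvgM => //; exact: cvg_cst.
Qed.

(** * Damping, Schur's test and the Fourier transform *)

Section ExponentialDamping.
Context {R : realType}.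
Local Notation mu := (@lebesgue_measure R).
Local Notation cint := (@cintegral R setT).
Local Notation cintble := (@cintegrable R setT).

(** Serves twice: as a convergence factor for Fourier integrals, and, with $s-p$ in place of [eps],
    as the Laplace kernel in the variable $x$. *)
Definition damp (eps s : R) : R := expR (- (eps * `|s|)).

(* The Fourier transform of [damp eps]. *)
Definition poisson (eps v : R) : R := 2 * eps / (eps ^+ 2 + v ^+ 2).

Lemma damp_gt0 eps s : 0 < damp eps s.
Proof. exact: expR_gt0. Qed.

Lemma damp_le1 eps s : 0 <= eps -> damp eps s <= 1.
Proof. by move=> e0; rewrite -expR0 ler_expR oppr_le0 mulr_ge0. Qed.

Lemma dampD b c s : damp (b + c) s = damp b s * damp c s.
Proof. by rewrite /damp -expRD; congr expR; ring. Qed.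

Lemma continuous_damp eps : continuous (damp eps).
Proof.
move=> s; rewrite /damp; apply: continuous_comp; last exact: continuous_expR.
by apply: cvgN; apply: cvgM; [exact: cvg_cst|exact: norm_continuous].
Qed.

Lemma measurable_damp eps : measurable_fun setT (damp eps).
Proof. exact: continuous_measurable_fun (@continuous_damp eps). Qed.

Lemma poisson_ge0 eps v : 0 <= eps -> 0 <= poisson eps v.
Proof. by move=> e0; rewrite divr_ge0 ?mulr_ge0 ?addr_ge0 ?sqr_ge0. Qed.

Lemma poissonN eps v : poisson eps (- v) = poisson eps v.
Proof. by rewrite /poisson sqrrN. Qed.

Lemma continuous_poisson eps : 0 < eps -> continuous (poisson eps).
Proof.
move=> e0 v; rewrite /poisson.
apply: cvgM; first exact: cvg_cst.
apply: cvgV; first by rewrite gt_eqF// ltr_wpDr ?sqr_ge0// exprn_gt0.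
by apply: cvgD; [exact: cvg_cst|under eq_fun do rewrite expr2; rewrite expr2; apply: cvgM; exact: cvg_id].
Qed.

Lemma continuous_poissonB eps v : 0 < eps -> continuous (fun y => poisson eps (v - y)).
Proof.
move=> e0 y; apply: (@continuous_comp _ _ _ (fun y => v - y) (poisson eps)).
  by apply: cvgB; [exact: cvg_cst|exact: cvg_id].
exact: continuous_poisson.
Qed.

Lemma cvg_expR_cstN (eps : R) : 0 < eps -> expR (- (eps * s)) @[s --> +oo%R] --> 0.
Proof.
move=> e0.
rewrite (_ : (fun s => _) = (fun z : R => expR (- z)) \o (fun s => eps * s))//.
apply: (@cvg_comp _ _ _ _ _ _ (pinfty_nbhs R)); last exact: cvgr_expR.
exact: gt0_cvgMry.
Qed.

(** Adding $1$ to the cosine makes the integrand nonnegative, so evenness and the fundamental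
    theorem on a half-line apply without prior integrability. The case $v=0$ gives
    $\int\rho_\varepsilon$, and subtracting it leaves the cosine transform. *)
Lemma integral_damp_1Dcos (eps v : R) : 0 < eps ->
  (\int[mu]_s (damp eps s * (1 + cos (v * s)))%:E = (2 / eps + poisson eps v)%:E)%E.
Proof.
move=> e0.
have ev : eps ^+ 2 + v ^+ 2 != 0 by rewrite gt_eqF// ltr_wpDr ?sqr_ge0// exprn_gt0.
have cos1 (x : R) : 0 <= 1 + cos x by have := cos_geN1 x; lra.
have cf (g : R -> R) : continuous g -> continuous (fun s => g s * (1 + cos (v * s))).
  move=> cg s; apply: cvgM; first exact: cg.
  apply: cvgD; first exact: cvg_cst.
  apply: (continuous_comp _ (@continuous_cos R _)).
  by apply: cvgM; [exact: cvg_cst|exact: cvg_id].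
rewrite ge0_symfun_integralT; last 3 first.
- by move=> s; rewrite mulr_ge0// ltW// damp_gt0.
- exact/cf/continuous_damp.
- by move=> s /=; rewrite /damp normrN mulrN cosN.
pose F (s : R) : R := - (expR (- (eps * s)) / eps) +
  expR (- (eps * s)) * ((v * sin (v * s) - eps * cos (v * s)) / (eps ^+ 2 + v ^+ 2)).
have de (s : R) : is_derive s 1 (fun s => expR (- (eps * s))) (expR (- (eps * s)) * (- eps)).
  by apply: isd_exp; apply: isd_opp; exact: isd_scale.
have dF (s : R) : is_derive s 1 F (expR (- (eps * s)) * (1 + cos (v * s))).
  have dv := isd_scale v s.
  rewrite /F; apply: is_derive_eq; rewrite /GRing.scale /=.
  by field; rewrite ev gt_eqF.
rewrite -set_itvcy (_ : (\int[_]_(_ in _) _)%E =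
    (\int[mu]_(s in `[0%R, +oo[) (expR (- (eps * s)) * (1 + cos (v * s)))%:E)%E); last first.
  apply: eq_integral => s; rewrite inE /= in_itv /= andbT => s0.
  by rewrite /damp ger0_norm.
rewrite (@ge0_continuous_FTC2y _ _ F _ 0).
- rewrite /F !mulr0 oppr0 expR0 sin0 cos0 -EFinB -EFinM /poisson; congr EFin.
  by field; rewrite ev gt_eqF.
- by move=> s _; rewrite mulr_ge0// ltW// expR_gt0.
- apply: continuous_subspaceT; apply: cf => s.
  exact: isd_continuous (de s).
- apply: (cvg0_dominated (g := fun s => expR (- (eps * s)))
    (K := eps^-1 + (`|v| + eps) / (eps ^+ 2 + v ^+ 2))); last exact: cvg_expR_cstN.
  move=> s; rewrite /F -mulrN -mulrDr normrM ger0_norm ?expR_ge0// mulrC.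
  rewrite ler_wpM2r ?expR_ge0//; apply: le_trans (ler_normD _ _) _.
  rewrite normrN gtr0_norm ?invr_gt0// lerD2l normrM normfV.
  have ev0 : 0 <= eps ^+ 2 + v ^+ 2 by rewrite addr_ge0// sqr_ge0.
  rewrite (ger0_norm ev0) ler_wpM2r ?invr_ge0//; apply: le_trans (ler_normB _ _) _.
  rewrite !normrM (gtr0_norm e0); apply: lerD; rewrite ler_piMr ?normr_ge0 ?(ltW e0)//.
    by rewrite ler_norml sin_geN1 sin_le1.
  by rewrite ler_norml cos_geN1 cos_le1.
- by move=> s _; case: (dF s).
- by apply: cvg_at_right_filter; exact: isd_continuous (dF 0).
- by move=> s _; rewrite (isd_derive1 (dF s)).
Qed.

Lemma integral_damp eps : 0 < eps ->
  (\int[mu]_s (damp eps s)%:E = (2 / eps)%:E)%E.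
Proof.
move=> e0; have := integral_damp_1Dcos 0 e0.
under eq_integral do rewrite mul0r cos0 mulrDr mulr1 EFinD.
rewrite ge0_integralD//; last 4 first.
- by move=> s _; rewrite lee_fin ltW// damp_gt0.
- by apply/measurable_EFinP; exact: measurable_damp.
- by move=> s _; rewrite lee_fin ltW// damp_gt0.
- by apply/measurable_EFinP; exact: measurable_damp.
rewrite (_ : 2 / eps + poisson eps 0 = 2 / eps + 2 / eps); last first.
  by rewrite /poisson; field; rewrite gt_eqF.
case: (\int[mu]_s _)%E => // x.
by rewrite -EFinD => -[h]; congr EFin; lra.
Qed.

Lemma integrable_damp eps : 0 < eps -> mu.-integrable setT (EFin \o damp eps).
Proof.
move=> e0; apply/integrableP; split.
  by apply/measurable_EFinP; exact: measurable_damp.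
under eq_integral do rewrite /= ger0_norm ?(ltW (damp_gt0 _ _))//.
by rewrite integral_damp// ltry.
Qed.

Lemma cintegrable_expi_damp eps v : 0 < eps ->
  cintble (fun s => expi (v * s) * (damp eps s)%:C%C).
Proof.
move=> e0; apply: (@cintegrable_le _ _ (damp eps)); last exact: integrable_damp.
  apply: cmeasM; last by apply: cmeas_real; exact: measurable_damp.
  by apply: cmeas_expi; apply: measurable_funM.
by move=> s; rewrite modulusM modulus_expi mul1r modulus_real ger0_norm// ltW// damp_gt0.
Qed.

Lemma cint_expi_damp eps v : 0 < eps ->
  cint (fun s => expi (v * s) * (damp eps s)%:C%C) = (poisson eps v)%:C%C.
Proof.
move=> e0; have [ir ii] := cintegrable_expi_damp v e0.
have id := integrable_damp e0.
have ReE s : complex.Re (expi (v * s) * (damp eps s)%:C%C) = damp eps s * cos (v * s).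
  by rewrite /= mulr0 subr0 mulrC.
have ImE s : complex.Im (expi (v * s) * (damp eps s)%:C%C) = damp eps s * sin (v * s).
  by rewrite /= mulr0 add0r mulrC.
rewrite /cintegral; congr (_ +i* _)%C.
  have := integral_damp_1Dcos v e0.
  under eq_integral do rewrite mulrDr mulr1 -ReE EFinD.
  rewrite integralD//= integral_damp// /Rintegral.
  rewrite -[X in (_ + X = _)%E]fineK; last exact: integrable_fin_num ir.
  by rewrite -EFinD => -[] /addrI.
rewrite /Rintegral.
set I := (\int[mu]_(s in setT) _)%E.
(* The sine part is odd: reflection gives $I=-I$, and $I$ is finite. *)
have IN : I = (- I)%E.
  rewrite {1}/I -(integral_oppr (D := setT))//=; last exact: measurable_int ii.
  rewrite preimage_setT /I -integralN; last first.
    by apply: integrable_add_def.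
  apply: eq_integral => s _; rewrite ImE /= mulr0 add0r /damp normrN.
  by rewrite mulrN sinN mulNr mulrC.
have Ifin : I \is a fin_num by exact: integrable_fin_num ii.
by have := congr1 fine IN; rewrite fineN; lra.
Qed.

(** The primitive $2\arctan((y-v)/\varepsilon)$ gives $\pi$ on the half-line to the right of the
    peak. The left half-line is reflected to the right half-line of the peak $-v$. *)
Lemma integral_poisson eps v : 0 < eps ->
  (\int[mu]_y (poisson eps (v - y))%:E = (2 * pi)%:E)%E.
Proof.
move=> e0.
have dF (w y : R) : is_derive y 1 (fun y => 2 * atan ((y - w) / eps)) (poisson eps (w - y)).
  apply: is_derive_eq; rewrite /GRing.scale /= /poisson.
  field; rewrite ?gt_eqF//.
  by rewrite ltr_wpDr ?sqr_ge0// exprn_gt0.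
have half w : (\int[mu]_(y in `[w, +oo[) (poisson eps (w - y))%:E = pi%:E)%E.
  rewrite (@ge0_continuous_FTC2y _ _ (fun y => 2 * atan ((y - w) / eps)) _ pi).
  - by rewrite subrr mul0r atan0 mulr0 sube0.
  - by move=> y _; rewrite poisson_ge0// ltW.
  - by apply: continuous_subspaceT; exact: continuous_poissonB.
  - rewrite [X in _ --> X](_ : pi = 2 * (pi / 2)); last by field.
    apply: cvgM; first exact: cvg_cst.
    rewrite (_ : (fun y => _) = atan \o (fun y => (y - w) / eps))//.
    apply: (@cvg_comp _ _ _ _ _ _ (pinfty_nbhs R)); last exact: cvgy_atan.
    by apply: gt0_cvgMly; [rewrite invr_gt0|exact: cvg_addrr].
  - by move=> y _; case: (dF w y).
  - by apply: cvg_at_right_filter; exact: isd_continuous (dF w w).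
  - by move=> y _; exact: isd_derive1 (dF w y).
have mp (D : set R) : measurable_fun D (fun y => (poisson eps (v - y))%:E).
  by apply/measurable_EFinP; apply: measurable_funTS; exact: continuous_measurable_fun (continuous_poissonB e0).
rewrite -(setUv `[v, +oo[%classic) ge0_integral_setU//=; last 4 first.
- exact: measurableC.
- by rewrite setUv; exact: mp.
- by move=> y _; rewrite lee_fin poisson_ge0// ltW.
- exact/disj_setPCl.
rewrite half setCitvr integral_itv_bndo_bndc; last exact: mp.
have -> : `]-oo, v]%classic = -%R @^-1` `[- v, +oo[%classic.
  by rewrite opp_preimage_itvbndy opprK.
transitivity (pi%:E + \int[mu]_(y in `[(- v)%R, +oo[) (poisson eps (- v - y))%:E)%E.
  congr (_ + _)%E.
  rewrite -(ge0_integral_oppr (D := `[- v, +oo[%classic))//=.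
  - by apply: eq_integral => y _; rewrite -poissonN; congr (poisson _ _)%:E; ring.
  - apply/measurable_EFinP; apply: measurable_funTS; apply: continuous_measurable_fun.
    exact: continuous_poissonB.
  - by move=> y _; rewrite lee_fin poisson_ge0// ltW.
by rewrite half -EFinD; congr EFin; ring.
Qed.

End ExponentialDamping.

(** * Schur's test for nonnegative kernels *)

Section Schur.
Context {R : realType}.
Local Notation mu := (@lebesgue_measure R).

(* Schur's test: [K] is the kernel weighted by the quotient of the test
   function at its two arguments. *)
Lemma schur_test (a : R -> R) (k K : R * R -> R) (B : R) :
  measurable_fun setT a -> (forall y, 0 <= a y) ->
  measurable_fun setT k -> (forall z, 0 <= k z) ->
  measurable_fun setT K -> (forall z, 0 <= K z) ->
  (forall y y', a y * a y' * k (y, y') <=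
     2^-1 * (a y ^+ 2 * K (y, y') + a y' ^+ 2 * K (y', y))) ->
  (forall y, (\int[mu]_y' (K (y, y'))%:E <= B%:E)%E) ->
  (\int[mu]_y \int[mu]_y' (a y * a y' * k (y, y'))%:E <=
     B%:E * \int[mu]_y (a y ^+ 2)%:E)%E.
Proof.
move=> ma a0 mk k0 mK K0 akK KB.
pose P1 z := (a z.1 ^+ 2 * K z)%:E; pose P2 z := (a z.2 ^+ 2 * K (z.2, z.1))%:E.
have mP1 : measurable_fun setT P1.
  apply/measurable_EFinP; apply: measurable_funM => //.
  by apply: measurable_funX; apply: (measurableT_comp ma); exact: measurable_fst.
have mP2 : measurable_fun setT P2.
  apply/measurable_EFinP; apply: measurable_funM => //.
    by apply: measurable_funX; apply: (measurableT_comp ma); exact: measurable_snd.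
  apply: (measurableT_comp mK); apply: measurable_fun_pair; [exact: measurable_snd|exact: measurable_fst].
have P10 z : (0 <= P1 z)%E by rewrite lee_fin mulr_ge0 ?sqr_ge0.
have P20 z : (0 <= P2 z)%E by rewrite lee_fin mulr_ge0 ?sqr_ge0.
have mL : measurable_fun setT (fun z => (a z.1 * a z.2 * k z)%:E).
  apply/measurable_EFinP; apply: measurable_funM => //; apply: measurable_funM.
    by apply: (measurableT_comp ma); exact: measurable_fst.
  by apply: (measurableT_comp ma); exact: measurable_snd.
have L0 z : (0 <= (a z.1 * a z.2 * k z)%:E)%E by rewrite lee_fin !mulr_ge0.
have mF (f : R * R -> \bar R) : (forall z, (0 <= f z)%E) -> measurable_fun setT f ->
    measurable_fun setT (fun y => \int[mu]_y' f (y, y'))%E.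
  by move=> f0 mf; exact: (measurable_fun_fubini_tonelli_F (m2 := mu) f).
have m1 (f : R * R -> \bar R) y : measurable_fun setT f ->
    measurable_fun setT (fun y' => f (y, y')).
  by move=> mf; apply: (measurableT_comp mf); exact: measurable_pair1.
have S1 : (\int[mu]_y \int[mu]_y' P1 (y, y') <= B%:E * \int[mu]_y (a y ^+ 2)%:E)%E.
  rewrite -ge0_integralZl//; last 3 first.
  - by apply/measurable_EFinP; exact: measurable_funX.
  - by move=> y _; rewrite lee_fin sqr_ge0.
  - by apply: le_trans (KB 0); apply: integral_ge0 => y _; rewrite lee_fin.
  apply: ge0_le_integral => //.
  - by move=> y _; exact: integral_ge0.
  - exact: mF.
  - by apply/measurable_EFinP; apply: measurable_funM => //; exact: measurable_funX.
  - move=> y _; rewrite /P1 /=.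
    under eq_integral do rewrite EFinM.
    rewrite ge0_integralZl//; last 3 first.
    + by apply/measurable_EFinP; apply: (measurableT_comp mK); exact: measurable_pair1.
    + by move=> y' _; rewrite lee_fin.
    + by rewrite lee_fin sqr_ge0.
    by rewrite muleC lee_wpmul2r// lee_fin sqr_ge0.
(* [P2] is [P1] with its arguments exchanged, so Tonelli's theorem gives both the same double
   integral. *)
have S2 : (\int[mu]_y \int[mu]_y' P2 (y, y') <= B%:E * \int[mu]_y (a y ^+ 2)%:E)%E.
  apply: le_trans S1; rewrite le_eqVlt; apply/orP; left; apply/eqP.
  exact: (fubini_tonelli (m1 := mu) (m2 := mu) P2).
have c0 : (0 <= (2^-1 : R)%:E)%E by rewrite lee_fin invr_ge0.
apply: (@le_trans _ _ (\int[mu]_y \int[mu]_y' ((2^-1)%:E * (P1 (y, y') + P2 (y, y'))))%E).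
  apply: ge0_le_integral => //.
  - by move=> y _; apply: integral_ge0 => y' _; exact: (L0 (y, y')).
  - exact: (mF _ L0 mL).
  - apply: (mF (fun z => (2^-1)%:E * (P1 z + P2 z))%E).
      by move=> z; rewrite mule_ge0// adde_ge0.
    by apply: emeasurable_funM; [exact: measurable_cst|exact: emeasurable_funD].
  - move=> y _; apply: ge0_le_integral => //.
    + by move=> y' _; exact: (L0 (y, y')).
    + exact: (m1 _ y mL).
    + apply: emeasurable_funM; first exact: measurable_cst.
      by apply: emeasurable_funD; exact: m1.
    + by move=> y' _; rewrite -EFinD -EFinM lee_fin.
under eq_integral => y _.
  rewrite ge0_integralZl//; last 2 first.
    by apply: emeasurable_funD; exact: m1.
    by move=> y' _; rewrite adde_ge0.
  rewrite ge0_integralD//; [|exact: m1..].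
  over.
rewrite ge0_integralZl//; last 2 first.
- by apply: emeasurable_funD; exact: mF.
- by move=> y _; rewrite adde_ge0// integral_ge0.
rewrite ge0_integralD//; [|by move=> y _; exact: integral_ge0|exact: mF|by move=> y _; exact: integral_ge0|exact: mF].
apply: (@le_trans _ _ ((2^-1)%:E * (B%:E * \int[mu]_y (a y ^+ 2)%:E + B%:E * \int[mu]_y (a y ^+ 2)%:E))%E).
  by apply: lee_wpmul2l; [rewrite lee_fin|exact: leeD].
have : (0 <= B%:E * \int[mu]_y (a y ^+ 2)%:E)%E.
  by apply: le_trans S1; apply: integral_ge0 => y _; exact: integral_ge0.
case: (B%:E * \int[mu]_y (a y ^+ 2)%:E)%E => [x _| |//].
  by rewrite -EFinD -EFinM lee_fin; lra.
by move=> _; exact: leey.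
Qed.

End Schur.

(** * Limits and parameters under the integral sign *)

Section Limits.
Context {R : realType}.
Local Notation mu := (@lebesgue_measure R).
Local Notation cint := (@cintegral R setT).
Local Notation cintble := (@cintegrable R setT).

Lemma fatou_bound (f_ : nat -> R -> \bar R) (f : R -> \bar R) (B : \bar R) :
  (forall n, measurable_fun setT (f_ n)) -> (forall n x, (0 <= f_ n x)%E) ->
  (forall x, f_ n x @[n --> \oo] --> f x) ->
  (forall n, (\int[mu]_x f_ n x <= B)%E) -> (\int[mu]_x f x <= B)%E.
Proof.
move=> mf f0 ff fB.
have -> : (\int[mu]_x f x = \int[mu]_x limn_einf (f_ ^~ x))%E.
  by apply: eq_integral => x _; have [-> _] := cvg_limn_einf_sup (ff x).
apply: le_trans (fatou _ _ _ _) _ => //.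
rewrite limn_einf_lim; apply: lime_le; first exact: is_cvg_einfs.
apply: nearW => n; apply: le_trans (fB n).
by apply: ereal_inf_lbound; exists n => //=.
Qed.

(** Tonelli's theorem gives measurability for nonnegative integrands; it is applied to the positive
    and negative parts of the real and imaginary parts. *)
Lemma cmeas_cint_param (h : R * R -> R[i]) : cmeas h ->
  cmeas (fun x => cint (fun s => h (s, x))).
Proof.
move=> [mr mi].
have H (g : R * R -> R) : measurable_fun setT g ->
    measurable_fun setT (fun x => \int[mu]_s g (s, x)).
  move=> mg; rewrite /Rintegral.
  apply: measurableT_comp; first exact: fine_measurable.
  under eq_fun do rewrite integralE.
  have mge : measurable_fun setT (EFin \o g) by exact/measurable_EFinP.
  apply: emeasurable_funB.
    rewrite (_ : (fun x => _) = fun x => \int[mu]_s ((EFin \o g)^\+%E (s, x)))%E.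
      apply: (measurable_fun_fubini_tonelli_G (m1 := mu) ((EFin \o g)^\+)%E) => //.
      exact: measurable_funepos.
    by apply/funext => x; apply: eq_integral => s _; rewrite !funeposE.
  rewrite (_ : (fun x => _) = fun x => \int[mu]_s ((EFin \o g)^\-%E (s, x)))%E.
    apply: (measurable_fun_fubini_tonelli_G (m1 := mu) ((EFin \o g)^\-)%E) => //.
    exact: measurable_funeneg.
  by apply/funext => x; apply: eq_integral => s _; rewrite !funenegE.
by split; [exact: (H (fun z => complex.Re (h z)))|exact: (H (fun z => complex.Im (h z)))].
Qed.

(** Real dominated convergence is applied to $|f_n-f|$, which tends to $0$ almost everywhere and is
    at most $h+|f|$. *)
Lemma cint_dominated_cvg (f_ : nat -> R -> R[i]) (f : R -> R[i]) (h : R -> R) :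
  (forall n, cmeas (f_ n)) -> cintble f ->
  {ae mu, forall x, modulus (f_ n x - f x) @[n --> \oo] --> 0} ->
  (forall n x, modulus (f_ n x) <= h x) -> mu.-integrable setT (EFin \o h) ->
  modulus (cint (f_ n) - cint f) @[n --> \oo] --> 0.
Proof.
move=> mf_ fi ff fh hi.
have mf := cintegrable_meas fi.
have f_i n : cintble (f_ n) by exact: cintegrable_le (mf_ n) (fh n) hi.
pose d n x := modulus (f_ n x - f x).
have md n : measurable_fun setT (EFin \o d n).
  apply/measurable_EFinP; apply: cmeas_modulus; apply: cmeasD => //; exact: cmeasN.
pose g x := (h x + modulus (f x)).
have gi : mu.-integrable setT (EFin \o g).
  rewrite (_ : EFin \o g = (EFin \o h) \+ (EFin \o (fun x => modulus (f x))))%E//.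
  by apply: integrableD => //; exact: cintegrable_modulus.
have df : {ae mu, forall x, setT x -> (EFin \o d n) x @[n --> \oo] --> (cst 0%E) x}.
  have [N [mN N0 sN]] := ff; exists N; split => //; apply: subset_trans sN.
  by apply: subsetC => x fx _; apply: cvg_EFin => //; exact: nearW.
have dg : {ae mu, forall x n, setT x -> (`|(EFin \o d n) x| <= (EFin \o g) x)%E}.
  apply: aeW => x n _ /=; rewrite lee_fin ger0_norm ?modulus_ge0//.
  by apply: le_trans (modulusD _ _) _; rewrite modulusN lerD.
have [_ _ L] := @dominated_convergence _ _ R mu setT measurableT
  (fun n => EFin \o d n) (cst 0%E) (EFin \o g) md (@measurable_cst _ _ _ _ setT 0%E) df gi dg.
rewrite integral0 in L.
have di n : mu.-integrable setT (EFin \o d n).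
  apply: cintegrable_modulus; apply: cintegrableD => //.
  rewrite (_ : (fun x => _) = fun x => (-1) * f x); first exact: cintegrableZ.
  by apply/funext => x; rewrite mulN1r.
have {}L : \int[mu]_x d n x @[n --> \oo] --> 0.
  by move/fine_cvg : L.
apply: (cvg0_dominated (K := 1) _ L) => n.
rewrite mul1r ger0_norm ?modulus_ge0//.
have -> : cint (f_ n) - cint f = cint (fun x => f_ n x - f x).
  rewrite -mulN1r -cintZ// -cintD//; last exact: cintegrableZ.
  by apply: eq_cint => x; rewrite mulN1r.
apply: modulus_cint_le_fine; apply: cintegrableD => //.
rewrite (_ : (fun x => _) = fun x => (-1) * f x); first exact: cintegrableZ.
by apply/funext => x; rewrite mulN1r.
Qed.

End Limits.

(** * Plancherel's inequality for integrable functions *)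

Section FourierTransform.
Context {R : realType}.
Local Notation mu := (@lebesgue_measure R).
Local Notation cint := (@cintegral R setT).
Local Notation cintble := (@cintegrable R setT).

(** The sign [sg] is $-1$ for the Fourier transform and $1$ for its inverse, up to the factor
    $1/(2\pi)$; estimates proved for $sg^2=1$ cover both. *)
Definition ft (sg : R) (u : R -> R[i]) (s : R) : R[i] :=
  cint (fun y => expi (sg * (s * y)) * u y).

Lemma cmeas_expiM (sg : R) : cmeas (fun z : R * R => expi (sg * (z.1 * z.2))).
Proof.
apply: cmeas_expi; apply: measurable_funM => //; apply: measurable_funM.
  exact: measurable_fst.
exact: measurable_snd.
Qed.

Lemma cintegrable_expiM (sg s : R) u : cintble u ->
  cintble (fun y => expi (sg * (s * y)) * u y).
Proof.
move=> iu; apply: (cintegrableM_bounded (M := 1)) => //.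
  by apply: (cmeas_comp (h := fun y => (s, y)) (cmeas_expiM sg)); exact: measurable_pair1.
by move=> y; rewrite modulus_expi.
Qed.

Lemma cmeas_ft sg u : cintble u -> cmeas (ft sg u).
Proof.
move=> iu; apply: (@cmeas_cint_param _ (fun z => expi (sg * (z.2 * z.1)) * u z.1)).
apply: cmeasM; last exact: cmeas_comp (cintegrable_meas iu) measurable_fst.
apply: cmeas_expi; apply: measurable_funM => //; apply: measurable_funM.
  exact: measurable_snd.
exact: measurable_fst.
Qed.

Lemma modulus_ft_le sg u s : cintble u ->
  modulus (ft sg u s) <= \int[mu]_y modulus (u y).
Proof.
move=> iu; apply: le_trans (modulus_cint_le_fine (cintegrable_expiM _ _ iu)) _.
rewrite le_eqVlt; apply/orP; left; apply/eqP; apply: eq_Rintegral => y _.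
by rewrite modulusM modulus_expi mul1r.
Qed.

Lemma cmeas_damp (eps : R) : cmeas (fun s => (damp eps s)%:C%C).
Proof. by apply: cmeas_real; exact: measurable_damp. Qed.

Lemma modulus_damp (eps s : R) : modulus (damp eps s)%:C%C = damp eps s.
Proof. by rewrite modulus_real ger0_norm// ltW// damp_gt0. Qed.

(* $\int |\hat u|^2 \rho_\varepsilon = \iint u(y)\bar u(y')\hat\rho_\varepsilon(y-y')$ *)
Lemma damped_ft_sqrE sg u (eps : R) : sg ^+ 2 = 1 -> 0 < eps -> cintble u ->
  cint (fun s => ((damp eps s)%:C%C * ((ft sg u s)^*)%C) * ft sg u s) =
  cint (fun y => u y * cint (fun y' => (poisson eps (y - y'))%:C%C * ((u y')^*)%C)).
Proof.
move=> sg1 e0 iu; set I1 := \int[mu]_y modulus (u y).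
have ip : cintble (fun s => (damp eps s)%:C%C * ((ft sg u s)^*)%C).
  apply: (@cintegrable_le _ _ (fun s => I1 * damp eps s)).
  - by apply: cmeasM; [exact: cmeas_damp|apply: cmeas_conj; exact: cmeas_ft].
  - move=> s; rewrite modulusM modulus_conj modulus_damp mulrC ler_wpM2r//.
      by rewrite ltW// damp_gt0.
    exact: modulus_ft_le.
  - rewrite (_ : EFin \o _ = (fun x => I1%:E * (EFin \o damp eps) x)%E)//.
    by apply: integrableZl => //; exact: integrable_damp.
have e1 (c : R) (z : R * R) : modulus (expi (c * (z.1 * z.2))) <= 1.
  by rewrite modulus_expi.
rewrite (cint_swap ip iu (cmeas_expiM sg) (e1 sg)).
apply: eq_cint => y; congr (_ * _).
have idy : cintble (fun s => expi (sg * (s * y)) * (damp eps s)%:C%C).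
  rewrite (_ : (fun s => _) = fun s => expi (sg * y * s) * (damp eps s)%:C%C).
    exact: cintegrable_expi_damp.
  by apply/funext => s; congr (expi _ * _); ring.
have := cint_swap idy (cintegrable_conj iu) (cmeas_expiM (- sg)) (e1 (- sg)).
move=> H.
transitivity (cint (fun s => (expi (sg * (s * y)) * (damp eps s)%:C%C) *
    cint (fun y' => expi (- sg * (s * y')) * ((u y')^*)%C))).
  apply: eq_cint => s; rewrite mulrA; congr (_ * _).
  rewrite /ft -cint_conj; last exact: cintegrable_expiM.
  by apply: eq_cint => y'; rewrite conj_mul conj_expi mulNr.
rewrite H.
apply: eq_cint => y'; rewrite mulrC; congr (_ * _).
transitivity (cint (fun s => expi (sg * (y - y') * s) * (damp eps s)%:C%C)).
  by apply: eq_cint => s; rewrite mulrA -expiD; congr (expi _ * _) => /=; ring.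
rewrite (cint_expi_damp _ e0); congr (_%:C)%C.
by rewrite /poisson exprMn sg1 mul1r.
Qed.

Lemma poisson_le (eps v : R) : 0 < eps -> poisson eps v <= 2 / eps.
Proof.
move=> e0; have e2 : 0 < eps ^+ 2 by rewrite exprn_gt0.
have ev : 0 < eps ^+ 2 + v ^+ 2 by rewrite ltr_wpDr ?sqr_ge0.
rewrite /poisson ler_pdivrMr//.
rewrite (_ : 2 / eps * _ = 2 * eps + 2 / eps * v ^+ 2); last by field; rewrite gt_eqF.
by rewrite lerDl mulr_ge0 ?sqr_ge0 ?divr_ge0 ?ltW.
Qed.

Lemma measurable_poissonB (eps : R) : 0 < eps ->
  measurable_fun setT (fun z : R * R => poisson eps (z.1 - z.2)).
Proof.
move=> e0; apply: (measurableT_comp (f := poisson eps)).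
  exact: continuous_measurable_fun (continuous_poisson e0).
by apply: measurable_funB; [exact: measurable_fst|exact: measurable_snd].
Qed.

(** Schur's test with a constant test function: the Poisson kernel is symmetric and has mass $2\pi$
    for every $\varepsilon$, so the bound does not see the damping. Boundedness of $\hat u$ makes
    the damped left-hand side finite, which allows the complex identity to be used. *)
Lemma damped_plancherel_le sg u (eps : R) : sg ^+ 2 = 1 -> 0 < eps -> cintble u ->
  (\int[mu]_s (damp eps s * modulus (ft sg u s) ^+ 2)%:E <=
   (2 * pi)%:E * \int[mu]_y (modulus (u y) ^+ 2)%:E)%E.
Proof.
move=> sg1 e0 iu; have mft := cmeas_ft sg iu; have mu' := cintegrable_meas iu.
set I1 := \int[mu]_y modulus (u y).
have I10 : 0 <= I1 by apply: Rintegral_ge0 => y _; exact: modulus_ge0.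
set F := fun s => damp eps s * modulus (ft sg u s) ^+ 2.
have F0 s : 0 <= F s by rewrite mulr_ge0 ?sqr_ge0// ltW// damp_gt0.
have iF : mu.-integrable setT (EFin \o F).
  apply: (@le_integrable _ _ R mu setT measurableT _ (fun x => (I1 ^+ 2)%:E * (EFin \o damp eps) x)%E).
  - apply/measurable_EFinP; apply: measurable_funM; first exact: measurable_damp.
    by apply: measurable_funX; exact: cmeas_modulus.
  - move=> s _; rewrite /= lee_fin !ger0_norm//; last first.
      by rewrite mulr_ge0 ?sqr_ge0// ltW// damp_gt0.
    rewrite /F mulrC ler_wpM2r ?(ltW (damp_gt0 _ _))//.
    by rewrite ler_sqr ?nnegrE ?modulus_ge0// modulus_ft_le.
  - by apply: integrableZl => //; exact: integrable_damp.
pose g y := cint (fun y' => (poisson eps (y - y'))%:C%C * ((u y')^*)%C).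
have mk : measurable_fun setT (fun z : R * R => poisson eps (z.1 - z.2)).
  exact: measurable_poissonB.
have ig y : cintble (fun y' => (poisson eps (y - y'))%:C%C * ((u y')^*)%C).
  apply: (cintegrableM_bounded (M := 2 / eps)).
  - apply: cmeas_real; apply: continuous_measurable_fun; exact: continuous_poissonB.
  - by move=> y'; rewrite modulus_real ger0_norm ?poisson_le// poisson_ge0// ltW.
  - exact: cintegrable_conj.
have gle y : modulus (g y) <= 2 / eps * I1.
  apply: le_trans (modulus_cint_le_fine (ig y)) _.
  rewrite -RintegralZl//; last exact: cintegrable_modulus.
  apply: le_Rintegral => //.
  - exact: cintegrable_modulus.
  - rewrite (_ : EFin \o _ = (fun x => (2 / eps)%:E * (EFin \o (fun x => modulus (u x))) x)%E)//.
    by apply: integrableZl => //; exact: cintegrable_modulus.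
  - move=> y' _; rewrite modulusM modulus_conj modulus_real ger0_norm ?(poisson_ge0 _ (ltW e0))//.
    by rewrite ler_wpM2r ?modulus_ge0// poisson_le.
have mg : cmeas g.
  apply: (@cmeas_cint_param _ (fun z => (poisson eps (z.2 - z.1))%:C%C * ((u z.1)^*)%C)).
  apply: cmeasM.
    apply: cmeas_real; apply: (measurableT_comp (f := poisson eps)).
      exact: continuous_measurable_fun (continuous_poisson e0).
    by apply: measurable_funB; [exact: measurable_snd|exact: measurable_fst].
  by apply: (cmeas_comp (cmeas_conj mu')); exact: measurable_fst.
have iug : cintble (fun y => u y * g y).
  rewrite (_ : (fun y => _) = fun y => g y * u y); last by apply/funext => y; rewrite mulrC.
  exact: cintegrableM_bounded mg gle iu.
have -> : (\int[mu]_s (F s)%:E = (\int[mu]_s F s)%:E)%E.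
  by rewrite /Rintegral fineK//; exact: integrable_fin_num iF.
have FE : cint (fun s => ((damp eps s)%:C%C * ((ft sg u s)^*)%C) * ft sg u s) =
    (\int[mu]_s F s)%:C%C.
  transitivity (cint (fun s => (F s)%:C%C)).
    by apply: eq_cint => s; rewrite -mulrA [_ * ft _ _ _]mulrC mul_conj -rmorphM.
  by rewrite /cintegral /= /Rintegral integral0.
have : ((\int[mu]_s F s)%R%:E <= \int[mu]_y (modulus (u y * g y))%:E)%E.
  apply: le_trans (modulus_cint_le iug); rewrite lee_fin.
  rewrite -(damped_ft_sqrE sg1 e0 iu) FE modulus_real ger0_norm//.
  by apply: Rintegral_ge0.
move=> /le_trans; apply.
have S := @schur_test R (fun y => modulus (u y)) (fun z => poisson eps (z.1 - z.2))
  (fun z => poisson eps (z.1 - z.2)) (2 * pi) (cmeas_modulus mu') (fun y => modulus_ge0 _)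
  mk (fun z => poisson_ge0 _ (ltW e0)) mk (fun z => poisson_ge0 _ (ltW e0)).
apply: le_trans (S _ _); last first.
- by move=> y; rewrite /= integral_poisson.
- move=> y y' /=; rewrite -(poissonN _ (y' - y)) opprB -mulrDl.
  have := poisson_ge0 (y - y') (ltW e0); set k := poisson _ _ => k0.
  rewrite [leRHS]mulrA ler_wpM2r//.
  by have := sqr_ge0 (modulus (u y) - modulus (u y')); nra.
have mL : measurable_fun setT (fun z : R * R =>
    (modulus (u z.1) * modulus (u z.2) * poisson eps (z.1 - z.2))%:E).
  apply/measurable_EFinP; apply: measurable_funM => //; apply: measurable_funM.
    by apply: (measurableT_comp (cmeas_modulus mu')); exact: measurable_fst.
  by apply: (measurableT_comp (cmeas_modulus mu')); exact: measurable_snd.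
have L0 y y' : 0 <= modulus (u y) * modulus (u y') * poisson eps (y - y').
  by apply: mulr_ge0; [apply: mulr_ge0; exact: modulus_ge0|exact: poisson_ge0 (ltW e0)].
apply: ge0_le_integral => //.
- by move=> y _; rewrite lee_fin modulus_ge0.
- by apply/measurable_EFinP; apply: cmeas_modulus; exact: cmeasM.
- apply: (measurable_fun_fubini_tonelli_F (m2 := mu) (fun z : R * R =>
    (modulus (u z.1) * modulus (u z.2) * poisson eps (z.1 - z.2))%:E)) => //.
  by move=> z; rewrite lee_fin L0.
- move=> y _; rewrite modulusM EFinM.
  apply: (@le_trans _ _ ((modulus (u y))%:E * \int[mu]_y' (modulus ((poisson eps (y - y'))%:C%C * ((u y')^*)%C))%:E)%E).
    by rewrite lee_wpmul2l ?lee_fin ?modulus_ge0//; exact: modulus_cint_le.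
  rewrite -ge0_integralZl//; last 3 first.
  + by apply/measurable_EFinP; apply: cmeas_modulus; exact: cintegrable_meas (ig y).
  + by move=> y' _; rewrite lee_fin modulus_ge0.
  + by rewrite lee_fin modulus_ge0.
  rewrite le_eqVlt; apply/orP; left; apply/eqP; apply: eq_integral => y' _.
  rewrite -EFinM modulusM modulus_conj modulus_real ger0_norm ?(poisson_ge0 _ (ltW e0))//.
  by congr EFin; ring.
Qed.

Lemma cvg_damp (s c : R) : (damp n.+1%:R^-1 s * c)%R @[n --> \oo] --> c.
Proof.
rewrite -[X in _ --> X]mul1r; apply: cvgM; last exact: cvg_cst.
rewrite /damp -[X in _ --> X]expR0; apply: continuous_cvg; first exact: continuous_expR.
rewrite -oppr0; apply: cvgN; rewrite -(mul0r `|s|); apply: cvgM; last exact: cvg_cst.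
exact: cvg_harmonic.
Qed.

(** Fatou's lemma removes the damping. The right-hand side may be $+\infty$, as [u] is only
    integrable. *)
Lemma plancherel_le sg u : sg ^+ 2 = 1 -> cintble u ->
  (\int[mu]_s (modulus (ft sg u s) ^+ 2)%:E <=
   (2 * pi)%:E * \int[mu]_y (modulus (u y) ^+ 2)%:E)%E.
Proof.
move=> sg1 iu; have mft := cmeas_ft sg iu.
apply: (@fatou_bound R (fun n s => (damp n.+1%:R^-1 s * modulus (ft sg u s) ^+ 2)%:E)
  (fun s => (modulus (ft sg u s) ^+ 2)%:E)).
- move=> n; apply/measurable_EFinP; apply: measurable_funM; first exact: measurable_damp.
  by apply: measurable_funX; exact: cmeas_modulus.
- by move=> n s; rewrite lee_fin mulr_ge0 ?sqr_ge0// ltW// damp_gt0.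
- by move=> s; apply: cvg_EFin; [exact: nearW|exact: cvg_damp].
- by move=> n; apply: damped_plancherel_le.
Qed.

End FourierTransform.

(** * Oscillatory and Laplace integrals *)

Section VanDerCorput.
Context {R : realType}.
Local Notation mu := (@lebesgue_measure R).

Lemma within_continuous_for (A : set R) (f : R -> R) :
  (forall s, A s -> {for s, continuous f}) -> {within A, continuous f}.
Proof.
by move=> cf; apply: continuous_in_subspaceT => s; rewrite inE; exact: cf.
Qed.

(** Mean value theorem for $x\mapsto H(x)-\int_a^xf$, whose derivative $h-f$ is nonnegative. Nothing
    is asked of [h] beyond being a derivative and dominating [f]. *)
Lemma Rintegral_le_primitive (f H h : R -> R) (a b : R) : a < b ->
  (forall s, a <= s <= b -> {for s, continuous f}) ->
  (forall s, a <= s <= b -> is_derive s 1 H (h s)) ->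
  (forall s, a <= s <= b -> f s <= h s) ->
  \int[mu]_(s in `[a, b]) f s <= H b - H a.
Proof.
move=> ab cf dH fh.
have cfw : {within `[a, b], continuous f}.
  by apply: within_continuous_for => s /=; rewrite in_itv /=; exact: cf.
have fi : mu.-integrable `[a, b] (EFin \o f).
  by apply: continuous_compact_integrable => //; exact: segment_compact.
pose S x := \int[mu]_(s in `[a, x]) f s.
pose D x := H x - S x.
have dS x : a < x < b -> is_derive x 1 S (f x).
  move=> /andP[ax xb]; have [] := @continuous_FTC1_closed R f a x b xb fi ax.
    by apply: cf; rewrite !ltW.
  by move=> ? <-; rewrite derive1E; apply/derivableP.
have dD x : a < x < b -> is_derive x 1 D (h x - f x).
  move=> axb; apply: isd_sub; [apply: dH|exact: dS].
  by case/andP: axb => ? ?; rewrite !ltW.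
have cD : {within `[a, b], continuous D}.
  have cS := parameterized_integral_continuous (ltW ab) fi.
  have cH : {within `[a, b], continuous H}.
    apply: within_continuous_for => s /=; rewrite in_itv /= => asb.
    exact: isd_continuous (dH s asb).
  by move=> x; apply: cvgB; [exact: cH|exact: cS].
have dD' x : x \in `]a, b[%R -> is_derive x 1 D (h x - f x).
  by rewrite in_itv /=; exact: dD.
have [c] := MVT ab dD' cD; rewrite in_itv /= => /andP[ac cb] E.
have : 0 <= D b - D a.
  by rewrite E mulr_ge0 ?subr_ge0 ?(ltW ab)// fh// !ltW.
rewrite /D /S set_itv1 Rintegral_set1; lra.
Qed.

(** [H] is an approximate primitive of [f], and $Q(b)-Q(a)$ pays for the error: the one-sided bound
    is applied to $f\le h+q$ and to $-f\le q-h$. *)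
Lemma norm_Rintegral_le_primitive (f H Q h q : R -> R) (a b : R) : a < b ->
  (forall s, a <= s <= b -> {for s, continuous f}) ->
  (forall s, a <= s <= b -> is_derive s 1 H (h s)) ->
  (forall s, a <= s <= b -> is_derive s 1 Q (q s)) ->
  (forall s, a <= s <= b -> `|f s - h s| <= q s) ->
  `|\int[mu]_(s in `[a, b]) f s| <= `|H b| + `|H a| + (Q b - Q a).
Proof.
move=> ab cf dH dQ fq.
have U := @Rintegral_le_primitive f (fun x => H x + Q x) (fun x => h x + q x) a b ab cf.
have V := @Rintegral_le_primitive (fun x => - f x) (fun x => Q x - H x) (fun x => q x - h x) a b ab.
have {}U : \int[mu]_(s in `[a, b]) f s <= (H b + Q b) - (H a + Q a).
  apply: U => s asb; first by apply: isd_add; [exact: dH|exact: dQ].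
  by have := fq s asb; rewrite ler_norml; lra.
have {}V : \int[mu]_(s in `[a, b]) (- f s) <= (Q b - H b) - (Q a - H a).
  apply: V => s asb; first by apply: cvgN; exact: cf.
    by apply: isd_sub; [exact: dQ|exact: dH].
  by have := fq s asb; rewrite ler_norml; lra.
have cfw : {within `[a, b], continuous f}.
  by apply: within_continuous_for => s /=; rewrite in_itv /=; exact: cf.
have fi : mu.-integrable `[a, b] (EFin \o f).
  by apply: continuous_compact_integrable => //; exact: segment_compact.
have E : \int[mu]_(s in `[a, b]) (- f s) = - \int[mu]_(s in `[a, b]) f s.
  by under eq_Rintegral do rewrite -mulN1r; rewrite RintegralZl// mulN1r.
rewrite E in V.
have := ler_norm (H b); have := ler_norm (H a).
have := ler_norm (- H b); have := ler_norm (- H a); rewrite !normrN => *.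
by rewrite ler_norml; apply/andP; split; lra.
Qed.

(* With $p(v) = v/(\lambda+v^2)$, the function $a\,p(\theta')\sin\theta$ is
   an approximate primitive of $a\cos\theta$ with no case distinction at the
   stationary point: the error is dominated by the derivative of
   $-a/(2\sqrt\lambda) + 2\lambda^{-1/2}\arctan(\theta'/\sqrt\lambda)$. *)
Lemma van_der_corput_cos (a da th dth ddth : R -> R) (l x y : R) :
  0 < l -> x < y ->
  (forall s, x <= s <= y -> is_derive s 1 a (da s)) ->
  (forall s, x <= s <= y -> is_derive s 1 th (dth s)) ->
  (forall s, x <= s <= y -> is_derive s 1 dth (ddth s)) ->
  (forall s, x <= s <= y -> 0 <= a s <= 1) ->
  (forall s, x <= s <= y -> da s <= 0) ->
  (forall s, x <= s <= y -> l ^+ 2 <= ddth s) ->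
  `|\int[mu]_(s in `[x, y]) (a s * cos (th s))| <= (2 + 2 * pi) / l.
Proof.
move=> l0 xy ha hth hdth a01 da0 ddthl.
pose p (v : R) := v / (l ^+ 2 + v ^+ 2).
have l2 : 0 < l ^+ 2 by rewrite exprn_gt0.
have lv (v : R) : 0 < l ^+ 2 + v ^+ 2 by rewrite ltr_wpDr ?sqr_ge0.
have pk v : `|p v| <= (2 * l)^-1.
  rewrite /p normrM normfV (gtr0_norm (lv v)) ler_pdivrMr// mulrC ler_pdivlMr ?mulr_gt0//.
  by have := sqr_ge0 (l - `|v|); rewrite -(real_normK (num_real v)); nra.
pose H s := a s * p (dth s) * sin (th s).
pose h s := (da s * p (dth s) + a s * (((l ^+ 2 - dth s ^+ 2) / (l ^+ 2 + dth s ^+ 2) ^+ 2) * ddth s)) * sin (th s) + a s * p (dth s) * (cos (th s) * dth s).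
pose Q s := - ((2 * l)^-1 * a s) + 2 / l * atan (dth s / l).
pose q s := - ((2 * l)^-1 * da s) + 2 * ddth s / (l ^+ 2 + dth s ^+ 2).
apply: (@le_trans _ _ (`|H y| + `|H x| + (Q y - Q x))).
  apply: (@norm_Rintegral_le_primitive _ H Q h q) => // s sxy.
  - have dac := isd_mul (ha s sxy) (isd_cos (hth s sxy)).
    exact: isd_continuous dac.
  - have dp : is_derive (dth s) 1 p ((l ^+ 2 - dth s ^+ 2) / (l ^+ 2 + dth s ^+ 2) ^+ 2).
      have nz := lt0r_neq0 (lv (dth s)).
      by rewrite /p; apply: is_derive_eq; rewrite /GRing.scale /=; field.
    exact: isd_mul (isd_mul (ha s sxy) (isd_comp dp (hdth s sxy))) (isd_sin (hth s sxy)).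
  - have dQ := isd_add (isd_opp (isd_mul (isd_cst (2 * l)^-1 s) (ha s sxy)))
      (isd_mul (isd_cst (2 / l) s) (isd_atan (isd_mul (hdth s sxy) (isd_cst l^-1 s)))).
    apply: (is_derive_eq dQ); rewrite /q /=.
    by field; rewrite ?gt_eqF// -?expr2 addrC lv.
  - have /andP[as0 as1] := a01 s sxy; have da0s := da0 s sxy; have ddl := ddthl s sxy.
    have lvs := lv (dth s); set v := dth s in lvs *.
    have pks := pk v.
    rewrite /h /q -/v.
    have pE : a s * p v * (cos (th s) * v) = a s * cos (th s) * (1 - l ^+ 2 / (l ^+ 2 + v ^+ 2)).
      by rewrite /p; field; rewrite gt_eqF.
    rewrite pE; set m := l ^+ 2 + v ^+ 2 in lvs *.
    have m2 : `|(l ^+ 2 - v ^+ 2) / m ^+ 2| <= m^-1.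
      rewrite normrM normfV (ger0_norm (sqr_ge0 m)) ler_pdivrMr ?exprn_gt0//.
      rewrite (_ : m^-1 * m ^+ 2 = m); last by field; rewrite gt_eqF.
      by have := sqr_ge0 v; rewrite ler_norml /m; lra.
    have lm : l ^+ 2 / m <= ddth s / m by rewrite ler_pM2r ?invr_gt0.
    have lm0 : 0 <= l ^+ 2 / m by rewrite divr_ge0 ?ltW.
    have c1 : `|cos (th s)| <= 1 by rewrite ler_norml cos_geN1 cos_le1.
    have s1 : `|sin (th s)| <= 1 by rewrite ler_norml sin_geN1 sin_le1.
    have ddm0 : 0 <= ddth s by lra.
    have mi0 : 0 < m^-1 by rewrite invr_gt0.
    move: (p v) pks => pv pks; move: (_ / m ^+ 2) m2 => w m2.
    (* The error has three terms. As $\theta''\ge l^2$ and $|p'(v)|\le1/m$, the first and the third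
       are each at most $\theta''/m$; as [a] decreases, the second is at most $-a'/(2l)$. Their sum
       is [q]. *)
    rewrite (_ : _ - _ = a s * cos (th s) * (l ^+ 2 / m) - da s * pv * sin (th s)
      - a s * (w * ddth s) * sin (th s)); last by ring.
    apply: le_trans (ler_normB _ _) _.
    rewrite (_ : 2 * ddth s / m = ddth s / m + ddth s / m); last by field; rewrite gt_eqF.
    rewrite addrA; apply: lerD.
      apply: le_trans (ler_normB _ _) _; rewrite [leLHS]addrC; apply: lerD.
        rewrite !normrM (ler0_norm da0s) -mulrN mulrC mulrA -[leRHS]mul1r -mulrA.
        apply: ler_pM => //; first by rewrite mulr_ge0// oppr_ge0.
        by rewrite mulrC ler_wpM2r// oppr_ge0.
      apply: le_trans lm; rewrite normrM (ger0_norm lm0) normrM (ger0_norm as0).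
      rewrite -[leRHS]mul1r ler_wpM2r// -[leRHS]mul1r; exact: ler_pM.
    rewrite !normrM (ger0_norm as0) (ger0_norm ddm0) -[leRHS]mulr1; apply: ler_pM => //.
      by rewrite !mulr_ge0.
    rewrite -[leRHS]mul1r; apply: ler_pM => //; first by rewrite mulr_ge0.
    by rewrite [leLHS]mulrC ler_wpM2l.
have [/andP[ax0 ax1] /andP[ay0 ay1]] : 0 <= a x <= 1 /\ 0 <= a y <= 1.
  by split; apply: a01; lra.
have Hb s : x <= s <= y -> `|H s| <= (2 * l)^-1.
  move=> sxy; have /andP[as0 as1] := a01 s sxy.
  rewrite /H; move: (p (dth s)) (pk (dth s)) => pd pdk; rewrite !normrM (ger0_norm as0) -[leRHS]mulr1; apply: ler_pM => //.
  - by rewrite mulr_ge0.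
  - by rewrite -[leRHS]mul1r; apply: ler_pM.
  - by rewrite ler_norml sin_geN1 sin_le1.
have k0 : 0 <= (2 * l)^-1 by rewrite invr_ge0 mulr_ge0// ltW.
have l1 : l^-1 = 2 * (2 * l)^-1 by field; rewrite gt_eqF.
have l10 : 0 < l^-1 by rewrite invr_gt0.
have := Hb x; have := Hb y; rewrite !lexx (ltW xy) => /(_ isT) Hy /(_ isT) Hx.
(* The boundary terms of [H] cost at most $1/l$, the variation of [a] at most $1/(2l)$, and the
   arctangent, which varies by less than $\pi$, at most $2\pi/l$. *)
have := atan_ltpi2 (dth y / l); have := atan_gtNpi2 (dth x / l).
rewrite /Q; set A := atan _; set A' := atan _ => Ax Ay.
have : 2 / l * (A' - A) <= 2 / l * pi by rewrite ler_wpM2l ?divr_ge0// ?ltW//; lra.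
rewrite l1; nra.
Qed.

Section OscillatoryIntegral.
Variables (tau al be : R) (a da : R -> R).
Hypotheses (tau0 : 0 < tau) (tau1 : tau <= 1).
Hypotheses (al0 : 0 <= al) (al1 : al <= 1) (albe : al <= be).
Hypotheses (ma : measurable_fun setT a)
  (a01 : forall s, al <= s <= be -> 0 <= a s <= 1)
  (ha : forall s : R, 1 <= s <= be -> is_derive s 1 a (da s))
  (da0 : forall s, 1 <= s <= be -> da s <= 0).

(* trivial estimate on $[al, 1/tau]$, van der Corput on $[1/tau, be]$, where
   the second derivative of the phase is at least $tau^2$ *)
Let osc_cos_pos (P dP ddP : R -> R) (c d : R) :
  (forall s : R, is_derive s 1 P (dP s)) ->
  (forall s : R, is_derive s 1 dP (ddP s)) ->
  (forall s, 1 <= s -> s ^+ 2 <= ddP s) ->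
  `|\int[mu]_(s in `[al, be]) (a s * cos (tau ^+ 4 * P s + c * s + d))| <=
    (3 + 2 * pi) / tau.
Proof.
move=> hP hdP sP; set th := fun s => tau ^+ 4 * P s + c * s + d.
have hth (s : R) : is_derive s 1 th (tau ^+ 4 * dP s + c).
  apply: (is_derive_eq (isd_add (isd_add (isd_mul (isd_cst (tau ^+ 4) s) (hP s)) (isd_scale c s)) (isd_cst d s))).
  by rewrite /=; ring.
have hdth (s : R) : is_derive s 1 (fun s => tau ^+ 4 * dP s + c) (tau ^+ 4 * ddP s).
  apply: (is_derive_eq (isd_add (isd_mul (isd_cst (tau ^+ 4) s) (hdP s)) (isd_cst c s))).
  by rewrite /=; ring.
have mg : measurable_fun setT (fun s => a s * cos (th s)).
  apply: measurable_funM => //.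
  apply: (measurableT_comp (continuous_measurable_fun (@continuous_cos R))).
  by apply: continuous_measurable_fun => s; exact: isd_continuous (hth s).
have g1 s : al <= s <= be -> `|a s * cos (th s)| <= 1.
  move=> /a01 /andP[as0 as1]; rewrite normrM ger0_norm// -[leRHS]mul1r.
  by apply: ler_pM => //; rewrite ler_norml cos_geN1 cos_le1.
have finmu (x y : R) : (mu `[x, y]%classic < +oo)%E.
  by rewrite lebesgue_measure_itv /=; case: ifP => // _; rewrite -EFinB ltry.
have gi (x y : R) : al <= x -> y <= be ->
    mu.-integrable `[x, y] (EFin \o (fun s => a s * cos (th s))).
  move=> alx ybe; apply: measurable_bounded_integrable => //; first exact: finmu.
    exact: measurable_funTS.
  exists 1; split; first exact: num_real.
  move=> M M1 s; rewrite /= in_itv /= => /andP[xs sy].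
  by apply: le_trans (ltW M1); apply: g1; rewrite (le_trans alx)//= (le_trans sy).
have small (x y : R) : al <= x -> x <= y -> y <= be ->
    `|\int[mu]_(s in `[x, y]) (a s * cos (th s))| <= y - x.
  move=> alx xy ybe; apply: le_trans (le_normr_Rintegral _ (gi x y alx ybe)) _ => //.
  rewrite (_ : y - x = \int[mu]_(s in `[x, y]) 1); last first.
    by rewrite Rintegral_cst//= lebesgue_measure_itv /= lte_fin mul1r; case: ltgtP xy => // -> _; rewrite subrr.
  apply: le_Rintegral => //.
  - rewrite (_ : EFin \o _ = abse \o (EFin \o (fun s => a s * cos (th s))))//.
    by apply: integrable_abse; exact: gi.
  - apply: measurable_bounded_integrable => //; first exact: finmu.
    by exists 1; split => // M M1 s _; rewrite /= normr1 ltW.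
  - move=> s; rewrite /= in_itv /= => /andP[xs sy].
    by apply: g1; rewrite (le_trans alx)//= (le_trans sy).
have ti : 1 <= tau^-1 by rewrite invf_ge1.
have pi0 := pi_gt0 R.
have C1 : tau^-1 <= (3 + 2 * pi) / tau.
  by apply: ler_peMl; [exact: le_trans ti|lra].
have [beti|tibe] := leP be tau^-1.
  apply: le_trans (small al be (lexx _) albe (lexx _)) _.
  by apply: le_trans C1; apply: le_trans beti; rewrite gerBl.
have alti : al <= tau^-1 by exact: le_trans ti.
have := Rintegral_itvB (gi al be (lexx _) (lexx _)) (x := tau^-1).
rewrite !bnd_simp => /(_ alti (ltW tibe)).
rewrite Rintegral_itv_obnd_cbnd; last first.
  by apply: integrableS (gi tau^-1 be alti (lexx _)) => //; exact: subset_itv_oc_cc.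
move=> /eqP; rewrite subr_eq => /eqP ->.
apply: le_trans (ler_normD _ _) _.
have S1 := small al tau^-1 (lexx _) alti (ltW tibe).
have S2 : `|\int[mu]_(s in `[tau^-1, be]) (a s * cos (th s))| <= (2 + 2 * pi) / tau.
  apply: (@van_der_corput_cos a da th (fun s => tau ^+ 4 * dP s + c) (fun s => tau ^+ 4 * ddP s)) => //.
  - by move=> s /andP[ts sb]; apply: ha; rewrite sb (le_trans ti).
  - by move=> s /andP[ts sb]; apply: a01; rewrite sb (le_trans alti).
  - by move=> s /andP[ts sb]; apply: da0; rewrite sb (le_trans ti).
  - move=> s /andP[ts sb].
    have s1 : 1 <= s by exact: le_trans ts.
    apply: (@le_trans _ _ (tau ^+ 4 * s ^+ 2)); last by rewrite ler_wpM2l ?sP// exprn_ge0// ltW.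
    have : 1 <= tau * s by rewrite mulrC -ler_pdivrMr// mul1r.
    have t2 : 0 < tau ^+ 2 by rewrite exprn_gt0.
    move=> h; have : 1 <= (tau * s) ^+ 2 by rewrite exprn_ege1.
    by rewrite exprMn (_ : tau ^+ 4 = tau ^+ 2 * tau ^+ 2); [nra|ring].
rewrite (_ : (3 + 2 * pi) / tau = (2 + 2 * pi) / tau + tau^-1); last by field; rewrite gt_eqF.
by apply: lerD => //; apply: le_trans S1 _; rewrite gerBl.
Qed.

(** The cosine is even, so a concave phase reduces to a convex one. As [c] and [d] are arbitrary,
    the bound is uniform in the space variables and covers the sine as well. *)
Lemma oscillatory_cos_le (P dP ddP : R -> R) (c d : R) :
  (forall s : R, is_derive s 1 P (dP s)) ->
  (forall s : R, is_derive s 1 dP (ddP s)) ->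
  (forall s, 1 <= s -> s ^+ 2 <= ddP s) \/ (forall s, 1 <= s -> s ^+ 2 <= - ddP s) ->
  `|\int[mu]_(s in `[al, be]) (a s * cos (tau ^+ 4 * P s + c * s + d))| <=
    (3 + 2 * pi) / tau.
Proof.
move=> hP hdP [|] sP; first exact: osc_cos_pos hP hdP sP.
have := @osc_cos_pos (fun s => - P s) (fun s => - dP s) (fun s => - ddP s) (- c) (- d).
move=> /(_ (fun s => isd_opp (hP s)) (fun s => isd_opp (hdP s)) sP).
rewrite (_ : \int[mu]_(s in _) _ = \int[mu]_(s in `[al, be]) (a s * cos (tau ^+ 4 * P s + c * s + d)))//.
apply: eq_Rintegral => s _; rewrite -[in RHS]cosN; congr (_ * cos _); ring.
Qed.

End OscillatoryIntegral.

End VanDerCorput.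

(** * $L^2$ boundedness of the Laplace transform *)

Section Laplace.
Context {R : realType}.
Local Notation mu := (@lebesgue_measure R).

(** Put $\sigma=s-p$, $\sigma'=s'-p$. The kernel $2/(\sigma+\sigma')$ is weighted by the test
    function $\sigma^{-1/2}$; the substitution $\sigma'=\sigma v^2$ turns the integral into $4\int
    dv/(1+v^2)$, whence the primitive $4\arctan\sqrt{\sigma'/\sigma}$ and the bound $2\pi$. *)
Lemma integral_schur_weight (p al be s : R) : p < al -> al < be -> al <= s <= be ->
  (\int[mu]_(s' in `[al, be]) (2 * ((s - p) + (s' - p))^-1 *
     (Num.sqrt (s - p) * (Num.sqrt (s' - p))^-1))%:E <= (2 * pi)%:E)%E.
Proof.
move=> pal albe /andP[als sbe].
have sp : 0 < s - p by lra.
have sq : 0 < Num.sqrt (s - p) by rewrite sqrtr_gt0.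
pose F s' := 4 * atan (Num.sqrt (s' - p) / Num.sqrt (s - p)).
pose f s' := 2 * ((s - p) + (s' - p))^-1 * (Num.sqrt (s - p) * (Num.sqrt (s' - p))^-1).
have pos s' : al <= s' -> [/\ 0 < s' - p, 0 < Num.sqrt (s' - p) & 0 < (s - p) + (s' - p)].
  by move=> h; split; [lra|rewrite sqrtr_gt0; lra|lra].
have dsub (s' : R) : is_derive s' 1 (fun s' => s' - p) 1.
  by apply: (is_derive_eq (isd_sub (isd_id s') (isd_cst p s'))); rewrite subr0.
have dF (s' : R) : al <= s' <= be -> is_derive s' 1 F (f s').
  move=> /andP[als' _]; have [h1 h2 h3] := pos _ als'.
  have D := isd_mul (isd_cst 4 s') (isd_atan (isd_mul (isd_sqrt (g := fun s' => s' - p) h1 (dsub s')) (isd_cst (Num.sqrt (s - p))^-1 s'))).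
  apply: (is_derive_eq D); rewrite /f /=.
  have e1 : Num.sqrt (s - p) ^+ 2 = s - p by rewrite sqr_sqrtr// ltW.
  have e2 : Num.sqrt (s' - p) ^+ 2 = s' - p by rewrite sqr_sqrtr// ltW.
  move: (Num.sqrt (s - p)) (Num.sqrt (s' - p)) sq h2 e1 e2 => u v u0 v0 e1 e2.
  have n3 : u ^+ 2 + v ^+ 2 != 0 by rewrite e1 e2 gt_eqF.
  rewrite -e1 -e2; field; rewrite n3 !gt_eqF// addrC.
have cfs (s' : R) : al <= s' <= be -> {for s', continuous f}.
  move=> /andP[als' _]; have [h1 h2 h3] := pos _ als'.
  have D1 := isd_inv (g := fun s' => Num.sqrt (s' - p)) (lt0r_neq0 h2) (isd_sqrt (g := fun s' => s' - p) h1 (dsub s')).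
  have D2 := isd_inv (g := fun s' => (s - p) + (s' - p)) (lt0r_neq0 h3) (isd_add (isd_cst (s - p) s') (dsub s')).
  exact: isd_continuous (isd_mul (isd_mul (isd_cst 2 s') D2) (isd_mul (isd_cst (Num.sqrt (s - p)) s') D1)).
have cf : {within `[al, be], continuous f}.
  by apply: within_continuous_for => s' /=; rewrite in_itv /=; exact: cfs.
have fi : mu.-integrable `[al, be] (EFin \o f).
  by apply: continuous_compact_integrable => //; exact: segment_compact.
rewrite -[leLHS]fineK ?lee_fin; last exact: integrable_fin_num fi.
apply: (@le_trans _ _ (F be - F al)).
  exact: (@Rintegral_le_primitive R f F f).
rewrite /F -mulrBr.
have := atan_ltpi2 (Num.sqrt (be - p) / Num.sqrt (s - p)).
have : 0 <= atan (Num.sqrt (al - p) / Num.sqrt (s - p)).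
  by rewrite -atan0 le_atan// divr_ge0// sqrtr_ge0.
by lra.
Qed.

(** Expanding the square and integrating over $x$ before $s$ and $s'$ leaves the kernel $\int
    e^{-(\sigma+\sigma')|x|}dx=2/(\sigma+\sigma')$ with $\sigma=s-p$, to which Schur's test
    applies. *)
Lemma laplace_sqr_le (a : R -> R) (p al be : R) : p < al -> al < be ->
  measurable_fun setT a -> (forall s, 0 <= a s) ->
  (forall s, ~~ (al <= s <= be) -> a s = 0) ->
  (\int[mu]_x ((\int[mu]_s (a s * damp (s - p) x)%:E) *
              (\int[mu]_s (a s * damp (s - p) x)%:E)) <=
   (2 * pi)%:E * \int[mu]_s (a s ^+ 2)%:E)%E.
Proof.
move=> pal albe ma a0 aJ.
pose h (z : (R * R) * R) : \bar R := (a z.1.2 * damp (z.1.2 - p) z.1.1 * (a z.2 * damp (z.2 - p) z.1.1))%:E.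
have h0 z : (0 <= h z)%E by rewrite lee_fin !mulr_ge0// ltW// damp_gt0.
have mdamp d (T : measurableType d) (f g : T -> R) : measurable_fun setT f ->
    measurable_fun setT g -> measurable_fun setT (fun z => damp (f z) (g z)).
  move=> mf mg; apply: (measurableT_comp (@measurable_expR R)).
  apply: measurableT_comp => //; apply: measurable_funM => //.
  exact: measurableT_comp.
have mh : measurable_fun setT h.
  have m1 : measurable_fun setT (fun z : (R * R) * R => z.1.2).
    exact: measurableT_comp measurable_snd measurable_fst.
  have m2 : measurable_fun setT (fun z : (R * R) * R => z.1.1).
    exact: measurableT_comp measurable_fst measurable_fst.
  have m3 : measurable_fun setT (fun z : (R * R) * R => z.2) := measurable_snd.
  apply/measurable_EFinP; apply: measurable_funM.
    apply: measurable_funM; first exact: measurableT_comp.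
    by apply: mdamp => //; apply: measurable_funB.
  apply: measurable_funM; first exact: measurableT_comp.
  by apply: mdamp => //; apply: measurable_funB.
pose H (z : R * R) : \bar R := (\int[mu]_s' h (z, s'))%E.
have mH : measurable_fun setT H.
  exact: (measurable_fun_fubini_tonelli_F (m2 := mu) h).
have H0 z : (0 <= H z)%E by exact: integral_ge0.
have md x : measurable_fun setT (fun s => (a s * damp (s - p) x)%:E).
  apply/measurable_EFinP; apply: measurable_funM => //; apply: mdamp => //.
  exact: measurable_funB.
have ad0 s x : (0 <= (a s * damp (s - p) x)%:E)%E.
  by rewrite lee_fin mulr_ge0// ltW// damp_gt0.
have E1 x : ((\int[mu]_s (a s * damp (s - p) x)%:E) * (\int[mu]_s (a s * damp (s - p) x)%:E) =
    \int[mu]_s H (x, s))%E.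
  rewrite -ge0_integralZr//; [|exact: md|exact: integral_ge0].
  by apply: eq_integral => s _; rewrite -ge0_integralZl//; exact: md.
under eq_integral do rewrite E1.
rewrite (fubini_tonelli (m1 := mu) (m2 := mu) H)//.
(* The inverse is written as the real power $-1$, a measurable function of its base; on nonnegative
   bases the two agree. *)
pose k (z : R * R) : R := \1_(`[al, be]%classic) z.1 * \1_(`[al, be]%classic) z.2 *
  (2 * ((z.1 - p) + (z.2 - p)) `^ (-1)).
pose K (z : R * R) : R := k z * (Num.sqrt (z.1 - p) * (Num.sqrt (z.2 - p)) `^ (-1)).
have k0 z : 0 <= k z by rewrite !mulr_ge0// powR_ge0.
have K0 z : 0 <= K z by rewrite mulr_ge0// mulr_ge0// powR_ge0.
have mind : measurable_fun setT (\1_(`[al, be]%classic) : R -> R) by exact: measurable_indic.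
have mf1 : measurable_fun setT (fun z : R * R => z.1 - p).
  by apply: measurable_funB; [exact: measurable_fst|exact: measurable_cst].
have mf2 : measurable_fun setT (fun z : R * R => z.2 - p).
  by apply: measurable_funB; [exact: measurable_snd|exact: measurable_cst].
have msq := continuous_measurable_fun (@sqrt_continuous R).
have mpow (f : R * R -> R) : measurable_fun setT f ->
    measurable_fun setT (fun z => f z `^ (-1)).
  by move=> mf; exact: (measurableT_comp (@measurable_powR R (-1)) mf).
have mk : measurable_fun setT k.
  apply: measurable_funM.
    by apply: measurable_funM; apply: (measurableT_comp mind); [exact: measurable_fst|exact: measurable_snd].
  apply: measurable_funM => //; apply: mpow.
  exact: measurable_funD.
have mK : measurable_fun setT K.
  apply: measurable_funM => //; apply: measurable_funM; first exact: measurableT_comp.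
  by apply: mpow; exact: measurableT_comp.
have inJ s : al <= s <= be -> \1_(`[al, be]%classic) s = 1 :> R.
  by move=> sJ; rewrite indicE mem_set//= in_itv.
apply: (@le_trans _ _ (\int[mu]_s \int[mu]_s' (a s * a s' * k (s, s'))%:E)%E).
  rewrite le_eqVlt; apply/orP; left; apply/eqP; apply: eq_integral => s _.
  rewrite /H (fubini_tonelli (m1 := mu) (m2 := mu) (fun z => h ((z.1, s), z.2)))//=; last first.
    apply: (measurableT_comp mh); apply: measurable_fun_pair; last exact: measurable_snd.
    by apply: measurable_fun_pair => //; exact: measurable_fst.
  apply: eq_integral => s' _; rewrite /h /=.
  have [sJ|/aJ ->] := boolP (al <= s <= be); last first.
    by rewrite !mul0r; apply: integral0_eq => x _; rewrite !mul0r.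
  have [s'J|/aJ ->] := boolP (al <= s' <= be); last first.
    by rewrite mulr0 mul0r; apply: integral0_eq => x _; rewrite mul0r mulr0.
  have dp : 0 < (s - p) + (s' - p) by lra.
  under eq_integral => x _.
    rewrite (_ : a s * damp (s - p) x * (a s' * damp (s' - p) x) =
      a s * a s' * damp ((s - p) + (s' - p)) x); last first.
      by rewrite (dampD (s - p) (s' - p)); ring.
    rewrite EFinM; over.
  rewrite ge0_integralZl//; last 3 first.
  - by apply/measurable_EFinP; exact: measurable_damp.
  - by move=> x _; rewrite lee_fin ltW// damp_gt0.
  - by rewrite lee_fin mulr_ge0.
  by rewrite integral_damp// /k /= !inJ// !mul1r powR_inv1 ?(ltW dp)// EFinM.
apply: (@schur_test R a k K) => //.
- move=> s s'.
  have [sJ|/aJ ->] := boolP (al <= s <= be); last first.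
    by rewrite !mul0r mulr_ge0// expr0n /= mul0r add0r mulr_ge0// sqr_ge0.
  have [s'J|/aJ ->] := boolP (al <= s' <= be); last first.
    by rewrite mulr0 mul0r mulr_ge0// expr0n /= mul0r addr0 mulr_ge0// sqr_ge0.
  have kC : k (s', s) = k (s, s') by rewrite /k /= !inJ// addrC.
  rewrite /K kC /=; move: (k (s, s')) (k0 (s, s')) => c c0.
  have s0 : 0 < Num.sqrt (s - p) by rewrite sqrtr_gt0; lra.
  have s'0 : 0 < Num.sqrt (s' - p) by rewrite sqrtr_gt0; lra.
  rewrite !powR_inv1 ?(ltW s0) ?(ltW s'0)//.
  move: (Num.sqrt (s - p)) (Num.sqrt (s' - p)) s0 s'0 => u v u0 v0.
  rewrite (_ : 2^-1 * _ = 2^-1 * ((a s ^+ 2 * (u / v) + a s' ^+ 2 * (v / u)) * c)); last by ring.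
  rewrite [leRHS]mulrA ler_wpM2r//.
  have uv0 : 0 < u * v by rewrite mulr_gt0.
  rewrite (_ : 2^-1 * _ = 2^-1 * ((a s * u) ^+ 2 + (a s' * v) ^+ 2) / (u * v)); last by field; rewrite !gt_eqF.
  by rewrite ler_pdivlMr//; have := sqr_ge0 (a s * u - a s' * v); nra.
- move=> s.
  have [sJ|sJ] := boolP (al <= s <= be); last first.
    rewrite integral0_eq ?lee_fin ?mulr_ge0 ?pi_ge0// => s' _.
    by rewrite /K /k /= indicE memNset ?mul0r//= in_itv /=; exact/negP.
  apply: le_trans (integral_schur_weight pal albe sJ).
  rewrite [leRHS]integral_mkcond le_eqVlt; apply/orP; left; apply/eqP.
  apply: eq_integral => s' _; rewrite patchE /K /k /= inJ//.
  have [s'J|s'J] := boolP (al <= s' <= be); last first.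
    rewrite memNset ?indicE ?memNset ?mulr0 ?mul0r//= in_itv /=; exact/negP.
  have ss : 0 <= (s - p) + (s' - p) by lra.
  by rewrite mem_set ?in_itv//= inJ// !mul1r (powR_inv1 ss) (powR_inv1 (sqrtr_ge0 _)).
Qed.

End Laplace.

(** * Interpolation *)

Section Marcinkiewicz.
Context {R : realType}.
Local Notation mu := (@lebesgue_measure R).
Local Notation cintble := (@cintegrable R setT).

(** With $d_n=\min(b2^{-n},c)^q$, a term below the cutoff equals $(1-2^{-q})^{-1}(d_n-d_{n+1})$, and
    for the others this difference is nonnegative. Telescoping leaves $d_0\le c^q$, whatever [b] and
    [N] are. *)
Lemma sum_geometric_truncated (b c q : R) (N : nat) : 0 <= b -> 0 <= c -> 0 < q ->
  \sum_(0 <= n < N) (if b / 2 ^+ n <= c then (b / 2 ^+ n) `^ q else 0) <=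
  (1 - 2 `^ (- q))^-1 * c `^ q.
Proof.
move=> b0 c0 q0.
have h1 : 2 `^ (- q) < 1 :> R.
  rewrite powRN invf_lt1 ?powR_gt0//.
  have := gt0_ltr_powR q0 (x := 1) (y := 2 : R).
  by rewrite !nnegrE !ler0n ltr1n powR1; apply.
pose K := (1 - 2 `^ (- q))^-1 : R.
have K0 : 0 < K by rewrite invr_gt0 subr_gt0.
pose d n := (Num.min (b / 2 ^+ n) c) `^ q.
have bn0 n : 0 <= b / 2 ^+ n by rewrite divr_ge0// exprn_ge0.
have min0 n : 0 <= Num.min (b / 2 ^+ n) c by rewrite le_min bn0 c0.
have bS n : b / 2 ^+ n.+1 = b / 2 ^+ n * 2^-1.
  by rewrite exprS; field; rewrite expf_neq0.
have step n : (if b / 2 ^+ n <= c then (b / 2 ^+ n) `^ q else 0) <= K * (d n - d n.+1).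
  rewrite /d bS; case: ifPn => [bc|bc].
    have bc' : b / 2 ^+ n * 2^-1 <= c by have := bn0 n; lra.
    rewrite (min_idPl bc) (min_idPl bc').
    have -> : (b / 2 ^+ n * 2^-1) `^ q = (b / 2 ^+ n) `^ q * 2 `^ (- q).
      have i2 : 0 <= 2^-1 :> R by rewrite invr_ge0.
      rewrite (powRM _ (bn0 n) i2); congr (_ * _).
      by rewrite -powR_inv1// -powRrM mulN1r.
    rewrite (_ : K * _ = (b / 2 ^+ n) `^ q)//.
    by rewrite /K; field; rewrite subr_eq0 gt_eqF.
  rewrite mulr_ge0 ?(ltW K0)// subr_ge0 ge0_ler_powR ?nnegrE ?(ltW q0)//.
    by rewrite -bS.
  rewrite -bS le_min ge_min; apply/andP; split; last by rewrite ge_min lexx orbT.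
  by rewrite bS; have := bn0 n => ?; apply/orP; left; lra.
apply: (@le_trans _ _ (\sum_(0 <= n < N) K * (d n - d n.+1))).
  by apply: ler_sum.
rewrite -mulr_sumr -/K ler_wpM2l ?(ltW K0)//.
rewrite (_ : \sum_(0 <= n < N) _ = d 0 - d N); last first.
  under eq_bigr do rewrite -opprB.
  by rewrite sumrN telescope_sumr// opprB.
apply: (@le_trans _ _ (d 0)); first by rewrite gerBl powR_ge0.
by rewrite /d ge0_ler_powR ?nnegrE ?(ltW q0)// ge_min lexx orbT.
Qed.

(** If $\lambda<F\le2\lambda$ and $\lambda/2\le|Tv|$, then $F^r\le2^r\cdot4\,\lambda^{r-2}|Tv|^2$,
    which gives the first factors; [B] is the $L^2$ constant. The bracket is the geometric series
    cut off at $2AS$, with $(AS)^{r-2}$ taken out. *)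
Definition marcinkiewicz_cst (r B : R) : R :=
  2 `^ r * 4 * B * ((1 - 2 `^ (- (r - 2)))^-1 * 2 `^ (r - 2)).

(** Take the least [n] with $m_02^{-n}<F$: minimality gives the upper bound, and for $n=0$ it is the
    hypothesis on [F]. *)
Lemma ex_dyadic_level (m0 F : R) : 0 < F -> F <= 2 * m0 ->
  exists n, m0 / 2 ^+ n < F <= 2 * (m0 / 2 ^+ n).
Proof.
move=> F0 Fm; have m0p : 0 < m0 by lra.
have ex : exists n, m0 / 2 ^+ n < F.
  have [n hn] : exists n, m0 / F < n%:R.
    exists (Num.bound (m0 / F)); apply: archi_boundP; exact: divr_ge0 (ltW m0p) (ltW F0).
  exists n; rewrite ltr_pdivrMr ?exprn_gt0// mulrC -ltr_pdivrMr//.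
  by apply: lt_le_trans hn _; rewrite -natrX ler_nat ltnW// ltn_expl.
case: (ex_minnP ex) => n hn nmin; exists n; rewrite hn /=.
case: n hn nmin => [|n] hn nmin; first by rewrite expr0 divr1.
rewrite (_ : 2 * (m0 / 2 ^+ n.+1) = m0 / 2 ^+ n); last first.
  by rewrite exprS; field; rewrite expf_neq0.
rewrite leNgt; apply/negP => h.
by have := nmin n h; rewrite ltnn.
Qed.

Section Interpolation.
Variables (T : (R -> R[i]) -> R -> R[i]) (A B : R).
Hypotheses (A0 : 0 < A) (B0 : 0 <= B).
Hypothesis TD : forall u v, cintble u -> cintble v ->
  forall x, T (fun y => u y + v y) x = T u x + T v x.
Hypothesis Tm : forall u, cintble u -> cmeas (T u).
Hypothesis T1 : forall u, cintble u ->
  forall x, modulus (T u x) <= A * \int[mu]_y modulus (u y).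
Hypothesis T2 : forall u, cintble u ->
  (\int[mu]_x (modulus (T u x) ^+ 2)%:E <= B%:E * \int[mu]_y (modulus (u y) ^+ 2)%:E)%E.

(* At the level $2^{-n}m_0$ cut [u] at a height chosen so that, by the
   $L^1\to L^\infty$ bound, the part above the cut contributes at most half of
   the level; the part below is estimated in $L^2$, and the sum over the levels
   is dominated by a geometric series. *)
Lemma marcinkiewicz (u : R -> R[i]) (r S : R) : 2 < r -> 0 < S -> cintble u ->
  (\int[mu]_y (modulus (u y) `^ (r / (r - 1)))%:E <= S%:E)%E ->
  (\int[mu]_x (modulus (T u x) `^ r)%:E <=
    (marcinkiewicz_cst r B * ((A * S) `^ (r - 2) * S))%:E)%E.
Proof.
move=> r2 S0 iu uS; set p := r / (r - 1) in uS *.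
have r10 : 0 < r - 1 by lra.
have p1 : 0 < p - 1 by rewrite /p (_ : _ - 1 = (r - 1)^-1) ?invr_gt0//; field; rewrite gt_eqF.
have q0 : 0 < r - 2 by lra.
have p0 : p != 0 by rewrite gt_eqF//; lra.
have r0 : r != 0 by rewrite gt_eqF//; lra.
have mu' := cintegrable_meas iu; have mm := cmeas_modulus mu'.
pose I1 := \int[mu]_y modulus (u y).
have I10 : 0 <= I1 by apply: Rintegral_ge0 => y _; exact: modulus_ge0.
(* A strict upper bound for $|Tu|$; the summand $1$ keeps it positive even when $u=0$ almost
   everywhere. *)
pose m0 := A * I1 + 1.
have m00 : 0 < m0 by rewrite ltr_pwDr// mulr_ge0// ltW.
pose lv n : R := m0 / 2 ^+ n.
have lv0 n : 0 < lv n by rewrite divr_gt0// exprn_gt0.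
(* Above the cut, $|u|\le\frac{\lambda_n}{2AS}|u|^p$ with $\lambda_n$ the level [lv n]. Hence
   $A\int|u_h|\le\lambda_n/2$, which is the bound [Th]. *)
pose low n y : bool := lv n * modulus (u y) `^ (p - 1) <= 2 * (A * S).
have AS0 : 0 < A * S by rewrite mulr_gt0.
pose ind n y : R := if low n y then 1 else 0.
have mpow (e : R) : measurable_fun setT (fun y => modulus (u y) `^ e).
  exact: measurableT_comp (@measurable_powR R e) mm.
have mlow n : measurable_fun setT (low n).
  by apply: measurable_fun_ler; [exact: measurable_funM|exact: measurable_cst].
have mind n : measurable_fun setT (ind n).
  by apply: measurable_fun_ifT => //; exact: measurable_cst.
pose ul n y := (ind n y)%:C%C * u y; pose uh n y := (1 - ind n y)%:C%C * u y.
have iul n : cintble (ul n).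
  apply: (cintegrableM_bounded (M := 1)) => //; first exact: cmeas_real.
  by move=> y; rewrite modulus_real /ind; case: ifP; rewrite ?normr1 ?normr0.
have iuh n : cintble (uh n).
  apply: (cintegrableM_bounded (M := 1)) => //.
    by apply: cmeas_real; exact: measurable_funB.
  by move=> y; rewrite modulus_real /ind; case: ifP; rewrite ?subrr ?subr0 ?normr1 ?normr0.
have uE n : u = fun y => ul n y + uh n y.
  by apply/funext => y; rewrite /ul /uh -mulrDl -rmorphD /= addrCA subrr addr0 mul1r.
have ip : mu.-integrable setT (EFin \o (fun y => modulus (u y) `^ p)).
  apply/integrableP; split; first by apply/measurable_EFinP; exact: mpow.
  apply: le_lt_trans (ltry S); apply: le_trans uS.
  by under eq_integral do rewrite /= ger0_norm ?powR_ge0//.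
have SE : \int[mu]_y (modulus (u y) `^ p) <= S.
  by have := uS; rewrite -[leLHS]fineK ?lee_fin//; exact: integrable_fin_num ip.
have powE y : modulus (u y) `^ p = modulus (u y) * modulus (u y) `^ (p - 1).
  have [->|u0] := eqVneq (modulus (u y)) 0; first by rewrite mul0r powR0.
  rewrite -[X in X * _]powRr1 ?modulus_ge0// -powRD; last by rewrite u0 implybT.
  by congr (_ `^ _); ring.
have Th n x : modulus (T (uh n) x) <= lv n / 2.
  apply: le_trans (T1 (iuh n) x) _.
  apply: (@le_trans _ _ (A * \int[mu]_y (lv n / (2 * (A * S)) * modulus (u y) `^ p))).
    rewrite ler_wpM2l ?(ltW A0)//; apply: le_Rintegral => //.
    - exact: cintegrable_modulus.
    - rewrite (_ : EFin \o _ = fun y => ((lv n / (2 * (A * S)))%:E * (EFin \o (fun y => (modulus (u y) `^ p)%R)) y)%E)//.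
      exact: integrableZl.
    - move=> y _; rewrite modulusM modulus_real /ind /low; case: ifPn => hl.
        by rewrite subrr normr0 mul0r mulr_ge0 ?powR_ge0// divr_ge0 ?ltW// mulr_gt0.
      rewrite subr0 normr1 mul1r powE mulrA mulrAC ler_peMl ?modulus_ge0//.
      move: hl; rewrite -ltNge => /ltW.
      by move=> hh; rewrite mulrAC ler_pdivlMr ?mul1r // mulr_gt0.
  rewrite RintegralZl//.
  apply: (@le_trans _ _ (A * (lv n / (2 * (A * S)) * S))).
    by rewrite ler_wpM2l ?(ltW A0)// ler_wpM2l// divr_ge0 ?ltW// mulr_gt0.
  by rewrite le_eqVlt; apply/orP; left; apply/eqP; field; rewrite !gt_eqF.
pose c := 2 `^ r * 4 : R.
have c0 : 0 < c by rewrite mulr_gt0// powR_gt0.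
pose t n x := (c * lv n `^ (r - 2) * modulus (T (ul n) x) ^+ 2)%:E.
have t0 n x : (0 <= t n x)%E.
  by rewrite lee_fin; apply: mulr_ge0; [apply: mulr_ge0; [exact: ltW|exact: powR_ge0]|exact: sqr_ge0].
have mt n : measurable_fun setT (t n).
  apply/measurable_EFinP; apply: measurable_funM; first exact: measurable_cst.
  by apply: measurable_funX; exact: cmeas_modulus (Tm (iul n)).
(* One term of the series suffices: that of the dyadic level with $\lambda_n<F\le2\lambda_n$. There
   $|Tu_h|\le\lambda_n/2$ forces $|Tu_l|\ge\lambda_n/2$. *)
have FT x : ((modulus (T u x) `^ r)%:E <= \sum_(n <oo) t n x)%E.
  set F := modulus (T u x).
  have [F0|F0] := eqVneq F 0.
    by rewrite F0 powR0//; apply: nneseries_ge0.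
  have {}F0 : 0 < F by rewrite lt_neqAle eq_sym F0 modulus_ge0.
  have Fm : F <= 2 * m0.
    by apply: le_trans (T1 iu x) _; rewrite /m0 -/I1; have : 0 <= A * I1 := mulr_ge0 (ltW A0) I10; lra.
  have [n /andP[nF Fn]] := ex_dyadic_level F0 Fm; rewrite -/(lv n) in nF Fn.
  apply: (@le_trans _ _ (t n x)); last first.
    apply: le_trans (@nneseries_lim_ge _ _ _ _ n.+1 _) => //.
    by rewrite big_nat_recr//= leeDr// sume_ge0.
  rewrite lee_fin.
  have lF : lv n / 2 <= modulus (T (ul n) x).
    have FE : F <= modulus (T (ul n) x) + modulus (T (uh n) x).
      by rewrite /F {1}(uE n) TD//; exact: modulusD.
    by have := Th n x; lra.
  apply: (@le_trans _ _ ((2 * lv n) `^ r)).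
    by rewrite ge0_ler_powR// ?nnegrE ?modulus_ge0 ?mulr_ge0 ?(ltW (lv0 n))//; lra.
  rewrite powRM ?(ltW (lv0 n))//.
  have -> : lv n `^ r = lv n `^ (r - 2) * lv n ^+ 2.
    rewrite -powR_mulrn ?(ltW (lv0 n))// -powRD; last by rewrite (lt0r_neq0 (lv0 n)) implybT.
    by congr (_ `^ _); ring.
  rewrite /c -!mulrA ler_wpM2l ?powR_ge0// [leRHS]mulrCA ler_wpM2l ?powR_ge0//.
  by have := lv0 n; nra.
have Ssum : (\int[mu]_x (modulus (T u x) `^ r)%:E <= \sum_(n <oo) \int[mu]_x t n x)%E.
  rewrite -integral_nneseries//; apply: ge0_le_integral => //.
  - by move=> x _; rewrite lee_fin powR_ge0.
  - apply/measurable_EFinP.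
    exact: measurableT_comp (@measurable_powR R r) (cmeas_modulus (Tm iu)).
  - by apply: ge0_emeasurable_sum => [n x *|n *]; [exact: t0|exact: mt].
apply: le_trans Ssum _.
(* Since $p+(p-1)(r-2)=2$, one has $\lambda_n^{r-2}|u|^2=|u|^p(\lambda_n|u|^{p-1})^{r-2}$. For fixed
   [y] the last factor is geometric in [n] and cut off at $2AS$, so its sum is bounded independently
   of [y]. *)
pose w n y := ((c * B) * (modulus (u y) `^ p * (if low n y then (lv n * modulus (u y) `^ (p - 1)) `^ (r - 2) else 0)))%:E.
have w0 n y : (0 <= w n y)%E.
  rewrite lee_fin; apply: mulr_ge0; first by rewrite mulr_ge0// ltW.
  by rewrite mulr_ge0 ?powR_ge0//; case: ifP; rewrite ?powR_ge0.
have mw n : measurable_fun setT (w n).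
  apply/measurable_EFinP; apply: measurable_funM; first exact: measurable_cst.
  apply: measurable_funM => //; apply: measurable_fun_ifT => //.
  - apply: measurableT_comp (@measurable_powR R (r - 2)) _.
    by apply: measurable_funM; [exact: measurable_cst|exact: mpow].
have tw n : (\int[mu]_x t n x <= \int[mu]_y w n y)%E.
  rewrite /t; under eq_integral do rewrite EFinM.
  rewrite ge0_integralZl//; last 3 first.
  - by apply/measurable_EFinP; apply: measurable_funX; exact: cmeas_modulus (Tm (iul n)).
  - by move=> x _; rewrite lee_fin sqr_ge0.
  - by rewrite lee_fin mulr_ge0 ?powR_ge0 ?ltW.
  apply: (@le_trans _ _ ((c * lv n `^ (r - 2))%:E * (B%:E * \int[mu]_y (modulus (ul n y) ^+ 2)%:E))%E).
    by rewrite lee_wpmul2l ?lee_fin ?mulr_ge0 ?powR_ge0 ?(ltW c0)// T2.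
  rewrite muleA -EFinM -ge0_integralZl//; last 3 first.
  - by apply/measurable_EFinP; apply: measurable_funX; apply: cmeas_modulus; exact: cintegrable_meas.
  - by move=> x _; rewrite lee_fin sqr_ge0.
  - by rewrite lee_fin !mulr_ge0 ?powR_ge0 ?(ltW c0).
  rewrite le_eqVlt; apply/orP; left; apply/eqP; apply: eq_integral => y _.
  rewrite -EFinM /w; congr EFin; rewrite /ul modulusM modulus_real /ind.
  case: ifP => _; last by rewrite normr0 mul0r expr0n /= !mulr0.
  rewrite normr1 mul1r powRM ?powR_ge0 ?(ltW (lv0 n))// -powRrM.
  have [->|u0] := eqVneq (modulus (u y)) 0.
    by rewrite expr0n /= powR0// ?mul0r ?mulr0.
  rewrite (_ : modulus (u y) ^+ 2 = modulus (u y) `^ p * modulus (u y) `^ ((p - 1) * (r - 2))); first by ring.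
  rewrite -powR_mulrn ?modulus_ge0// -powRD; last by rewrite u0 implybT.
  by congr (_ `^ _); rewrite /p; field; rewrite gt_eqF.
apply: (@le_trans _ _ (\sum_(n <oo) \int[mu]_y w n y)%E).
  by apply: lee_nneseries => // n _ _; exact: integral_ge0.
rewrite -integral_nneseries//.
pose K := (1 - 2 `^ (- (r - 2)))^-1 * (2 * (A * S)) `^ (r - 2) : R.
have K0 : 0 <= K.
  have := @sum_geometric_truncated 0 (2 * (A * S)) (r - 2) 0 (lexx _) _ q0.
  by rewrite big_geq//; apply; rewrite mulr_ge0// ltW.
apply: (@le_trans _ _ (\int[mu]_y ((c * B * K)%:E * (modulus (u y) `^ p)%:E))%E).
  apply: ge0_le_integral => //.
  - by move=> y _; apply: nneseries_ge0.
  - by apply: ge0_emeasurable_sum => [n y *|n *]; [exact: w0|exact: mw].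
  - by apply: emeasurable_funM; [exact: measurable_cst|by apply/measurable_EFinP; exact: mpow].
  - move=> y _; apply: lime_le; first by apply: is_cvg_nneseries => n _ _; exact: w0.
    apply: nearW => N; rewrite /w sumEFin -EFinM lee_fin -!mulr_sumr.
    rewrite -[leRHS]mulrA ler_wpM2l ?mulr_ge0 ?(ltW c0)// mulrC ler_wpM2r ?powR_ge0//.
    have := @sum_geometric_truncated (m0 * modulus (u y) `^ (p - 1)) (2 * (A * S)) (r - 2) N.
    rewrite !mulr_ge0 ?powR_ge0 ?(ltW m00) ?(ltW A0) ?(ltW S0)// => /(_ isT isT q0).
    rewrite -/K; apply: le_trans; rewrite le_eqVlt; apply/orP; left; apply/eqP.
    by apply: eq_bigr => n _; rewrite /low /lv mulrAC.
rewrite ge0_integralZl//; last 3 first.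
- by apply/measurable_EFinP; exact: mpow.
- by move=> y _; rewrite lee_fin powR_ge0.
- by rewrite lee_fin (mulr_ge0 (mulr_ge0 (ltW c0) B0) K0).
apply: (@le_trans _ _ ((c * B * K)%:E * S%:E)%E).
  by rewrite lee_wpmul2l// lee_fin (mulr_ge0 (mulr_ge0 (ltW c0) B0) K0).
rewrite -EFinM lee_fin /K powRM// ?(ltW AS0)// /marcinkiewicz_cst /c.
by rewrite le_eqVlt; apply/orP; left; apply/eqP; ring.
Qed.

End Interpolation.

End Marcinkiewicz.

Lemma cvg_powR {R : realType} (a_ : nat -> R) (a r : R) : 0 < r ->
  (forall n, 0 <= a_ n) -> a_ n @[n --> \oo] --> a -> a_ n `^ r @[n --> \oo] --> a `^ r.
Proof.
move=> r0 a_0 aa.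
have a0 : 0 <= a.
  by rewrite -(cvg_lim _ aa)//; apply: limr_ge; [exact: (cvgP a)|exact: nearW].
move: a0; rewrite le_eqVlt => /predU1P[a0|a0].
  rewrite -a0 in aa *; rewrite powR0 ?gt_eqF//; apply/cvgr0Pnorm_lt => e e0.
  have e1 : 0 < e `^ r^-1 by rewrite powR_gt0.
  move/cvgr0Pnorm_lt : aa => /(_ _ e1); apply: filterS => n.
  rewrite !ger0_norm ?powR_ge0// => h.
  rewrite [ltRHS](_ : e = (e `^ r^-1) `^ r).
    by apply: gt0_ltr_powR => //; rewrite nnegrE ?powR_ge0.
  by rewrite -powRrM mulVf ?gt_eqF// powRr1// ltW.
have C : {for a, continuous (fun v => v `^ r)}.
  by apply: differentiable_continuous; apply/derivable1_diffP; case: (@is_derive1_powR R r a a0).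
exact: (cvg_comp _ _ aa C).
Qed.

(** * Estimates stable under pointwise limits *)

Section DispersiveBounds.
Context {R : realType}.
Local Notation mu := (@lebesgue_measure R).

(** [P] and [V] are linked by the estimates alone, not by an operator, because $\Psi_j$ need not lie
    in the domain of one. The $L^r$ bound is stated for every upper bound [S] of $\int|P|^{r'}$, so
    that one [S] serves a whole approximating sequence. *)
Record dispersive_bounds (A B : R) (P V : R -> R[i]) : Prop := DispersiveBounds {
  dispersive_meas : cmeas V;
  dispersive_Lr : forall r S, 2 < r -> 0 < S ->
    (\int[mu]_y (modulus (P y) `^ (r / (r - 1)))%:E <= S%:E)%E ->
    (\int[mu]_x (modulus (V x) `^ r)%:E <=
      (marcinkiewicz_cst r B * ((A * S) `^ (r - 2) * S))%:E)%E;
  dispersive_L2 : (\int[mu]_x (modulus (V x) ^+ 2)%:E <=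
    B%:E * \int[mu]_y (modulus (P y) ^+ 2)%:E)%E;
  dispersive_Loo : forall x, ((modulus (V x))%:E <= A%:E * \int[mu]_y (modulus (P y))%:E)%E }.

Lemma modulus_sub_le (z u : R[i]) : `|modulus z - modulus u| <= modulus (z - u).
Proof.
have h (a b : R[i]) : modulus a - modulus b <= modulus (a - b).
  by rewrite lerBlDr -[X in modulus X <= _](subrK b); exact: modulusD.
rewrite ler_norml h andbT lerNl opprB.
by apply: le_trans (h u z) _; rewrite -modulusN opprB.
Qed.

Lemma cvg_modulus (V_ : nat -> R[i]) (z : R[i]) :
  modulus (V_ n - z) @[n --> \oo] --> 0 -> modulus (V_ n) @[n --> \oo] --> modulus z.
Proof.
move=> h; apply/subr_cvg0; apply: (cvg0_dominated (K := 1) _ h) => n.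
by rewrite mul1r modulus_sub_le.
Qed.

(** The left-hand sides pass to the limit by Fatou's lemma, or pointwise for the supremum bound; the
    right-hand sides are controlled by $|P_n|\le|P|$, so convergence of $P_n$ does not enter. *)
Lemma dispersive_bounds_lim (A B : R) (P_ V_ : nat -> R -> R[i]) (P V : R -> R[i]) :
  0 <= A -> 0 <= B -> cmeas P -> (forall n, cmeas (P_ n)) ->
  (forall n y, modulus (P_ n y) <= modulus (P y)) ->
  (forall n, dispersive_bounds A B (P_ n) (V_ n)) ->
  (forall x, modulus (V_ n x - V x) @[n --> \oo] --> 0) ->
  dispersive_bounds A B P V.
Proof.
move=> A0 B0 mP mP_ PP dV VV.
have mV : cmeas V.
  split.
    apply: (@measurable_fun_cvg _ _ R setT (fun n x => complex.Re (V_ n x))).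
      by move=> n; case: (dispersive_meas (dV n)).
    move=> x _; apply/subr_cvg0; apply: (cvg0_dominated (K := 1) _ (VV x)) => n.
    by rewrite mul1r -raddfB; exact: Re_le_modulus.
  apply: (@measurable_fun_cvg _ _ R setT (fun n x => complex.Im (V_ n x))).
    by move=> n; case: (dispersive_meas (dV n)).
  move=> x _; apply/subr_cvg0; apply: (cvg0_dominated (K := 1) _ (VV x)) => n.
  by rewrite mul1r -raddfB; exact: Im_le_modulus.
have cV x := cvg_modulus (VV x).
have mm n := cmeas_modulus (dispersive_meas (dV n)).
split => //.
- move=> r S r2 S0 PS.
  apply: (@fatou_bound R (fun n x => (modulus (V_ n x) `^ r)%:E)).
  + move=> n; apply/measurable_EFinP.
    exact: measurableT_comp (@measurable_powR R r) (mm n).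
  + by move=> n x; rewrite lee_fin powR_ge0.
  + move=> x; apply: cvg_EFin; first exact: nearW.
    by apply: cvg_powR => //; [lra|move=> n; exact: modulus_ge0].
  + move=> n; apply: (dispersive_Lr (dV n) r2 S0); apply: le_trans PS.
    apply: ge0_le_integral => //.
    * by move=> y _; rewrite lee_fin powR_ge0.
    * apply/measurable_EFinP.
      exact: measurableT_comp (@measurable_powR R _) (cmeas_modulus (mP_ n)).
    * apply/measurable_EFinP.
      exact: measurableT_comp (@measurable_powR R _) (cmeas_modulus mP).
    * move=> y _; rewrite lee_fin ge0_ler_powR ?nnegrE ?modulus_ge0//.
      by rewrite divr_ge0//; lra.
- apply: (@fatou_bound R (fun n x => (modulus (V_ n x) ^+ 2)%:E)).
  + by move=> n; apply/measurable_EFinP; apply: measurable_funX; exact: mm.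
  + by move=> n x; rewrite lee_fin sqr_ge0.
  + move=> x; apply: cvg_EFin; first exact: nearW.
    by under eq_fun do rewrite expr2; rewrite expr2; apply: cvgM.
  + move=> n; apply: le_trans (dispersive_L2 (dV n)) _.
    rewrite lee_wpmul2l ?lee_fin//; apply: ge0_le_integral => //.
    * by move=> y _; rewrite lee_fin sqr_ge0.
    * by apply/measurable_EFinP; apply: measurable_funX; exact: cmeas_modulus (mP_ n).
    * by apply/measurable_EFinP; apply: measurable_funX; exact: cmeas_modulus mP.
    * by move=> y _; rewrite lee_fin ler_sqr ?nnegrE ?modulus_ge0.
- move=> x.
  have cE : (modulus (V_ n x))%:E @[n --> \oo] --> (modulus (V x))%:E.
    by apply: cvg_EFin; [exact: nearW|exact: cV].
  rewrite -(cvg_lim _ cE)//; apply: lime_le; first by apply/cvg_ex; eexists; exact: cE.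
  apply: nearW => n; apply: le_trans (dispersive_Loo (dV n) x) _.
  rewrite lee_wpmul2l ?lee_fin//; apply: ge0_le_integral => //.
  * by move=> y _; rewrite lee_fin modulus_ge0.
  * by apply/measurable_EFinP; exact: cmeas_modulus (mP_ n).
  * by apply/measurable_EFinP; exact: cmeas_modulus mP.
  * by move=> y _; rewrite lee_fin.
Qed.

End DispersiveBounds.

(** * Superpositions of waves *)

Section KernelOperator.
Context {R : realType}.
Local Notation mu := (@lebesgue_measure R).
Local Notation cint := (@cintegral R setT).
Local Notation cintble := (@cintegrable R setT).
Variables (m : R * R -> R[i]) (al be A B : R).
Hypotheses (A0 : 0 < A) (B0 : 0 <= B).
Hypothesis mm : cmeas m.
Hypothesis m1 : forall s x, modulus (m (s, x)) <= \1_(`[al, be]%classic) s.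
Hypothesis mK : forall x y, modulus (cint (fun s => expi (-1 * (s * y)) * m (s, x))) <= A.
Hypothesis mL : forall F : R -> R[i], cmeas F ->
  (exists M, forall s, modulus (F s) <= M) ->
  (\int[mu]_x (modulus (cint (fun s => m (s, x) * F s)) ^+ 2)%:E <=
    B%:E * \int[mu]_s (modulus (F s) ^+ 2)%:E)%E.
Hypothesis mc : forall x s, s != al -> s != be -> forall e, 0 < e ->
  exists2 d, 0 < d & forall s', `|s' - s| < d -> modulus (m (s', x) - m (s, x)) <= e.

(** Read through $\hat u$, it is bounded on $L^2$ by [mL] and Plancherel's inequality; read through
    [u], its kernel is $\int e^{-isy}m(s,x)\,ds$, bounded by [A] according to [mK]. *)
Definition kernel_op (u : R -> R[i]) (x : R) : R[i] :=
  cint (fun s => m (s, x) * ft (-1) u s).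

Let mmx x : cmeas (fun s => m (s, x)).
Proof. by apply: (cmeas_comp (h := fun s => (s, x)) mm); exact: measurable_pair2. Qed.

Let m1' s x : modulus (m (s, x)) <= 1.
Proof. by apply: le_trans (m1 s x) _; rewrite indicE; case: (_ \in _). Qed.

Let imx x : cintble (fun s => m (s, x)).
Proof.
apply: (@cintegrable_le _ _ (\1_(`[al, be]%classic) : R -> R)) => //.
apply/integrableP; split; first by apply/measurable_EFinP; exact: measurable_indic.
under eq_integral do rewrite /= ger0_norm//.
rewrite integral_indic// setIT.
have : (mu `[al, be]%classic < +oo)%E.
  by rewrite lebesgue_measure_itv /=; case: ifP => // _; rewrite -EFinB ltry.
exact.
Qed.

Let ft_bounded u : cintble u -> exists M, forall s, modulus (ft (-1) u s) <= M.
Proof. by move=> iu; exists (\int[mu]_y modulus (u y)) => s; exact: modulus_ft_le. Qed.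

Let imF F x : cmeas F -> (exists M, forall s, modulus (F s) <= M) ->
  cintble (fun s => m (s, x) * F s).
Proof.
move=> mF [M FM]; rewrite (_ : (fun s => _) = fun s => F s * m (s, x)).
  exact: cintegrableM_bounded mF FM (imx x).
by apply/funext => s; rewrite mulrC.
Qed.

Lemma kernel_opE u x : cintble u ->
  kernel_op u x = cint (fun y => u y * cint (fun s => expi (-1 * (s * y)) * m (s, x))).
Proof.
move=> iu; have e1 (z : R * R) : modulus (expi (-1 * (z.1 * z.2))) <= 1.
  by rewrite modulus_expi.
exact: (cint_swap (imx x) iu (cmeas_expiM (-1)) e1).
Qed.

Let sqN1 : (-1) ^+ 2 = 1 :> R. Proof. by rewrite sqrrN expr1n. Qed.

Lemma kernel_op_bounds : forall u, cintble u ->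
  dispersive_bounds A (B * (2 * pi)) u (kernel_op u).
Proof.
have B'0 : 0 <= B * (2 * pi) by rewrite !mulr_ge0// pi_ge0.
have TD u v : cintble u -> cintble v ->
    forall x, kernel_op (fun y => u y + v y) x = kernel_op u x + kernel_op v x.
  move=> iu iv x; rewrite /kernel_op -cintD; last 2 first.
  - by apply: imF; [exact: cmeas_ft|exact: ft_bounded].
  - by apply: imF; [exact: cmeas_ft|exact: ft_bounded].
  apply: eq_cint => s; rewrite -mulrDr; congr (_ * _).
  rewrite /ft -cintD; [|exact: cintegrable_expiM..].
  by apply: eq_cint => y; rewrite mulrDr.
have Tm u : cintble u -> cmeas (kernel_op u).
  move=> iu; apply: (@cmeas_cint_param _ (fun z => m z * ft (-1) u z.1)).
  by apply: cmeasM => //; apply: (cmeas_comp (cmeas_ft (-1) iu)); exact: measurable_fst.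
have T1 u : cintble u -> forall x, modulus (kernel_op u x) <= A * \int[mu]_y modulus (u y).
  move=> iu x; rewrite kernel_opE//.
  have mk : cmeas (fun y => cint (fun s => expi (-1 * (s * y)) * m (s, x))).
    apply: (@cmeas_cint_param _ (fun z => expi (-1 * (z.1 * z.2)) * m (z.1, x))).
    apply: cmeasM; first exact: cmeas_expiM.
    by apply: (cmeas_comp (mmx x)); exact: measurable_fst.
  have iuk : cintble (fun y => u y * cint (fun s => expi (-1 * (s * y)) * m (s, x))).
    rewrite (_ : (fun y => _) = fun y => cint (fun s => expi (-1 * (s * y)) * m (s, x)) * u y).
      exact: cintegrableM_bounded mk (mK x) iu.
    by apply/funext => y; rewrite mulrC.
  apply: le_trans (modulus_cint_le_fine iuk) _.
  have im := cintegrable_modulus iu.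
  rewrite -RintegralZl//; apply: le_Rintegral => //.
  - exact: cintegrable_modulus.
  - rewrite (_ : EFin \o _ = fun y => (A%:E * (EFin \o (fun y => modulus (u y))) y)%E)//.
    exact: integrableZl.
  - by move=> y _; rewrite modulusM mulrC ler_wpM2r ?modulus_ge0.
have T2 u : cintble u -> (\int[mu]_x (modulus (kernel_op u x) ^+ 2)%:E <=
    (B * (2 * pi))%:E * \int[mu]_y (modulus (u y) ^+ 2)%:E)%E.
  move=> iu; apply: le_trans (mL (cmeas_ft _ iu) (ft_bounded iu)) _.
  by rewrite EFinM -muleA lee_wpmul2l ?lee_fin//; exact: plancherel_le.
move=> u iu; split.
- exact: Tm.
- by move=> r S r2 S0 uS; exact: (marcinkiewicz A0 B'0 TD Tm T1 T2).
- exact: T2.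
- move=> x; have im := cintegrable_modulus iu.
  rewrite -[X in (_ * X)%E]fineK; last exact: integrable_fin_num im.
  by rewrite -EFinM lee_fin; exact: T1.
Qed.

Lemma inv_fourierE (f : R -> R[i]) (y : R) : inv_fourier f y = ((2 * pi)^-1)%:C%C * ft 1 f y.
Proof.
rewrite /inv_fourier /ft; congr (_ * _); apply: eq_cint => s; congr (_ * _).
by rewrite cexp_i; congr expi; ring.
Qed.

(** The convolution of $m(\cdot,x)$ with the Poisson kernel of mass one, into which the factor
    $e^{-\varepsilon|y|}$ is transformed on the frequency side. *)
Definition mollified (eps x s : R) : R[i] :=
  ((2 * pi)^-1)%:C%C * cint (fun s' => (poisson eps (s - s'))%:C%C * m (s', x)).

Let pi2 : 0 < 2 * pi :> R. Proof. by rewrite mulr_gt0// pi_gt0. Qed.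

Let cint_poisson eps s : 0 < eps ->
  cintble (fun s' => (poisson eps (s - s'))%:C%C) /\
  cint (fun s' => (poisson eps (s - s'))%:C%C) = (2 * pi)%:C%C.
Proof.
move=> e0.
have mp : measurable_fun setT (fun s' : R => poisson eps (s - s')).
  by apply: continuous_measurable_fun; exact: continuous_poissonB.
have ip : mu.-integrable setT (EFin \o (fun s' => poisson eps (s - s'))).
  apply/integrableP; split; first exact/measurable_EFinP.
  under eq_integral do rewrite /= ger0_norm ?(poisson_ge0 _ (ltW e0))//.
  by rewrite integral_poisson// ltry.
split.
  apply: (cintegrable_le _ _ ip); first exact: cmeas_real.
  by move=> s'; rewrite modulus_real ger0_norm// poisson_ge0// ltW.
by rewrite /cintegral /= /Rintegral integral0 integral_poisson.
Qed.

(** Stands in for Fourier inversion, which would require [inv_fourier f] to be integrable. Changes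
    of order carry the damping from the variable $y$ to the multiplier and leave [f] untouched. *)
Lemma kernel_op_damp (f : R -> R[i]) (eps x : R) : 0 < eps -> cintble f ->
  kernel_op (fun y => (damp eps y)%:C%C * inv_fourier f y) x =
  cint (fun s => f s * mollified eps x s).
Proof.
move=> e0 fi.
have e1 (c : R) (z : R * R) : modulus (expi (c * (z.1 * z.2))) <= 1.
  by rewrite modulus_expi.
have mft := cmeas_ft 1 fi.
have idmp : cintble (fun y => (damp eps y)%:C%C).
  apply: (@cintegrable_le _ _ (damp eps)); [exact: cmeas_damp|by move=> y; rewrite modulus_damp|exact: integrable_damp].
have iP : cintble (fun y => (damp eps y)%:C%C * inv_fourier f y).
  rewrite (_ : (fun y => _) = fun y => (((2 * pi)^-1)%:C%C * ft 1 f y) * (damp eps y)%:C%C); last first.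
    by apply/funext => y; rewrite inv_fourierE mulrC.
  apply: (cintegrableM_bounded (M := (2 * pi)^-1 * \int[mu]_y modulus (f y))) => //.
    by apply: cmeasM => //; exact: cmeas_cst.
  move=> y; rewrite modulusM modulus_real ger0_norm ?invr_ge0 ?(ltW pi2)//.
  by rewrite ler_wpM2l ?invr_ge0 ?(ltW pi2)//; exact: modulus_ft_le.
rewrite kernel_opE//.
pose ka y := cint (fun s => expi (-1 * (s * y)) * m (s, x)).
have mka : cmeas ka.
  apply: (@cmeas_cint_param _ (fun z => expi (-1 * (z.1 * z.2)) * m (z.1, x))).
  apply: cmeasM; first exact: cmeas_expiM.
  by apply: (cmeas_comp (mmx x)); exact: measurable_fst.
have ip : cintble (fun y => ka y * (damp eps y)%:C%C).
  exact: cintegrableM_bounded mka (mK x) idmp.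
have iq := cintegrableZ ((2 * pi)^-1)%:C%C ip.
transitivity (cint (fun y => (((2 * pi)^-1)%:C%C * (ka y * (damp eps y)%:C%C)) *
    cint (fun s => expi (1 * ((y, s).1 * (y, s).2)) * f s))).
  apply: eq_cint => y; rewrite inv_fourierE -/(ka y).
  rewrite -[cint (fun s => expi (1 * ((y, s).1 * _)) * _)]/(ft 1 f y).
  by rewrite [in LHS]mulrC mulrA mulrA -[in RHS]mulrA [in RHS]mulrC mulrA; ring.
rewrite (cint_swap iq fi (cmeas_expiM 1) (e1 1)).
apply: eq_cint => s; congr (_ * _); rewrite /mollified.
transitivity (((2 * pi)^-1)%:C%C * cint (fun y => (expi (s * y) * (damp eps y)%:C%C) *
   cint (fun s' => expi (-1 * ((y, s').1 * (y, s').2)) * m (s', x)))).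
  have kaE y : cint (fun s' => expi (-1 * ((y, s').1 * (y, s').2)) * m (s', x)) = ka y.
    by apply: eq_cint => s'; congr (expi _ * _) => /=; ring.
  rewrite -cintZ.
    apply: eq_cint => y; rewrite kaE /=.
    have -> : 1 * (y * s) = s * y by ring.
    by ring.
  rewrite (_ : (fun y => _) = fun y => expi (s * y) * (ka y * (damp eps y)%:C%C)); last first.
    by apply/funext => y; rewrite kaE; ring.
  apply: (cintegrableM_bounded (M := 1)) ip; last by move=> y; rewrite modulus_expi.
  by apply: cmeas_expi; apply: measurable_funM.
congr (_ * _).
rewrite (cint_swap (cintegrable_expi_damp s e0) (imx x) (cmeas_expiM (-1)) (e1 (-1))).
apply: eq_cint => s'; rewrite [RHS]mulrC; congr (_ * _).
rewrite -cint_expi_damp//; apply: eq_cint => y.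
by rewrite mulrA -expiD; congr (expi _ * _) => /=; ring.
Qed.

Let cint_poissonM (h : R -> R[i]) (M : R) eps s : 0 < eps -> cmeas h ->
  (forall s', modulus (h s') <= M) ->
  cintble (fun s' => (poisson eps (s - s'))%:C%C * h s').
Proof.
move=> e0 mh hM; have [ip _] := cint_poisson s e0.
rewrite (_ : (fun s' => _) = fun s' => h s' * (poisson eps (s - s'))%:C%C).
  exact: cintegrableM_bounded mh hM ip.
by apply/funext => s'; rewrite mulrC.
Qed.

Let Rint_poisson eps s : 0 < eps ->
  mu.-integrable setT (EFin \o (fun s' => poisson eps (s - s'))) /\
  \int[mu]_s' poisson eps (s - s') = 2 * pi.
Proof.
move=> e0; have [[ip _] [h _]] := cint_poisson s e0; split.
  by move: ip; rewrite /=.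
by rewrite -h.
Qed.

Lemma mollified_le eps x s : 0 < eps -> modulus (mollified eps x s) <= 1.
Proof.
move=> e0; have im := cint_poissonM s e0 (mmx x) (fun s => m1' s x).
have [ip Ip] := Rint_poisson s e0.
rewrite /mollified modulusM modulus_real ger0_norm ?invr_ge0 ?(ltW pi2)//.
rewrite ler_pdivrMl// mulr1; apply: le_trans (modulus_cint_le_fine im) _.
rewrite -Ip; apply: le_Rintegral => //; first exact: cintegrable_modulus.
move=> s' _; rewrite modulusM modulus_real ger0_norm ?(poisson_ge0 _ (ltW e0))//.
by rewrite ler_piMr// (poisson_ge0 _ (ltW e0)).
Qed.

(** For $|s'-s|\ge d$ the difference of multipliers is at most $2$ and
    $p_\varepsilon\le\varepsilon(1+d^{-2})p_1$. The tail is thus bounded by the mass of the Poisson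
    kernel of width one, and no tail integral has to be computed. *)
Lemma mollified_sub_le eps e d x s : 0 < eps -> 0 < e -> 0 < d ->
  (forall s', `|s' - s| < d -> modulus (m (s', x) - m (s, x)) <= e) ->
  modulus (mollified eps x s - m (s, x)) <= e + 2 * (1 + d ^- 2) * eps.
Proof.
move=> eps0 e0 d0 md; have [ip Ip] := cint_poisson s eps0.
have im := cint_poissonM s eps0 (mmx x) (fun s => m1' s x).
have mh : cmeas (fun s' => m (s', x) - m (s, x)).
  by apply: cmeasD => //; exact: cmeas_cst.
have h2 s' : modulus (m (s', x) - m (s, x)) <= 2.
  by apply: le_trans (modulusD _ _) _; rewrite modulusN; have := m1' s' x; have := m1' s x; lra.
have ih := cint_poissonM s eps0 mh h2.
have -> : mollified eps x s - m (s, x) =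
    ((2 * pi)^-1)%:C%C * cint (fun s' => (poisson eps (s - s'))%:C%C * (m (s', x) - m (s, x))).
  have -> : cint (fun s' => (poisson eps (s - s'))%:C%C * (m (s', x) - m (s, x))) =
      cint (fun s' => (poisson eps (s - s'))%:C%C * m (s', x)) - m (s, x) * (2 * pi)%:C%C.
    rewrite -Ip -mulNr -cintZ// -cintD//; last exact: cintegrableZ.
    by apply: eq_cint => s'; ring.
  rewrite mulrBr /mollified; congr (_ - _).
  rewrite mulrCA -rmorphM /= mulVf ?gt_eqF// mulr1//.
have [ip1 Ip1] := Rint_poisson s (@ltr01 R); have [ipe Ipe] := Rint_poisson s eps0.
rewrite modulusM modulus_real ger0_norm ?invr_ge0 ?(ltW pi2)//.
rewrite ler_pdivrMl//; apply: le_trans (modulus_cint_le_fine ih) _.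
pose K := 2 * (1 + d ^- 2) * eps.
have d20 : 0 < d ^- 2 by rewrite invr_gt0 exprn_gt0.
have K0 : 0 <= K by rewrite /K !mulr_ge0 ?(ltW eps0)//; lra.
have iZ (c : R) (h : R -> R) : mu.-integrable setT (EFin \o h) ->
    mu.-integrable setT (EFin \o (fun x => c * h x)).
  move=> ih'; rewrite (_ : EFin \o _ = (fun x => c%:E * (EFin \o h) x)%E)//.
  exact: integrableZl.
apply: (@le_trans _ _ (\int[mu]_s' (e * poisson eps (s - s') + K * poisson 1 (s - s')))).
  apply: le_Rintegral => //.
  - exact: cintegrable_modulus.
  - rewrite (_ : EFin \o _ = (EFin \o (fun s' => (e * poisson eps (s - s'))%R)) \+
      (EFin \o (fun s' => (K * poisson 1 (s - s'))%R)))%E//.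
    by apply: integrableD => //; exact: iZ.
  move=> s' _; rewrite modulusM modulus_real ger0_norm ?(poisson_ge0 _ (ltW eps0))//.
  have p0 := poisson_ge0 (s - s') (ltW eps0).
  have p10 := poisson_ge0 (s - s') (@ler01 R).
  have [sd|ds] := ltP `|s' - s| d.
    rewrite [leLHS]mulrC -[leLHS]addr0; apply: lerD; last exact: mulr_ge0.
    by apply: ler_wpM2r => //; exact: md.
  rewrite -[leLHS]add0r; apply: lerD; first exact: mulr_ge0 (ltW e0) p0.
  apply: (@le_trans _ _ (poisson eps (s - s') * 2)); first by rewrite ler_wpM2l.
  have d2 : d ^+ 2 <= (s - s') ^+ 2.
    by rewrite -(real_normK (num_real (s - s'))) distrC ler_sqr ?nnegrE ?(ltW d0).
  have dd : 0 < d ^+ 2 by rewrite exprn_gt0.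
  rewrite /poisson /K expr1n; set v := (s - s') ^+ 2 in d2 *.
  have v0 : 0 < v by exact: lt_le_trans d2.
  have ev : 0 < eps ^+ 2 + v by rewrite addr_gt0// exprn_gt0.
  have v1 : 0 < 1 + v by lra.
  apply: (@le_trans _ _ (2 * eps / v * 2)).
    rewrite ler_wpM2r// ler_wpM2l ?mulr_ge0 ?(ltW eps0)// lef_pV2 ?posrE//.
    by rewrite lerDr sqr_ge0.
  rewrite (_ : 2 * (1 + d ^- 2) * eps * (2 * 1 / (1 + v)) = 2 * eps * 2 * ((1 + d ^- 2) / (1 + v))); last first.
    by field; rewrite !gt_eqF.
  rewrite (_ : 2 * eps / v * 2 = 2 * eps * 2 * v^-1); last by field; rewrite gt_eqF.
  rewrite ler_wpM2l ?mulr_ge0 ?(ltW eps0)// ler_pdivlMr// mulrDr mulr1 mulVf ?gt_eqF//.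
  by rewrite addrC lerD2l lef_pV2 ?posrE.
rewrite RintegralD//; [|exact: iZ..].
have -> : \int[mu]_s' (e * poisson eps (s - s')) = e * (2 * pi).
  by rewrite -Ipe; exact: RintegralZl.
have -> : \int[mu]_s' (K * poisson 1 (s - s')) = K * (2 * pi).
  by rewrite -Ip1; exact: RintegralZl.
by rewrite -mulrDl mulrC.
Qed.

Lemma cvg_mollified x s : s != al -> s != be ->
  modulus (mollified n.+1%:R^-1 x s - m (s, x)) @[n --> \oo] --> 0.
Proof.
move=> sal sbe; apply/cvgr0Pnorm_le => e e0.
have e2 : 0 < e / 2 by rewrite divr_gt0.
have [d d0 md] := mc x sal sbe e2.
have K0 : 0 < 2 * (1 + d ^- 2) by rewrite mulr_gt0// addr_gt0// invr_gt0 exprn_gt0.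
have H := @cvg_harmonic R; move/cvgr0Pnorm_le : H => /(_ (e / 2 / (2 * (1 + d ^- 2)))).
rewrite divr_gt0// => /(_ isT); apply: filterS => n.
rewrite ger0_norm ?invr_ge0// ler_pdivlMr// => hn.
rewrite ger0_norm ?modulus_ge0//.
have n0 : 0 < n.+1%:R^-1 :> R by rewrite invr_gt0.
apply: le_trans (mollified_sub_le n0 e2 d0 md) _.
by rewrite [leRHS]splitr lerD2l mulrC.
Qed.

Theorem kernel_dispersive (f : R -> R[i]) : cintble f ->
  dispersive_bounds A (B * (2 * pi)) (inv_fourier f) (fun x => cint (fun s => m (s, x) * f s)).
Proof.
move=> fi; have mf := cintegrable_meas fi.
have mP : cmeas (inv_fourier f).
  rewrite (_ : inv_fourier f = fun y => ((2 * pi)^-1)%:C%C * ft 1 f y).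
    by apply: cmeasM; [exact: cmeas_cst|exact: cmeas_ft].
  by apply/funext => y; rewrite inv_fourierE.
have n0 n : 0 < n.+1%:R^-1 :> R by rewrite invr_gt0.
pose P_ n y := (damp n.+1%:R^-1 y)%:C%C * inv_fourier f y.
have PE n y : modulus (P_ n y) = damp n.+1%:R^-1 y * modulus (inv_fourier f y).
  by rewrite modulusM modulus_damp.
have iP n : cintble (P_ n).
  apply: (@cintegrable_le _ _ (fun y => ((2 * pi)^-1 * \int[mu]_y modulus (f y)) * damp n.+1%:R^-1 y)).
  - by apply: cmeasM => //; exact: cmeas_damp.
  - move=> y; rewrite PE mulrC ler_wpM2r ?(ltW (damp_gt0 _ _))// inv_fourierE.
    rewrite modulusM modulus_real ger0_norm ?invr_ge0 ?(ltW pi2)//.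
    by rewrite ler_wpM2l ?invr_ge0 ?(ltW pi2)//; exact: modulus_ft_le.
  - set c := _ * _; rewrite (_ : EFin \o _ = (fun x => c%:E * (EFin \o damp n.+1%:R^-1) x)%E)//.
    by apply: integrableZl => //; exact: integrable_damp.
apply: (@dispersive_bounds_lim _ _ _ P_ (fun n => kernel_op (P_ n))) => //.
- exact: ltW.
- by rewrite mulr_ge0// ltW.
- by move=> n; exact: cintegrable_meas.
- by move=> n y; rewrite PE ler_piMl ?modulus_ge0// damp_le1// ltW.
- by move=> n; exact: kernel_op_bounds.
move=> x.
have -> : (fun n => modulus (kernel_op (P_ n) x - cint (fun s => m (s, x) * f s))) =
    (fun n => modulus (cint (fun s => f s * mollified n.+1%:R^-1 x s) - cint (fun s => m (s, x) * f s))).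
  by apply/funext => n; rewrite /P_ kernel_op_damp.
apply: (@cint_dominated_cvg _ _ _ (fun s => modulus (f s))).
- move=> n; apply: cmeasM => //; apply: cmeasM; first exact: cmeas_cst.
  apply: (@cmeas_cint_param _ (fun z => (poisson n.+1%:R^-1 (z.2 - z.1))%:C%C * m (z.1, x))).
  apply: cmeasM.
    apply: cmeas_real; apply: (measurableT_comp (f := poisson n.+1%:R^-1)).
      exact: continuous_measurable_fun (continuous_poisson (n0 n)).
    by apply: measurable_funB; [exact: measurable_snd|exact: measurable_fst].
  by apply: (cmeas_comp (mmx x)); exact: measurable_fst.
- exact: cintegrableM_bounded (mmx x) (fun s => m1' s x) fi.
(* Convergence of the mollified multiplier is known off the two points where the cutoff may jump, a
   null set. *)
- exists ([set al] `|` [set be]); split.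
  + exact: measurableU.
  + rewrite null_set_setU//; exact: lebesgue_measure_set1.
  move=> s /= h; apply: contrapT => /not_orP[/eqP sal /eqP sbe]; apply: h.
  apply: (cvg0_dominated (K := modulus (f s)) _ (cvg_mollified x sal sbe)) => n.
  by rewrite ger0_norm ?modulus_ge0// (mulrC (m _)) -mulrBr modulusM.
- move=> n s; rewrite modulusM ler_piMr ?modulus_ge0//; exact: mollified_le.
- exact: cintegrable_modulus.
Qed.

End KernelOperator.

(** * Damped waves cut off to a compact interval of frequencies *)

Section WaveKernel.
Context {R : realType}.
Local Notation mu := (@lebesgue_measure R).
Local Notation cint := (@cintegral R setT).
Local Notation cintble := (@cintegrable R setT).
Variables (eta P : R -> R) (kap tau : R).
Hypotheses (ceta : continuous eta) (cP : continuous P).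

(** The arguments are $(s,x)$, with $\mathrm{Re}\,k=\kappa s$, $\mathrm{Im}\,k=\eta(s)$ and
    $\tau^4=t$. Using $|x|$ extends the damping evenly to the whole line, where the $L^2$ theory
    takes place; for $x\ge0$ nothing changes. *)
Definition wave (z : R * R) : R[i] :=
  (expR (- (eta z.1 * `|z.2|)))%:C%C * expi (kap * (z.1 * z.2) + tau ^+ 4 * P z.1).

Definition wave_kernel (al be : R) (z : R * R) : R[i] :=
  (\1_(`[al, be]%classic) z.1)%:C%C * wave z.

Lemma cmeas_wave : cmeas wave.
Proof.
have m1 : measurable_fun setT (fun z : R * R => eta z.1).
  by apply: (measurableT_comp (continuous_measurable_fun ceta)); exact: measurable_fst.
have m2 : measurable_fun setT (fun z : R * R => P z.1).
  by apply: (measurableT_comp (continuous_measurable_fun cP)); exact: measurable_fst.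
have m3 : measurable_fun setT (fun z : R * R => `|z.2|).
  by apply: measurableT_comp => //; exact: measurable_snd.
apply: cmeasM.
  apply: cmeas_real; apply: (measurableT_comp (@measurable_expR R)).
  by apply: measurableT_comp => //; exact: measurable_funM.
apply: cmeas_expi; apply: measurable_funD; apply: measurable_funM => //.
by apply: measurable_funM; [exact: measurable_fst|exact: measurable_snd].
Qed.

Lemma modulus_wave z : modulus (wave z) = expR (- (eta z.1 * `|z.2|)).
Proof. by rewrite modulusM modulus_expi mulr1 modulus_real ger0_norm// expR_ge0. Qed.

Lemma indic_itvE (al be s : R) :
  \1_(`[al, be]%classic) s = if al <= s <= be then 1 else 0 :> R.
Proof.
rewrite indicE; case: ifPn => h; first by rewrite mem_set//= in_itv.
by rewrite memNset//= in_itv /=; exact/negP.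
Qed.

Lemma continuous_wave x s e : 0 < e ->
  exists2 d, 0 < d & forall s', `|s' - s| < d -> modulus (wave (s', x) - wave (s, x)) <= e.
Proof.
move=> e0; have e2 : 0 < e / 2 by rewrite divr_gt0.
have ca : continuous (fun s : R => expR (- (eta s * `|x|))).
  move=> v; apply: (@continuous_comp _ _ _ (fun s => - (eta s * `|x|)) expR); last exact: continuous_expR.
  by apply: cvgN; apply: cvgM; [exact: ceta|exact: cvg_cst].
have cth : continuous (fun s : R => kap * (s * x) + tau ^+ 4 * P s).
  move=> v; apply: cvgD; apply: cvgM; try exact: cvg_cst; last exact: cP.
  by apply: cvgM; [exact: cvg_id|exact: cvg_cst].
have cRe : {for s, continuous (fun s => complex.Re (wave (s, x)))}.
  rewrite (_ : (fun s => _) = fun s => expR (- (eta s * `|x|)) * cos (kap * (s * x) + tau ^+ 4 * P s)).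
    apply: cvgM; first exact: ca.
    exact: (cvg_comp _ _ (cth s) (@continuous_cos R _)).
  by apply/funext => v; rewrite /= mul0r subr0.
have cIm : {for s, continuous (fun s => complex.Im (wave (s, x)))}.
  rewrite (_ : (fun s => _) = fun s => expR (- (eta s * `|x|)) * sin (kap * (s * x) + tau ^+ 4 * P s)).
    apply: cvgM; first exact: ca.
    exact: (cvg_comp _ _ (cth s) (@continuous_sin R _)).
  by apply/funext => v; rewrite /= mul0r addr0.
move/cvgrPdist_le : cRe => /(_ _ e2) nRe; move/cvgrPdist_le : cIm => /(_ _ e2) nIm.
have [d d0 hd] := (nbhs_ballP _ _).1 (filterI nRe nIm).
exists d => // s' ss'.
have bs : ball s d s' by rewrite /ball /= distrC.
have [h1 h2] := hd s' bs; apply: le_trans (modulus_le_ReIm _) _.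
rewrite [leRHS]splitr; apply: lerD.
  by rewrite raddfB distrC.
by rewrite raddfB distrC.
Qed.

Variables (al be : R).
Hypotheses (tau0 : 0 < tau) (tau1 : tau <= 1).
Hypothesis eta0 : forall s, al <= s <= be -> 0 <= eta s.

Lemma cmeas_wave_kernel : cmeas (wave_kernel al be).
Proof.
apply: cmeasM; last exact: cmeas_wave.
apply: cmeas_real.
have mi : measurable_fun setT (\1_(`[al, be]%classic) : R -> R) by exact: measurable_indic.
by apply: (measurableT_comp mi); exact: measurable_fst.
Qed.

Lemma modulus_wave_kernel s x :
  modulus (wave_kernel al be (s, x)) <= \1_(`[al, be]%classic) s.
Proof.
rewrite modulusM modulus_real ger0_norm// modulus_wave /= indic_itvE.
case: ifPn => sJ; last by rewrite mul0r.
by rewrite mul1r -expR0 ler_expR oppr_le0 mulr_ge0// eta0.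
Qed.

Lemma continuous_wave_kernel x s : s != al -> s != be -> forall e, 0 < e ->
  exists2 d, 0 < d & forall s', `|s' - s| < d ->
    modulus (wave_kernel al be (s', x) - wave_kernel al be (s, x)) <= e.
Proof.
move=> sal sbe e e0; have [d d0 hd] := continuous_wave x s e0.
(* At points closer to [s] than both endpoints the cutoff has the same value as at [s], so only
   [wave] varies. *)
pose d1 := Num.min `|s - al| `|s - be|.
have d10 : 0 < d1 by rewrite lt_min !normr_gt0 !subr_eq0 sal.
exists (Num.min d d1); first by rewrite lt_min d0.
move=> s'; rewrite lt_min => /andP[s'd]; rewrite lt_min => /andP[s'1 s'2].
have -> : wave_kernel al be (s', x) - wave_kernel al be (s, x) =
    (\1_(`[al, be]%classic) s)%:C%C * (wave (s', x) - wave (s, x)).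
  have -> : wave_kernel al be (s', x) = (\1_(`[al, be]%classic) s)%:C%C * wave (s', x).
    have side (c v v' : R) : v != c -> `|v' - v| < `|v - c| ->
        ((c <= v') = (c <= v)) * ((v' <= c) = (v <= c)).
      case: (ltgtP v c) => // vc _.
        rewrite [`|v - c|]ltr0_norm ?subr_lt0// ltr_norml => h.
        by split; [apply/negbTE; rewrite -ltNge; lra|apply/idP; lra].
      rewrite [`|v - c|]gtr0_norm ?subr_gt0// ltr_norml => h.
      by split; [apply/idP; lra|apply/negbTE; rewrite -ltNge; lra].
    rewrite /wave_kernel -[(s', x).1]/s'; congr (_%:C%C * _).
    by rewrite !indic_itvE (side al s s' sal s'1) (side be s s' sbe s'2).
  by rewrite /wave_kernel mulrBr.
rewrite modulusM modulus_real ger0_norm//.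
apply: le_trans (hd s' s'd); rewrite ler_piMl ?modulus_ge0//.
Qed.

(** Real and imaginary parts are both oscillatory cosine integrals, since
    $\sin\theta=\cos(\theta-\pi/2)$; hence the factor $2$. The space variables enter the phase only
    through its linear coefficient $\kappa x-y$. *)
Lemma wave_kernel_osc_le (A : R) x y :
  (forall c d, `|\int[mu]_(s in `[al, be]) (expR (- (eta s * `|x|)) *
     cos (tau ^+ 4 * P s + c * s + d))| <= A) ->
  modulus (cint (fun s => expi (-1 * (s * y)) * wave_kernel al be (s, x))) <= 2 * A.
Proof.
move=> HA; pose c := kap * x - y.
have E s : expi (-1 * (s * y)) * wave_kernel al be (s, x) =
    (\1_(`[al, be]%classic) s * expR (- (eta s * `|x|)))%:C%C * expi (tau ^+ 4 * P s + c * s).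
  rewrite /wave_kernel /wave -[(s, x).1]/s -[(s, x).2]/x.
  rewrite [RHS](_ : _ = (\1_(`[al, be]%classic) s)%:C%C * ((expR (- (eta s * `|x|)))%:C%C * expi (tau ^+ 4 * P s + c * s))); last by rewrite rmorphM /= mulrA.
  rewrite mulrCA; congr (_ * _); rewrite mulrCA; congr (_ * _).
  by rewrite -expiD; congr expi; rewrite /c; ring.
have patch (g : R -> R) : \int[mu]_s (\1_(`[al, be]%classic) s * expR (- (eta s * `|x|)) * g s) =
    \int[mu]_(s in `[al, be]) (expR (- (eta s * `|x|)) * g s).
  rewrite [RHS]Rintegral_mkcond; apply: eq_Rintegral => s _.
  by rewrite patchE indicE; case: ifP; rewrite ?mul1r ?mul0r.
apply: le_trans (modulus_le_ReIm _) _; rewrite mulr_natl mulr2n; apply: lerD.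
  rewrite [complex.Re _](_ : _ = \int[mu]_(s in `[al, be]) (expR (- (eta s * `|x|)) *
     cos (tau ^+ 4 * P s + c * s + 0))); first exact: HA.
  rewrite -patch -[LHS]/(\int[mu]_s complex.Re (expi (-1 * (s * y)) * wave_kernel al be (s, x))).
  by apply: eq_Rintegral => s _; rewrite E addr0 /= mul0r subr0.
rewrite [complex.Im _](_ : _ = \int[mu]_(s in `[al, be]) (expR (- (eta s * `|x|)) *
     cos (tau ^+ 4 * P s + c * s + - (pi / 2)))); first exact: HA.
rewrite -patch -[LHS]/(\int[mu]_s complex.Im (expi (-1 * (s * y)) * wave_kernel al be (s, x))).
apply: eq_Rintegral => s _; rewrite E /= mul0r addr0.
by rewrite cosB cos_pihalf sin_pihalf mulr0 mulr1 add0r.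
Qed.

(** Without damping the superposition is the Fourier integral of [v], and the time factor has
    modulus one. *)
Lemma wave_kernel_L2_fourier (F : R -> R[i]) : (forall s, eta s = 0) -> kap = 1 ->
  cmeas F -> (exists M, forall s, modulus (F s) <= M) ->
  (\int[mu]_x (modulus (cint (fun s => wave_kernel al be (s, x) * F s)) ^+ 2)%:E <=
    (2 * pi)%:E * \int[mu]_s (modulus (F s) ^+ 2)%:E)%E.
Proof.
move=> eta00 kap1 mF [M FM].
have M0 : 0 <= M by apply: le_trans (FM 0); exact: modulus_ge0.
have mi : measurable_fun setT (\1_(`[al, be]%classic) : R -> R) by exact: measurable_indic.
pose v s := (\1_(`[al, be]%classic) s)%:C%C * (expi (tau ^+ 4 * P s) * F s).
have mv : cmeas v.
  apply: cmeasM; first exact: cmeas_real; apply: cmeasM => //.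
  by apply: cmeas_expi; apply: measurable_funM => //; exact: continuous_measurable_fun cP.
have vle s : modulus (v s) <= M * \1_(`[al, be]%classic) s.
  rewrite /v modulusM modulus_real modulusM modulus_expi mul1r ger0_norm//.
  by rewrite mulrC ler_wpM2r.
have iv : cintble v.
  apply: (@cintegrable_le _ _ (fun s => M * \1_(`[al, be]%classic) s)) => //.
  rewrite (_ : EFin \o _ = (fun s => M%:E * (EFin \o (\1_(`[al, be]%classic) : R -> R)) s)%E)//.
  apply: integrableZl => //; apply/integrableP; split.
    by apply/measurable_EFinP.
  under eq_integral do rewrite /= ger0_norm//.
  rewrite integral_indic// setIT.
  have : (mu `[al, be]%classic < +oo)%E.
    by rewrite lebesgue_measure_itv /=; case: ifP => // _; rewrite -EFinB ltry.
  exact.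
have -> : (fun x => (modulus (cint (fun s => wave_kernel al be (s, x) * F s)) ^+ 2)%:E) =
    (fun x => (modulus (ft 1 v x) ^+ 2)%:E).
  apply/funext => x; congr ((modulus _ ^+ 2)%:E); apply: eq_cint => s.
  rewrite /wave_kernel /wave /v -[(s, x).1]/s -[(s, x).2]/x eta00 kap1 mul0r oppr0 expR0.
  have -> : expi (1 * (s * x) + tau ^+ 4 * P s) = expi (1 * (x * s)) * expi (tau ^+ 4 * P s).
    by rewrite -expiD; congr expi; ring.
  by rewrite mul1r; ring.
apply: le_trans (plancherel_le _ iv) _; first by rewrite expr1n.
rewrite lee_wpmul2l ?lee_fin ?mulr_ge0 ?pi_ge0//; apply: ge0_le_integral => //.
- by move=> s _; rewrite lee_fin sqr_ge0.
- by apply/measurable_EFinP; apply: measurable_funX; exact: cmeas_modulus.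
- by apply/measurable_EFinP; apply: measurable_funX; exact: cmeas_modulus.
- move=> s _; rewrite lee_fin ler_sqr ?nnegrE ?modulus_ge0//.
  rewrite /v modulusM modulus_real modulusM modulus_expi mul1r ger0_norm//.
  by rewrite ler_piMl ?modulus_ge0// indic_itvE; case: ifP.
Qed.

(** The phase is discarded: the superposition is at most $\int|F(s)|e^{-(s-p)|x|}ds$ over the
    interval, a Laplace transform in $|x|$. *)
Lemma wave_kernel_L2_laplace (F : R -> R[i]) (p : R) : p < al -> al < be ->
  (forall s, al <= s <= be -> s - p <= eta s) ->
  cmeas F -> (exists M, forall s, modulus (F s) <= M) ->
  (\int[mu]_x (modulus (cint (fun s => wave_kernel al be (s, x) * F s)) ^+ 2)%:E <=
    (2 * pi)%:E * \int[mu]_s (modulus (F s) ^+ 2)%:E)%E.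
Proof.
move=> pal albe etap mF [M FM].
have M0 : 0 <= M by apply: le_trans (FM 0); exact: modulus_ge0.
have mi : measurable_fun setT (\1_(`[al, be]%classic) : R -> R) by exact: measurable_indic.
pose a s := \1_(`[al, be]%classic) s * modulus (F s).
have a0 s : 0 <= a s by rewrite mulr_ge0 ?modulus_ge0.
have ma : measurable_fun setT a by apply: measurable_funM => //; exact: cmeas_modulus.
have aJ s : ~~ (al <= s <= be) -> a s = 0.
  by move=> sJ; rewrite /a indic_itvE (negbTE sJ) mul0r.
have ale s : a s <= modulus (F s).
  by rewrite /a indic_itvE; case: ifP; rewrite ?mul1r ?mul0r ?modulus_ge0.
have mW x : cmeas (fun s => wave_kernel al be (s, x) * F s).
  apply: cmeasM => //; apply: (cmeas_comp (h := fun s => (s, x)) cmeas_wave_kernel).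
  exact: measurable_pair2.
have Wle x s : modulus (wave_kernel al be (s, x) * F s) <= a s * damp (s - p) x.
  rewrite modulusM modulusM modulus_real modulus_wave ger0_norm// mulrAC -/(a s).
  have [sJ|sJ] := boolP (al <= s <= be); last by rewrite aJ// !mul0r.
  by rewrite ler_wpM2l// ler_expR lerN2 ler_wpM2r// etap.
have mad x : measurable_fun setT (fun s => (a s * damp (s - p) x)%:E).
  apply/measurable_EFinP; apply: measurable_funM => //.
  apply: (measurableT_comp (@measurable_expR R)); apply: measurableT_comp => //.
  by apply: measurable_funM => //; exact: measurable_funB.
have ad0 x s : (0 <= (a s * damp (s - p) x)%:E)%E.
  by rewrite lee_fin mulr_ge0// ltW// damp_gt0.
have iW x : cintble (fun s => wave_kernel al be (s, x) * F s).
  apply/cintegrableP; split => //.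
  apply: (@le_lt_trans _ _ (\int[mu]_s (M * \1_(`[al, be]%classic) s)%:E)%E).
    apply: ge0_le_integral => //.
    - by move=> s _; rewrite lee_fin modulus_ge0.
    - by apply/measurable_EFinP; exact: (cmeas_modulus (mW x)).
    - by apply/measurable_EFinP; apply: measurable_funM.
    - move=> s _; rewrite lee_fin modulusM mulrC; apply: ler_pM; rewrite ?modulus_ge0//.
      by have := modulus_wave_kernel s x.
  under eq_integral do rewrite EFinM.
  rewrite ge0_integralZl//; last first.
    by apply/measurable_EFinP; exact: mi.
  rewrite lte_mul_pinfty//; rewrite integral_indic// setIT.
  have : (mu `[al, be]%classic < +oo)%E.
    by rewrite lebesgue_measure_itv /=; case: ifP => // _; rewrite -EFinB ltry.
  exact.
have VI x : ((modulus (cint (fun s => wave_kernel al be (s, x) * F s)))%:E <=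
    \int[mu]_s (a s * damp (s - p) x)%:E)%E.
  apply: le_trans (modulus_cint_le (iW x)) _; apply: ge0_le_integral => //.
  - by move=> s _; rewrite lee_fin modulus_ge0.
  - by apply/measurable_EFinP; exact: (cmeas_modulus (mW x)).
  - exact: mad.
  - by move=> s _; rewrite lee_fin.
have madz : measurable_fun setT (fun z : R * R => (a z.1 * damp (z.1 - p) z.2)%:E).
  apply/measurable_EFinP; apply: measurable_funM.
    by apply: (measurableT_comp ma); exact: measurable_fst.
  apply: (measurableT_comp (@measurable_expR R)); apply: measurableT_comp => //.
  apply: measurable_funM.
    by apply: measurable_funB; [exact: measurable_fst|exact: measurable_cst].
  by apply: measurableT_comp => //; exact: measurable_snd.
have mI : measurable_fun setT (fun x => \int[mu]_s (a s * damp (s - p) x)%:E)%E.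
  apply: (measurable_fun_fubini_tonelli_G (m1 := mu) (fun z : R * R => (a z.1 * damp (z.1 - p) z.2)%:E)) => //.
have mV : cmeas (fun x => cint (fun s => wave_kernel al be (s, x) * F s)).
  apply: (@cmeas_cint_param _ (fun z => wave_kernel al be z * F z.1)).
  apply: cmeasM; first exact: cmeas_wave_kernel.
  by apply: (cmeas_comp mF); exact: measurable_fst.
apply: (@le_trans _ _ (\int[mu]_x ((\int[mu]_s (a s * damp (s - p) x)%:E) *
              (\int[mu]_s (a s * damp (s - p) x)%:E)))%E).
  apply: ge0_le_integral => //.
  - by move=> x _; rewrite lee_fin sqr_ge0.
  - by apply/measurable_EFinP; apply: measurable_funX; exact: (cmeas_modulus mV).
  - exact: emeasurable_funM.
  - by move=> x _; rewrite expr2 EFinM lee_pmul ?lee_fin ?modulus_ge0.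
apply: le_trans (laplace_sqr_le pal albe ma a0 aJ) _.
rewrite lee_wpmul2l ?lee_fin ?mulr_ge0 ?pi_ge0//; apply: ge0_le_integral => //.
- by move=> s _; rewrite lee_fin sqr_ge0.
- by apply/measurable_EFinP; apply: measurable_funX.
- by apply/measurable_EFinP; apply: measurable_funX; exact: (cmeas_modulus mF).
- by move=> s _; rewrite lee_fin ler_sqr ?nnegrE ?modulus_ge0.
Qed.

End WaveKernel.

(** * From compact intervals to the five boundary arcs *)

Section Arcs.
Context {R : realType}.
Local Notation mu := (@lebesgue_measure R).
Local Notation cint := (@cintegral R setT).
Local Notation cintble := (@cintegrable R setT).

(** The intervals exhaust the support of [f] up to a null set, with constants independent of [n].
    Only the superposition is approximated; the function $\Psi$ stays fixed along the sequence. *)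
Lemma wave_dispersive (eta P : R -> R) (kap tau A : R) (al be : nat -> R) (f : R -> R[i]) :
  continuous eta -> continuous P -> 0 < A ->
  (forall n (s : R), al n <= s <= be n -> 0 <= eta s) ->
  (forall n (x c d : R), `|\int[mu]_(s in `[al n, be n]) (expR (- (eta s * `|x|)) *
     cos (tau ^+ 4 * P s + c * s + d))| <= A) ->
  (forall n (F : R -> R[i]), cmeas F -> (exists M, forall s, modulus (F s) <= M) ->
    (\int[mu]_x (modulus (cint (fun s => wave_kernel eta P kap tau (al n) (be n) (s, x) * F s)) ^+ 2)%:E <=
      (2 * pi)%:E * \int[mu]_s (modulus (F s) ^+ 2)%:E)%E) ->
  cintble f -> (forall s, f s != 0 -> 0 <= eta s) ->
  {ae mu, forall s, f s != 0 -> \forall n \near \oo, al n <= s <= be n} ->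
  dispersive_bounds (2 * A) (2 * pi * (2 * pi)) (inv_fourier f)
    (fun x => cint (fun s => wave eta P kap tau (s, x) * f s)).
Proof.
move=> ceta cP A0 eta0 osc L2 fi feta fJ.
have mf := cintegrable_meas fi; have mw := cmeas_wave kap tau ceta cP.
have mwx x : cmeas (fun s => wave eta P kap tau (s, x)).
  by apply: (cmeas_comp (h := fun s => (s, x)) mw); exact: measurable_pair2.
have D n : dispersive_bounds (2 * A) (2 * pi * (2 * pi)) (inv_fourier f)
    (fun x => cint (fun s => wave_kernel eta P kap tau (al n) (be n) (s, x) * f s)).
  apply: (@kernel_dispersive _ _ (al n) (be n)) => //.
  - by rewrite mulr_gt0.
  - by rewrite mulr_ge0// pi_ge0.
  - exact: cmeas_wave_kernel.
  - by move=> s x; apply: modulus_wave_kernel; exact: eta0.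
  - by move=> x y; apply: wave_kernel_osc_le; exact: osc.
  - exact: L2.
  - by move=> x s sal sbe e; exact: continuous_wave_kernel.
have mP : cmeas (inv_fourier f).
  rewrite (_ : inv_fourier f = fun y => ((2 * pi)^-1)%:C%C * ft 1 f y).
    by apply: cmeasM; [exact: cmeas_cst|exact: cmeas_ft].
  by apply/funext => y; rewrite inv_fourierE.
apply: (dispersive_bounds_lim _ _ mP (fun=> mP) _ D).
- by rewrite mulr_ge0// ltW.
- by rewrite !mulr_ge0// pi_ge0.
- by [].
move=> x; apply: (@cint_dominated_cvg _ _ _ (fun s => modulus (f s))).
- move=> n; apply: cmeasM => //; apply: (cmeas_comp (h := fun s => (s, x)) (cmeas_wave_kernel kap tau ceta cP (al n) (be n))).
  exact: measurable_pair2.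
- apply: (@cintegrable_leZ _ _ f 1) => //; first exact: cmeasM.
  move=> s; rewrite mul1r modulusM modulus_wave /=.
  have [->|fs] := eqVneq (f s) 0; first by rewrite modulus0 mulr0.
  by rewrite ler_piMl ?modulus_ge0// -expR0 ler_expR oppr_le0 mulr_ge0// feta.
- have [N [mN N0 sN]] := fJ; exists N; split => //; apply: subset_trans sN.
  apply: subsetC => s fs.
  have [f0|f0] := eqVneq (f s) 0.
    apply: (cvg0_dominated (g := fun=> 0) (K := 1)) => [n|]; last exact: cvg_cst.
    by rewrite f0 !mulr0 subrr modulus0 normr0.
  apply: cvg_near_cst; apply: filterS (fs f0) => n sJ; rewrite /wave_kernel -[(s, x).1]/s.
  by rewrite indic_itvE sJ mul1r subrr modulus0.
- move=> n s; rewrite modulusM.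
  rewrite -[leRHS]mul1r ler_wpM2r ?modulus_ge0//.
  apply: le_trans (modulus_wave_kernel (eta := eta) P kap tau (eta0 n) s x) _.
  by rewrite indic_itvE; case: ifP.
- exact: cintegrable_modulus.
Qed.

Lemma near_truncation (c s : R) : c < s ->
  \forall n \near \oo, c + (n%:R + 4)^-1 <= s <= n%:R + 4.
Proof.
move=> cs; have sc : 0 < s - c by rewrite subr_gt0.
near=> n.
have n0 : 0 < n%:R + 4 :> R by rewrite ltr_wpDl.
apply/andP; split.
  rewrite -lerBrDl -[leRHS]invrK lef_pV2 ?posrE ?invr_gt0//.
  have : (s - c)^-1 <= n%:R by near: n; exact: nbhs_infty_ger.
  by move=> h; apply: le_trans h _; rewrite lerDl.
have : s <= n%:R by near: n; exact: nbhs_infty_ger.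
by move=> h; apply: le_trans h _; rewrite lerDl.
Unshelve. all: by end_near. Qed.

(** Conditions on $\eta'$ and $P''$ are imposed for $s\ge1$, the range of the van der Corput
    estimate. This keeps clear of $s=1/\sqrt2$, where $\sqrt{s^2-1/2}$ has no finite derivative. *)
Lemma wave_dispersive_laplace (eta deta P dP ddP : R -> R) (kap tau p : R) (f : R -> R[i]) :
  0 < tau <= 1 -> 0 <= p <= 3 / 4 -> continuous eta ->
  (forall s, p <= s -> s - p <= eta s) ->
  (forall s : R, 1 <= s -> is_derive s 1 eta (deta s)) ->
  (forall s, 1 <= s -> 0 <= deta s) ->
  (forall s : R, is_derive s 1 P (dP s)) ->
  (forall s : R, is_derive s 1 dP (ddP s)) ->
  (forall s, 1 <= s -> s ^+ 2 <= ddP s) \/ (forall s, 1 <= s -> s ^+ 2 <= - ddP s) ->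
  cintble f -> (forall s, f s != 0 -> p <= s) ->
  dispersive_bounds (2 * ((3 + 2 * pi) / tau)) (2 * pi * (2 * pi)) (inv_fourier f)
    (fun x => cint (fun s => wave eta P kap tau (s, x) * f s)).
Proof.
move=> /andP[tau0 tau1] /andP[p0 p34] ceta etap deta1 deta0 hP hdP ddPs fi fp.
have cP : continuous P by move=> s; exact: isd_continuous (hP s).
have eta0 s : p <= s -> 0 <= eta s by move=> ps; apply: le_trans (etap s ps); rewrite subr_ge0.
(* With $p\le3/4$ the shift by $4$ gives $al_n\le1<be_n$, as the oscillatory estimate requires;
   $al_n>p$ keeps $s-p$ positive in Schur's test. *)
pose al (n : nat) : R := p + (n%:R + 4)^-1; pose be (n : nat) : R := n%:R + 4.
have be4 n : 4 <= be n by rewrite /be lerDr.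
have pal n : p < al n by rewrite /al ltrDl invr_gt0; have := be4 n; rewrite /be; lra.
have al1 n : al n <= 1.
  rewrite /al; have : (n%:R + 4)^-1 <= 4^-1 :> R.
    by rewrite lef_pV2 ?posrE //; have := be4 n; rewrite /be; lra.
  by lra.
have albe n : al n < be n by have := al1 n; have := be4 n; lra.
apply: (@wave_dispersive eta P kap tau _ al be) => //.
- by rewrite divr_gt0//; have := pi_gt0 R; lra.
- by move=> n s /andP[als _]; apply: eta0; have := pal n; lra.
- move=> n x c d.
  apply: (@oscillatory_cos_le R tau (al n) (be n) (fun s => expR (- (eta s * `|x|)))
    (fun s => - (expR (- (eta s * `|x|)) * (deta s * `|x|))) tau0 tau1 _ (al1 n) _ _ _ _ _ P dP ddP) => //.
  + by have := pal n; lra.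
  + exact: ltW.
  + apply: (measurableT_comp (@measurable_expR R)); apply: measurableT_comp => //.
    by apply: measurable_funM; [exact: continuous_measurable_fun ceta|exact: measurable_cst].
  + move=> s /andP[als _]; rewrite expR_ge0 -expR0 ler_expR oppr_le0 mulr_ge0//.
    by apply: eta0; have := pal n; lra.
  + move=> s /andP[s1 _].
    have D := isd_exp (isd_opp (isd_mul (deta1 s s1) (isd_cst `|x| s))).
    by apply: (is_derive_eq D); rewrite mulr0 addr0 mulrN.
  + by move=> s /andP[s1 _]; rewrite oppr_le0 !mulr_ge0 ?expR_ge0// deta0.
- move=> n F mF FM.
  apply: (@wave_kernel_L2_laplace R eta P kap tau ceta cP (al n) (be n) _ F p (pal n) (albe n)) => //.
    by move=> s /andP[als _]; apply: eta0; have := pal n; lra.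
  by move=> s /andP[als _]; apply: etap; have := pal n; lra.
- by move=> s /fp; exact: eta0.
exists [set p]; split; [exact: measurable_set1|exact: lebesgue_measure_set1|].
move=> s /= h; apply: contrapT => /eqP sp; apply: h => fs.
by apply: near_truncation; rewrite lt_neqAle eq_sym sp fp.
Qed.

Let P2 (s : R) : R := s ^+ 4 - s ^+ 2.

Let dP2 (s : R) : is_derive s 1 P2 (4 * s ^+ 3 - 2 * s).
Proof. by rewrite /P2; apply: is_derive_eq; rewrite /GRing.scale /=; ring. Qed.

Let ddP2 (s : R) : is_derive s 1 (fun s => 4 * s ^+ 3 - 2 * s) (12 * s ^+ 2 - 2).
Proof. by apply: is_derive_eq; rewrite /GRing.scale /=; ring. Qed.

Let cP2 : continuous P2. Proof. by move=> s; exact: isd_continuous (dP2 s). Qed.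

Let P2_osc (tau a b : R) (x c d : R) : 0 < tau <= 1 -> 0 <= a <= 1 -> a <= b ->
  `|\int[mu]_(s in `[a, b]) (expR (- (0 * `|x|)) * cos (tau ^+ 4 * P2 s + c * s + d))| <=
    (3 + 2 * pi) / tau.
Proof.
move=> /andP[tau0 tau1] /andP[a0 a1] ab.
have e1 : expR (- (0 * `|x|)) = 1 by rewrite mul0r oppr0 expR0.
apply: (@oscillatory_cos_le R tau a b (fun=> expR (- (0 * `|x|))) (fun=> 0) tau0 tau1 a0 a1 ab _ _ _ _
  P2 (fun s => 4 * s ^+ 3 - 2 * s) (fun s => 12 * s ^+ 2 - 2)) => //.
- by move=> s _; rewrite e1 ler01 lexx.
- left; move=> s s1; nra.
Qed.

Let c0 : continuous ((fun=> 0) : R -> R). Proof. by move=> s; exact: cvg_cst. Qed.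

Let A0 (tau : R) : 0 < tau -> 0 < (3 + 2 * pi) / tau.
Proof. by move=> t0; rewrite divr_gt0//; have := pi_gt0 R; lra. Qed.

Lemma wave_dispersive_right (tau a b : R) (f : R -> R[i]) : 0 < tau <= 1 -> 0 <= a <= 1 ->
  a <= b -> cintble f -> (forall s, f s != 0 -> a <= s <= b) ->
  dispersive_bounds (2 * ((3 + 2 * pi) / tau)) (2 * pi * (2 * pi)) (inv_fourier f)
    (fun x => cint (fun s => wave (fun=> 0) P2 1 tau (s, x) * f s)).
Proof.
move=> tau01 a01 ab fi fJ.
apply: (@wave_dispersive (fun=> 0) P2 1 tau _ (fun=> a) (fun=> b)) => //.
- by apply: A0; case/andP: tau01.
- by move=> _ x c d; exact: P2_osc.
- by move=> _ F mF FM; apply: wave_kernel_L2_fourier.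
exists set0; split => // s /= h; exfalso; apply: h => /fJ sJ.
exact: nearW.
Qed.

(** The phase [P2] is even: reflection maps $[-(n+4),-a]$ to $[a,n+4]$ and replaces [c] by [-c],
    which the oscillatory estimate allows. *)
Lemma wave_dispersive_left (tau a : R) (f : R -> R[i]) : 0 < tau <= 1 -> 0 <= a <= 1 ->
  cintble f -> (forall s, f s != 0 -> s <= - a) ->
  dispersive_bounds (2 * ((3 + 2 * pi) / tau)) (2 * pi * (2 * pi)) (inv_fourier f)
    (fun x => cint (fun s => wave (fun=> 0) P2 1 tau (s, x) * f s)).
Proof.
move=> tau01 a01 fi fJ.
apply: (@wave_dispersive (fun=> 0) P2 1 tau _ (fun n => - (n%:R + 4)) (fun=> - a)) => //.
- by apply: A0; case/andP: tau01.
- move=> n x c d.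
  have an : a <= n%:R + 4 by have : 0 <= n%:R :> R := ler0n R n; case/andP: a01; lra.
  pose g s := expR (- (0 * `|x|)) * cos (tau ^+ 4 * P2 s + - c * s + d).
  have mg : measurable_fun setT g.
    apply: measurable_funM; first exact: measurable_cst.
    apply: (measurableT_comp (continuous_measurable_fun (@continuous_cos R))).
    apply: continuous_measurable_fun => s.
    exact: isd_continuous (isd_add (isd_add (isd_mul (isd_cst (tau ^+ 4) s) (dP2 s)) (isd_scale (- c) s)) (isd_cst d s)).
  have E : \int[mu]_(s in `[- (n%:R + 4), - a]) (expR (- (0 * `|x|)) * cos (tau ^+ 4 * P2 s + c * s + d)) =
      \int[mu]_(s in `[a, n%:R + 4]) g s.
    rewrite /Rintegral; congr fine.
    have -> : `[- (n%:R + 4), - a]%classic = -%R @^-1` `[a, n%:R + 4]%classic.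
      by rewrite opp_preimage_itvbndbnd.
    rewrite -(integral_oppr (D := `[a, n%:R + 4]%classic))//; last first.
      by apply/measurable_EFinP; exact: measurable_funTS.
    apply: eq_integral => s _; rewrite /g /P2; congr (_ * cos _)%:E.
    by ring.
  by rewrite E; exact: P2_osc.
- by move=> n F mF FM; apply: wave_kernel_L2_fourier.
exists set0; split => // s /= h; exfalso; apply: h => /fJ sa.
near=> n; rewrite sa andbT lerNl.
have : - s <= n%:R by near: n; exact: nbhs_infty_ger.
by move=> h; apply: le_trans h _; rewrite lerDl.
Unshelve. all: by end_near. Qed.

(** For $k=is$ one has $k^4-k^2=s^4+s^2$, with $\mathrm{Im}\,k=s$ and $\mathrm{Re}\,k=0$. *)
Lemma wave_dispersive_imaginary_axis (tau : R) (f : R -> R[i]) : 0 < tau <= 1 ->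
  cintble f -> (forall s, f s != 0 -> 0 <= s) ->
  dispersive_bounds (2 * ((3 + 2 * pi) / tau)) (2 * pi * (2 * pi)) (inv_fourier f)
    (fun x => cint (fun s => wave id (fun s => s ^+ 4 + s ^+ 2) 0 tau (s, x) * f s)).
Proof.
move=> tau01 fi f0.
apply: (@wave_dispersive_laplace id (fun=> 1) (fun s => s ^+ 4 + s ^+ 2) (fun s => 4 * s ^+ 3 + 2 * s)
  (fun s => 12 * s ^+ 2 + 2) 0 tau 0) => //.
- by rewrite lexx divr_ge0.
- by move=> s; exact: cvg_id.
- by move=> s _; rewrite subr0.
- by move=> s; apply: is_derive_eq; rewrite /GRing.scale /=; ring.
- by move=> s; apply: is_derive_eq; rewrite /GRing.scale /=; ring.
- left=> s s1; nra.
Qed.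

(** For $k=\pm s+ih$ with $h^2=s^2-\frac12$, the number $k^2-\frac12$ is purely imaginary, so
    $k^4-k^2=(k^2-\frac12)^2-\frac14$ is real and equals $-(2s^2-\frac12)^2$. With $q=1/\sqrt2$, the
    bound $h\ge s-q$ follows from $s^2-q^2\ge(s-q)^2$ for $s\ge q$. *)
Lemma wave_dispersive_hyperbola (tau kap : R) (f : R -> R[i]) : 0 < tau <= 1 ->
  cintble f -> (forall s, f s != 0 -> (Num.sqrt 2)^-1 <= s) ->
  dispersive_bounds (2 * ((3 + 2 * pi) / tau)) (2 * pi * (2 * pi)) (inv_fourier f)
    (fun x => cint (fun s => wave (fun s => Num.sqrt (s ^+ 2 - 2^-1))
       (fun s => - (2 * s ^+ 2 - 2^-1) ^+ 2) kap tau (s, x) * f s)).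
Proof.
move=> tau01 fi fq.
have q0 : 0 < (Num.sqrt 2)^-1 :> R by rewrite invr_gt0 sqrtr_gt0.
have q2 : (Num.sqrt 2)^-1 ^+ 2 = 2^-1 :> R by rewrite exprVn sqr_sqrtr.
move: ((Num.sqrt 2)^-1) q0 q2 fq => q q0 q2 fq.
have pos (s : R) : 1 <= s -> 0 < s ^+ 2 - 2^-1 by move=> s1; nra.
have dsq (s : R) : is_derive s 1 (fun s => s ^+ 2 - 2^-1) (2 * s).
  by apply: is_derive_eq; rewrite /GRing.scale /=; ring.
apply: (@wave_dispersive_laplace (fun s => Num.sqrt (s ^+ 2 - 2^-1))
  (fun s => s / Num.sqrt (s ^+ 2 - 2^-1)) (fun s => - (2 * s ^+ 2 - 2^-1) ^+ 2)
  (fun s => - 16 * s ^+ 3 + 4 * s) (fun s => - 48 * s ^+ 2 + 4) kap tau q).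
- exact: tau01.
- by apply/andP; split; nra.
- by move=> s; exact: (cvg_comp _ _ (isd_continuous (dsq s)) (@sqrt_continuous R _)).
- move=> s qs; rewrite -[leLHS]ger0_norm ?subr_ge0// -sqrtr_sqr ler_wsqrtr//.
  by nra.
- move=> s s1; have s0 := pos s s1.
  apply: (is_derive_eq (isd_sqrt (g := fun s => s ^+ 2 - 2^-1) s0 (dsq s))).
  by field; rewrite gt_eqF ?sqrtr_gt0.
- by move=> s s1; rewrite divr_ge0 ?sqrtr_ge0//; lra.
- by move=> s; apply: is_derive_eq; rewrite /GRing.scale /=; field.
- by move=> s; apply: is_derive_eq; rewrite /GRing.scale /=; ring.
- right=> s s1; nra.
- exact: fi.
- exact: fq.
Qed.

End Arcs.

(** * Lebesgue norms and the boundary arcs *)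

Section LebesgueNorms.
Context {R : realType}.
Local Notation mu := (@lebesgue_measure R).

Local Notation Lmod r f := ('N[mu]_r [ (EFin \o (fun x => modulus (f x))) ]%E).

Lemma Lnorm_modulusE (r : R) (f : R -> R[i]) :
  Lmod r%:E f = ((\int[mu]_x (modulus (f x) `^ r)%:E) `^ r^-1)%E.
Proof.
rewrite unlock; apply: (f_equal (fun v => v `^ r^-1)%E).
by apply: eq_integral => x _ /=; rewrite ger0_norm ?modulus_ge0.
Qed.

Lemma marcinkiewicz_cst_ge0 (r B : R) : 2 < r -> 0 <= B -> 0 <= marcinkiewicz_cst r B.
Proof.
move=> r2 B0; have q0 : 0 < r - 2 by lra.
rewrite /marcinkiewicz_cst; apply: mulr_ge0; first by rewrite !mulr_ge0 ?powR_ge0.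
have := @sum_geometric_truncated R 0 2 (r - 2) 0 (lexx _) (ler0n _ 2) q0.
by rewrite big_geq.
Qed.

(** For [S] equal to the integral itself, the $r$-th root of $KA^{r-2}S^{r-1}$ contains
    $S^{(r-1)/r}$, the norm of [P]. An infinite norm is split off because the constant vanishes for
    $B=0$ and $0\cdot\infty=0$. *)
Lemma dispersive_Lnorm_fin (A B r : R) (P V : R -> R[i]) : 0 < A -> 0 <= B -> 2 < r ->
  dispersive_bounds A B P V ->
  (Lmod r%:E V <= (marcinkiewicz_cst r B `^ r^-1 * A `^ ((r - 2) / r))%:E * Lmod (r / (r - 1))%:E P)%E
  \/ Lmod (r / (r - 1))%:E P = +oo%E.
Proof.
move=> A0 B0 r2 [mV HLr _ _]; set p := r / (r - 1).
have r0 : 0 < r by lra.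
have q0 : 0 < r - 2 by lra.
have p0 : 0 < p by rewrite divr_gt0//; lra.
set K := marcinkiewicz_cst r B; have K0 : 0 <= K by exact: marcinkiewicz_cst_ge0.
rewrite !Lnorm_modulusE.
have I0 : (0 <= \int[mu]_x (modulus (V x) `^ r)%:E)%E.
  by apply: integral_ge0 => x _; rewrite lee_fin powR_ge0.
have J0 : (0 <= \int[mu]_x (modulus (P x) `^ p)%:E)%E.
  by apply: integral_ge0 => x _; rewrite lee_fin powR_ge0.
case EJ : (\int[mu]_x (modulus (P x) `^ p)%:E)%E => [S| |].
- left; have S0 : 0 <= S by rewrite EJ in J0.
  have HS (S' : R) : 0 < S' -> S <= S' ->
      (\int[mu]_x (modulus (V x) `^ r)%:E <= (K * ((A * S') `^ (r - 2) * S'))%:E)%E.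
    by move=> S'0 SS'; apply: HLr => //; rewrite -/p EJ lee_fin.
  move: S0; rewrite le_eqVlt => /predU1P[S0|S0].
    (* The estimate is stated for positive [S], so $S=0$ is reached by small $S'$: $S'\le1$ controls
       $S'^{r-2}$, and $S'\le e/c$ makes the bound at most [e]. *)
    suff -> : (\int[mu]_x (modulus (V x) `^ r)%:E = 0)%E.
      rewrite poweR0r ?invr_neq0 ?gt_eqF//; apply: mule_ge0; last exact: poweR_ge0.
      by rewrite lee_fin mulr_ge0 ?powR_ge0.
    apply/eqP; rewrite eq_le I0 andbT; apply/lee_addgt0Pr => e e0; rewrite add0e.
    pose c := K * A `^ (r - 2) + 1.
    have c0 : 0 < c by rewrite ltr_pwDr// mulr_ge0 ?powR_ge0.
    pose S' := Num.min 1 (e / c).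
    have S'0 : 0 < S' by rewrite lt_min ltr01 divr_gt0.
    have S'1 : S' <= 1 by rewrite ge_min lexx.
    have S'e : S' * c <= e by rewrite -ler_pdivlMr// ge_min lexx orbT.
    apply: le_trans (HS S' S'0 _) _; first by rewrite -S0 ltW.
    rewrite lee_fin; apply: le_trans S'e.
    rewrite powRM ?(ltW A0) ?(ltW S'0)//.
    have h : S' `^ (r - 2) <= 1.
      have e1 : 1 `^ (r - 2) = 1 by rewrite powR1.
      rewrite -[leRHS]e1; apply: ge0_ler_powR; rewrite ?nnegrE ?(ltW S'0) ?(ltW q0)//.
    rewrite (_ : K * _ = S' * (K * A `^ (r - 2) * S' `^ (r - 2))); last by ring.
    rewrite ler_wpM2l ?(ltW S'0)//.
    have KA : 0 <= K * A `^ (r - 2) by rewrite mulr_ge0 ?powR_ge0.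
    by apply: (@le_trans _ _ (K * A `^ (r - 2))); [rewrite ler_piMr|rewrite lerDl].
  have H := HS S S0 (lexx _).
  have ri0 : 0 <= r^-1 by rewrite invr_ge0 ltW.
  apply: (@le_trans _ _ ((K * ((A * S) `^ (r - 2) * S))%:E `^ r^-1)%E).
    apply: gt0_ler_poweR => //; rewrite ?in_itv /= ?I0 ?leey//.
    by rewrite andbT lee_fin; apply: mulr_ge0 => //; apply: mulr_ge0; [exact: powR_ge0|exact: ltW].
  rewrite !poweR_EFin -EFinM lee_fin le_eqVlt; apply/orP; left; apply/eqP.
  have -> : (A * S) `^ (r - 2) * S = A `^ (r - 2) * S `^ (r - 1).
    rewrite powRM ?(ltW A0) ?(ltW S0)// -mulrA; congr (_ * _).
    rewrite -[X in _ * X](powRr1 (ltW S0)) -powRD; last by rewrite (lt0r_neq0 S0) implybT.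
    by congr (_ `^ _); ring.
  rewrite (powRM _ K0) ?mulr_ge0 ?powR_ge0// powRM ?powR_ge0// -!powRrM mulrA.
  by congr (_ * _ * _ `^ _); rewrite /p invf_div.
- by right; rewrite poweRyr// invr_neq0 ?gt_eqF.
- by rewrite EJ in J0.
Qed.

Lemma dispersive_Lnorm2 (A B : R) (P V : R -> R[i]) : 0 <= B ->
  dispersive_bounds A B P V -> (Lmod 2%:E V <= (Num.sqrt B)%:E * Lmod 2%:E P)%E.
Proof.
move=> B0 [_ _ HL2 _]; rewrite !Lnorm_modulusE.
have E (f : R -> R[i]) : (\int[mu]_x (modulus (f x) `^ 2)%:E = \int[mu]_x (modulus (f x) ^+ 2)%:E)%E.
  by apply: eq_integral => x _; rewrite -powR_mulrn ?modulus_ge0.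
have I0 (f : R -> R[i]) : (0 <= \int[mu]_x (modulus (f x) ^+ 2)%:E)%E.
  by apply: integral_ge0 => x _; rewrite lee_fin sqr_ge0.
rewrite !E -powR12_sqrt// -poweR_EFin -poweRM ?lee_fin//.
by apply: gt0_ler_poweR; rewrite ?in_itv /= ?I0 ?mule_ge0 ?leey ?invr_ge0 ?I0.
Qed.

(** For finite $r=s$ the exponent is $\frac14-\frac1{2s}=\frac{s-2}{4s}$, so the power of $\tau^4$
    is the $(1/\tau)^{(s-2)/s}$ produced by interpolation. The ends $r=\infty$ and $r=2$ come
    directly from the kernel bound and the $L^2$ bound. *)
Lemma dispersive_Lnorm (A0 B : R) (r r' : \bar R) : 0 < A0 -> 0 <= B ->
  (2%:E <= r)%E -> (r^-1 + r'^-1 = 1)%E ->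
  exists2 C : R, 0 < C & forall (tau : R) (P V : R -> R[i]), 0 < tau ->
    dispersive_bounds (A0 / tau) B P V ->
    (Lmod r V <= (C * (tau ^+ 4) `^ (- (1 / 4 - fine ((2%:E * r)^-1)%E)))%:E * Lmod r' P)%E.
Proof.
move=> A00 B0 r2 rr'.
have pow (e tau : R) : 0 < tau -> (tau ^+ 4) `^ (- e) = (tau^-1) `^ (4 * e).
  move=> tau0; rewrite -powR_mulrn ?(ltW tau0)// -powRrM mulrN powRN.
  by rewrite -(powR_inv1 (ltW tau0)) -powRrM mulN1r powRN.
have [[rE r'E] | [s [s2 rE r'E]]] : (r = +oo%E /\ r' = 1%E) \/
    exists s : R, [/\ 2 <= s, r = s%:E & r' = (s / (s - 1))%:E].
- case: r r2 rr' => [s| |//] r2 rr'; last first.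
    by left; split=> //; move: rr'; rewrite invey add0e => /eqP; rewrite inve_eq1 => /eqP.
  right; exists s; rewrite lee_fin in r2; split => //.
  have s0 : s != 0 by rewrite gt_eqF//; lra.
  have s1 : s - 1 != 0 by rewrite gt_eqF//; lra.
  move: rr'; rewrite inver (negbTE s0); case: r' => [p| |]; last 2 first.
  + by rewrite invey adde0 => -[]/eqP; rewrite invr_eq1 => /eqP s1'; exfalso; lra.
  + by rewrite inveNy.
  rewrite inver; case: ifPn => // p0; rewrite -EFinD => -[h]; congr _%:E.
  have sp : p + s = s * p.
    by rewrite -[RHS]mulr1 -h; field; rewrite s0 p0.
  apply: (mulIf s1); rewrite divfK//; lra.
- exists A0 => // tau P V tau0 [_ _ _ HLoo].
  rewrite rE r'E gt0_muley ?lte_fin// invey /= subr0 Lnorm1.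
  rewrite pow// (_ : 4 * (1 / 4) = 1); last by field.
  rewrite powRr1 ?invr_ge0 ?(ltW tau0)// unlock.
  have RHS0 : (0 <= (A0 / tau)%:E * \int[mu]_x `|(EFin \o (fun x => modulus (P x))) x|)%E.
    by apply: mule_ge0; [rewrite lee_fin divr_ge0// ltW|exact: integral_ge0].
  case: ifP => // _.
  apply/ess_supP; apply: aeW => x /=; rewrite ger0_norm ?modulus_ge0//.
  apply: le_trans (HLoo x) _.
  rewrite le_eqVlt; apply/orP; left; apply/eqP; congr (_ * _)%E.
  by apply: eq_integral => y _ /=; rewrite ger0_norm ?modulus_ge0.
- rewrite rE r'E; have s0 : 0 < s by lra.
  have expE : 1 / 4 - fine (2%:E * s%:E)^-1%E = (s - 2) / s / 4.
    rewrite -EFinM inver gt_eqF ?mulr_gt0//=; field; exact: lt0r_neq0.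
  have e4 : 4 * ((s - 2) / s / 4) = (s - 2) / s by field; rewrite lt0r_neq0.
  move: s2; rewrite le_eqVlt => /predU1P[s2|s2].
    exists (Num.sqrt B + 1); first by rewrite ltr_wpDl ?sqrtr_ge0.
    move=> tau P V tau0 /(dispersive_Lnorm2 B0) H.
    rewrite expE pow// e4 -s2 (_ : 2 / (2 - 1) = 2 :> R); last by field; lra.
    rewrite subrr mul0r powRr0 mulr1; apply: le_trans H _.
    by rewrite lee_wpmul2r ?Lnorm_ge0// lee_fin lerDl.
  set c := marcinkiewicz_cst s B `^ s^-1.
  have c0 : 0 <= c by exact: powR_ge0.
  (* The summand $1$ makes the constant positive, so that the right-hand side is $+\infty$ when the
     norm of [P] is. *)
  exists (c * A0 `^ ((s - 2) / s) + 1); first by rewrite ltr_wpDl ?mulr_ge0 ?powR_ge0.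
  move=> tau P V tau0 D; rewrite expE pow// e4.
  have ti : 0 < tau^-1 by rewrite invr_gt0.
  have A1 : 0 < A0 / tau by rewrite divr_gt0.
  have [H|->] := dispersive_Lnorm_fin A1 B0 s2 D.
    apply: le_trans H _; rewrite lee_wpmul2r ?Lnorm_ge0// lee_fin -/c.
    rewrite powRM ?(ltW A00) ?(ltW ti)// mulrA ler_wpM2r ?powR_ge0//.
    by rewrite lerDl.
  rewrite gt0_muley ?leey// lte_fin mulr_gt0 ?powR_gt0//.
  by rewrite ltr_wpDl ?mulr_ge0 ?powR_ge0.
Qed.

End LebesgueNorms.

(** * The contribution of each boundary arc *)

Section BoundaryArcs.
Context {R : realType}.
Local Notation mu := (@lebesgue_measure R).
Local Notation cint := (@cintegral R setT).
Local Notation cintble := (@cintegrable R setT).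

(** At $s=1/\sqrt2$ the hyperbolas have no derivative in this parameter, and $\hat\Psi_3,\hat\Psi_4$
    contain a division by $0$; the values there carry no meaning. Agreement with a measurable [h]
    off one point also makes [g] measurable on [D]. *)
Lemma Rintegral_eq_but1 (D : set R) (q : R) (g h : R -> R) : measurable D ->
  measurable_fun setT h -> (forall s, D s -> s != q -> g s = h s) ->
  (forall s, ~ D s -> h s = 0) ->
  \int[mu]_(s in D) g s = \int[mu]_s h s.
Proof.
move=> mD mh gh h0; have mq : measurable (D `&` ~` [set q]).
  by apply: measurableI => //; apply: measurableC; exact: measurable_set1.
rewrite -[RHS](_ : \int[mu]_(s in D) h s = _); last first.
  rewrite Rintegral_mkcond; congr (Rintegral _ _ _); apply/funext => s.
  by rewrite patchE; case: ifPn => // /negP sD; rewrite h0// => Ds; apply: sD; rewrite inE.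
rewrite /Rintegral; congr fine; apply: ae_eq_integral => //.
- apply/measurable_EFinP.
  have DE : (D `&` ~` [set q]) `|` (D `&` [set q]) = D by rewrite -setIUr setvU setIT.
  rewrite -DE; apply/measurable_funU => //; first by apply: measurableI => //; exact: measurable_set1.
  split.
    apply: (@eq_measurable_fun _ _ _ _ _ h); last exact: measurable_funTS.
    by move=> s; rewrite inE => -[Ds /eqP sq]; rewrite gh.
  by apply: measurable_funS (@measurable_fun_set1 _ _ _ _ q _); [exact: measurable_set1|move=> s []].
- by apply/measurable_EFinP; exact: measurable_funTS.
exists [set q]; split; [exact: measurable_set1|exact: lebesgue_measure_set1|].
by move=> s /= h1; apply: contrapT => /eqP sq; apply: h1 => Ds; rewrite gh.
Qed.

Lemma cintegral_eq_but1 (D : set R) (q : R) (g h : R -> R[i]) : measurable D ->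
  cmeas h -> (forall s, D s -> s != q -> g s = h s) ->
  (forall s, ~ D s -> h s = 0) -> cintegral D g = cint h.
Proof.
move=> mD [mr mi] gh h0; rewrite /cintegral; congr (_ +i* _)%C;
  apply: (@Rintegral_eq_but1 D q) => //.
- by move=> s Ds sq; rewrite gh.
- by move=> s /h0 ->.
- by move=> s Ds sq; rewrite gh.
- by move=> s /h0 ->.
Qed.

Lemma cexp_wave (a b x t p : R) :
  (a +i* b)%C ^+ 4 - (a +i* b)%C ^+ 2 = p%:C%C ->
  cexp ('i%C * (a +i* b)%C * x%:C%C - w (a +i* b)%C * t%:C%C) =
  (expR (- (b * x)))%:C%C * expi (a * x + t * p).
Proof.
rewrite /w => ->; rewrite cexpE.
have -> : 'i%C * (a +i* b)%C * x%:C%C - - 'i%C * p%:C%C * t%:C%C =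
   (- (b * x) +i* (a * x + t * p))%C by simpc; congr (_ +i* _)%C; ring.
by [].
Qed.

(** [c] collects the factor $-1/(2\pi)$ of $E$ and, on the imaginary axis, the factor $-i$ of $dk$;
    only $|c|\le1$ is retained. *)
Lemma modulus_cintegral_wave (D : set R) (g f : R -> R[i]) (eta P : R -> R) (kap tau x q : R) (c : R[i]) :
  0 <= x -> continuous eta -> continuous P -> measurable D -> cintble f ->
  (forall s, f s != 0 -> 0 <= eta s) ->
  (forall s, f s != 0 -> D s) -> modulus c <= 1 ->
  (forall s, D s -> s != q -> g s = c * (wave eta P kap tau (s, x) * f s)) ->
  modulus (cintegral D g) <= modulus (cint (fun s => wave eta P kap tau (s, x) * f s)).
Proof.
move=> x0 ceta cP mD fi eta0 fD c1 gE.
have mw : cmeas (fun s => wave eta P kap tau (s, x) * f s).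
  apply: cmeasM (cintegrable_meas fi).
  by apply: (cmeas_comp (h := fun s => (s, x)) (cmeas_wave kap tau ceta cP)); exact: measurable_pair2.
have iw : cintble (fun s => wave eta P kap tau (s, x) * f s).
  apply: (@cintegrable_leZ _ _ f 1) => // s; rewrite mul1r modulusM modulus_wave /=.
  have [->|fs] := eqVneq (f s) 0; first by rewrite modulus0 mulr0.
  by rewrite ler_piMl ?modulus_ge0// -expR0 ler_expR oppr_le0 mulr_ge0// eta0.
rewrite (@cintegral_eq_but1 D q g (fun s => c * (wave eta P kap tau (s, x) * f s)))//.
- by rewrite cintZ// modulusM ler_piMl ?modulus_ge0.
- by apply: cmeasM => //; exact: cmeas_cst.
- move=> s Ds; have [->|/fD//] := eqVneq (f s) 0.
  by rewrite !mulr0.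
Qed.

Lemma cintegral_oppr (D : set R) (g h : R -> R[i]) : measurable D -> cmeas h ->
  (forall s, D s -> g (- s) = h s) -> cintegral (-%R @^-1` D) g = cintegral D h.
Proof.
move=> mD [mr mi] gh; rewrite /cintegral /Rintegral; congr (fine _ +i* fine _)%C.
- rewrite -(integral_oppr (D := D))//; last by apply/measurable_EFinP; exact: measurable_funTS.
  by apply: eq_integral => s; rewrite inE => /= Ds; rewrite -gh// opprK.
- rewrite -(integral_oppr (D := D))//; last by apply/measurable_EFinP; exact: measurable_funTS.
  by apply: eq_integral => s; rewrite inE => /= Ds; rewrite -gh// opprK.
Qed.

Let q : R := (Num.sqrt 2)^-1.

Let q_gt0 : 0 < q. Proof. by rewrite invr_gt0 sqrtr_gt0. Qed.

Let sqr_q : q ^+ 2 = 2^-1. Proof. by rewrite exprVn sqr_sqrtr. Qed.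

Let height_gt0 (s : R) : q < s -> 0 < s ^+ 2 - 2^-1.
Proof. by move=> qs; rewrite -sqr_q; have := q_gt0; nra. Qed.

Lemma derive1_height (s : R) : q < s ->
  derive1 (fun u : R => Num.sqrt (u ^+ 2 - 2^-1)) s = s / Num.sqrt (s ^+ 2 - 2^-1).
Proof.
move=> qs; have h := height_gt0 qs; apply: isd_derive1.
have d2 : is_derive s 1 (fun u : R => u ^+ 2 - 2^-1 : R) (2 * s).
  by apply: is_derive_eq; rewrite scaler0 subr0 /GRing.scale/=; ring.
apply: (is_derive_eq (isd_sqrt (g := fun u => u ^+ 2 - 2^-1) h d2)).
by field; rewrite gt_eqF ?sqrtr_gt0.
Qed.

Lemma continuous_height : continuous (fun s : R => Num.sqrt (s ^+ 2 - 2^-1)).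
Proof.
move=> s; have d2 : is_derive s 1 (fun u : R => u ^+ 2 - 2^-1 : R) (2 * s).
  by apply: is_derive_eq; rewrite scaler0 subr0 /GRing.scale/=; ring.
exact: (cvg_comp _ _ (isd_continuous d2) (@sqrt_continuous R _)).
Qed.

Let Ecst : R[i] := - ((2 * pi)^-1)%:C%C.

Let modulus_Ecst : modulus Ecst <= 1.
Proof.
have pi2 := pi_ge2 R; have p0 : 0 < 2 * pi :> R by lra.
rewrite modulusN modulus_real ger0_norm ?invr_ge0 ?(ltW p0)// invf_le1//; lra.
Qed.

Lemma E_wave (eta P : R -> R) (kap tau a b s x : R) : 0 <= x ->
  (a +i* b)%C ^+ 4 - (a +i* b)%C ^+ 2 = (P s)%:C%C -> b = eta s -> a = kap * s ->
  E (a +i* b)%C x (tau ^+ 4) = Ecst * wave eta P kap tau (s, x).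
Proof.
move=> x0 abP bE aE; rewrite /E (cexp_wave x (tau ^+ 4) abP) /wave -[(s, x).1]/s -[(s, x).2]/x.
by rewrite (ger0_norm x0) bE aE -[kap * s * x]mulrA.
Qed.

Let cderive_real (s : R) : cderive (fun s : R => s%:C%C) s = 1.
Proof.
by rewrite /cderive; congr (_ +i* _)%C; [exact: isd_derive1 (isd_id s)|exact: isd_derive1 (isd_cst 0 s)].
Qed.

Let cderive_imag (s : R) : cderive (fun s : R => 0 +i* (- s))%C s = - 'i%C.
Proof.
rewrite [RHS](_ : _ = 0 +i* (- 1))%C; last by simpc.
by rewrite /cderive; congr (_ +i* _)%C; [exact: isd_derive1 (isd_cst 0 s)|exact: isd_derive1 (isd_opp (isd_id s))].
Qed.

Let cderive_height (kap s : R) : q < s ->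
  cderive (fun s : R => (kap * s) +i* Num.sqrt (s ^+ 2 - 2^-1))%C s = (kap +i* (s / Num.sqrt (s ^+ 2 - 2^-1)))%C.
Proof.
move=> qs; rewrite /cderive; congr (_ +i* _)%C; last exact: derive1_height.
exact: isd_derive1 (isd_scale kap s).
Qed.

Let phase_real (s : R) : (s +i* 0)%C ^+ 4 - (s +i* 0)%C ^+ 2 = (s ^+ 4 - s ^+ 2)%:C%C.
Proof. by rewrite !exprS !expr0; simpc; congr (_ +i* _)%C; ring. Qed.

Let phase_imag (s : R) : (0 +i* s)%C ^+ 4 - (0 +i* s)%C ^+ 2 = (s ^+ 4 + s ^+ 2)%:C%C.
Proof. by rewrite !exprS !expr0; simpc; congr (_ +i* _)%C; ring. Qed.

Let phase_height (a h : R) : h ^+ 2 = a ^+ 2 - 2^-1 ->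
  (a +i* h)%C ^+ 4 - (a +i* h)%C ^+ 2 = (- (2 * a ^+ 2 - 2^-1) ^+ 2)%:C%C.
Proof.
move=> h2.
have z2 : (a +i* h)%C ^+ 2 = (2^-1 +i* (2 * a * h))%C.
  by rewrite expr2; simpc; congr (_ +i* _)%C; [rewrite -!expr2 h2|]; ring.
have -> : (a +i* h)%C ^+ 4 = (a +i* h)%C ^+ 2 * (a +i* h)%C ^+ 2 by rewrite -exprD.
rewrite z2; simpc; congr (_ +i* _)%C; last by field.
rewrite (_ : 2 * a * h * (2 * a * h) = 4 * a ^+ 2 * h ^+ 2); last by ring.
by rewrite h2; field.
Qed.

Let arc_bounds (c : @Defs.arc R) (tau T eps : R) (g0 g1 f : R -> R[i]) :=
  exists2 V : R -> R[i],
    dispersive_bounds (2 * ((3 + 2 * pi) / tau)) (2 * pi * (2 * pi)) (inv_fourier f) V &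
    forall x, 0 <= x -> modulus (arc_integral c
      (fun k => E k x (tau ^+ 4) * G eps g0 g1 k T)) <= modulus (V x).

Let cphase2 : continuous (fun s : R => s ^+ 4 - s ^+ 2).
Proof.
move=> s; apply: (@isd_continuous R _ _ (4 * s ^+ 3 - 2 * s)).
by apply: is_derive_eq; rewrite /GRing.scale /=; ring.
Qed.

Let real_arc_bounds (D : set R) (eps T tau : R) (g0 g1 f : R -> R[i]) :
  0 < tau <= 1 -> measurable D -> cintble f -> (forall s, f s != 0 -> D s) ->
  (forall s, D s -> f s = G eps g0 g1 s%:C%C T) ->
  dispersive_bounds (2 * ((3 + 2 * pi) / tau)) (2 * pi * (2 * pi)) (inv_fourier f)
    (fun x => cint (fun s => wave (fun=> 0) (fun s => s ^+ 4 - s ^+ 2) 1 tau (s, x) * f s)) ->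
  arc_bounds (Arc D (fun s => s%:C%C)) tau T eps g0 g1 f.
Proof.
move=> tau01 mD fi fD fG H; eexists; first exact: H.
move=> x x0; apply: (@modulus_cintegral_wave D _ f _ _ 1 tau x 0 Ecst) => //.
- by move=> s; exact: cvg_cst.
- move=> s Ds _; rewrite cderive_real mulr1 fG// mulrA; congr (_ * _).
  by apply: E_wave; rewrite ?mul1r ?phase_real.
Qed.

(** The derivative $\kappa+is/\sqrt{s^2-1/2}$ of the path is exactly the factor built into
    $\hat\Psi_3$ and $\hat\Psi_4$, so its singularity is absorbed in the amplitude. *)
Let hyperbola_bounds (eps T tau kap : R) (g0 g1 f : R -> R[i]) :
  0 < tau <= 1 -> kap ^+ 2 = 1 -> cintble f -> (forall s, f s != 0 -> q <= s) ->
  (forall s, q <= s -> f s =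
    G eps g0 g1 ((kap * s) +i* Num.sqrt (s ^+ 2 - 2^-1))%C T * (kap +i* (s / Num.sqrt (s ^+ 2 - 2^-1)))%C) ->
  arc_bounds (Arc `[q, +oo[ (fun s => (kap * s) +i* Num.sqrt (s ^+ 2 - 2^-1))%C) tau T eps g0 g1 f.
Proof.
move=> tau01 kap2 fi fq fG; eexists; first exact: (wave_dispersive_hyperbola kap tau01 fi fq).
move=> x x0; apply: (@modulus_cintegral_wave `[q, +oo[%classic _ f _ _ kap tau x q Ecst) => //.
- exact: continuous_height.
- move=> s; apply: (@isd_continuous R _ _ (- 16 * s ^+ 3 + 4 * s)).
  by apply: is_derive_eq; rewrite /GRing.scale /=; field.
- by move=> s /fq; rewrite /= in_itv /= andbT.
- move=> s; rewrite /= in_itv /= andbT => qs sq; rewrite fG// cderive_height; last first.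
    by rewrite lt_neqAle eq_sym sq.
  rewrite mulrA mulrA; congr (_ * _ * _); apply: E_wave => //.
  have h : 0 <= s ^+ 2 - 2^-1 by apply/ltW/height_gt0; rewrite lt_neqAle eq_sym sq.
  have ks : (kap * s) ^+ 2 = s ^+ 2 by rewrite exprMn kap2 mul1r.
  rewrite -ks; apply: phase_height.
  by rewrite ks sqr_sqrtr.
Qed.

(** The arc descends the imaginary axis with parameter $s\le0$, whereas $\hat\Psi_1$ lives on
    $s\ge0$; a reflection matches the two. *)
Let imaginary_bounds (eps T tau : R) (g0 g1 : R -> R[i]) :
  0 < tau <= 1 -> cintble (Psi_hat1 eps T g0 g1) ->
  arc_bounds (Arc `]-oo, 0] (fun s => 0 +i* (- s))%C) tau T eps g0 g1 (Psi_hat1 eps T g0 g1).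
Proof.
move=> tau01; set f := Psi_hat1 _ _ _ _ => fi.
have f0 s : f s != 0 -> 0 <= s by rewrite /f /Psi_hat1; case: ifP => // _; rewrite eqxx.
eexists; first exact: (wave_dispersive_imaginary_axis tau01 fi f0).
move=> x x0; rewrite /arc_integral -[arc_dom _]/(`]-oo, 0]%classic) -[arc_path _]/(fun s => 0 +i* (- s))%C.
have cP : continuous (fun s : R => s ^+ 4 + s ^+ 2).
  move=> s; apply: (@isd_continuous R _ _ (4 * s ^+ 3 + 2 * s)).
  by apply: is_derive_eq; rewrite /GRing.scale /=; ring.
have cid : continuous (id : R -> R) by move=> s; exact: cvg_id.
have mw : cmeas (fun s => (Ecst * - 'i%C) * (wave id (fun s => s ^+ 4 + s ^+ 2) 0 tau (s, x) * f s)).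
  apply: cmeasM; first exact: cmeas_cst.
  apply: cmeasM (cintegrable_meas fi).
  by apply: (cmeas_comp (h := fun s => (s, x)) (cmeas_wave 0 tau cid cP)); exact: measurable_pair2.
have -> : `]-oo, 0]%classic = -%R @^-1` `[0, +oo[%classic :> set R.
  by apply/seteqP; split=> s; rewrite /= !in_itv /= andbT oppr_ge0.
rewrite (cintegral_oppr _ mw)//; last first.
  move=> s; rewrite /= in_itv /= andbT => s0; rewrite cderive_imag opprK.
  rewrite (@E_wave id (fun s => s ^+ 4 + s ^+ 2) 0 tau 0 s s x) ?mul0r ?phase_imag//.
  by rewrite /f /Psi_hat1 s0; ring.
apply: (@modulus_cintegral_wave _ _ f id _ 0 tau x 0 (Ecst * - 'i%C)) => //.
- by move=> s /f0; rewrite /= in_itv /= andbT.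
- rewrite modulusM (_ : modulus (- 'i%C) = 1) ?mulr1//.
  by rewrite modulusN modulusE /= expr0n expr1n add0r sqrtr1.
Qed.

Lemma bnd_arc_dispersive (eps T tau : R) (g0 g1 : R -> R[i]) (j : 'I_5) : 0 < tau <= 1 ->
  cintble (Psi_hat eps T g0 g1 j) -> exists2 V : R -> R[i],
    dispersive_bounds (2 * ((3 + 2 * pi) / tau)) (2 * pi * (2 * pi)) (Psi eps T g0 g1 j) V &
    forall x, 0 <= x -> modulus (arc_integral (bnd_arc j)
      (fun k => E k x (tau ^+ 4) * G eps g0 g1 k T)) <= modulus (V x).
Proof.
have arcE i : bnd_arc i = nth (bnd_arc 0)
  [:: Arc `]-oo, 0] (fun s : R => 0 +i* (- s))%C;
      Arc `[0, q] (fun s => s%:C%C);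
      Arc `[q, +oo[ (fun s => s +i* Num.sqrt (s ^+ 2 - 2^-1))%C;
      Arc `[q, +oo[ (fun s => (- s) +i* Num.sqrt (s ^+ 2 - 2^-1))%C;
      Arc `]-oo, - q] (fun s => s%:C%C)] i.
  by rewrite {1}/bnd_arc (tnth_nth (bnd_arc 0)).
have psiE i : Psi_hat eps T g0 g1 i = nth (fun=> 0)
  [:: Psi_hat1 eps T g0 g1; Psi_hat2 eps T g0 g1; Psi_hat3 eps T g0 g1;
      Psi_hat4 eps T g0 g1; Psi_hat5 eps T g0 g1] i.
  by rewrite {1}/Psi_hat (tnth_nth (fun=> 0)).
rewrite /Psi arcE psiE => tau01.
case: j => [[|[|[|[|[|//]]]]] jlt].
- exact: imaginary_bounds.
- have f0 s : Psi_hat2 eps T g0 g1 s != 0 -> 0 <= s <= q.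
    by rewrite /Psi_hat2; case: ifP => // _; rewrite eqxx.
  move=> fi; apply: real_arc_bounds => //.
  + by move=> s; rewrite /= in_itv /= => sq; rewrite /Psi_hat2 sq.
  + apply: (wave_dispersive_right (a := 0) (b := q)) => //; first by rewrite lexx ler01.
    exact: ltW.
- have f0 s : Psi_hat3 eps T g0 g1 s != 0 -> q <= s.
    by rewrite /Psi_hat3; case: ifP => // _; rewrite eqxx.
  move=> fi; have -> : (fun s => s +i* Num.sqrt (s ^+ 2 - 2^-1))%C =
      (fun s : R => (1 * s) +i* Num.sqrt (s ^+ 2 - 2^-1))%C.
    by apply/funext => s; rewrite mul1r.
  apply: hyperbola_bounds => //; first by rewrite expr1n.
  by move=> s qs; rewrite -[LHS]/(Psi_hat3 eps T g0 g1 s) /Psi_hat3 -/q qs mul1r.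
- have f0 s : Psi_hat4 eps T g0 g1 s != 0 -> q <= s.
    by rewrite /Psi_hat4; case: ifP => // _; rewrite eqxx.
  move=> fi; have -> : (fun s => (- s) +i* Num.sqrt (s ^+ 2 - 2^-1))%C =
      (fun s : R => (- 1 * s) +i* Num.sqrt (s ^+ 2 - 2^-1))%C.
    by apply/funext => s; rewrite mulN1r.
  apply: hyperbola_bounds => //; first by rewrite sqrrN expr1n.
  by move=> s qs; rewrite -[LHS]/(Psi_hat4 eps T g0 g1 s) /Psi_hat4 -/q qs mulN1r.
- have f0 s : Psi_hat5 eps T g0 g1 s != 0 -> s <= - q.
    by rewrite /Psi_hat5; case: ifP => // _; rewrite eqxx.
  move=> fi; apply: real_arc_bounds => //.
  + by move=> s; rewrite /= in_itv /= => sq; rewrite /Psi_hat5 sq.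
  apply: (wave_dispersive_left (a := q)) => //; rewrite (ltW q_gt0) /=.
  by have := sqr_q; have := q_gt0; nra.
Qed.

End BoundaryArcs.

Local Notation NN r f := ('N[(@lebesgue_measure _)]_r [ (EFin \o f) ]%E).

(** * Monotonicity and Minkowski's inequality for norms on the line *)

Section NormBounds.
Context {R : realType}.
Local Notation mu := (@lebesgue_measure R).


(** Allows $|W_b|$, whose measurability is not established, to be replaced by a measurable majorant
    before Minkowski's inequality is applied. *)
Lemma Lnorm_le (p : \bar R) (f g : R -> R) : (0 < p)%E ->
  (forall x, 0 <= f x <= g x) -> (NN p f <= NN p g)%E.
Proof.
move=> p1 fg.
have fgE x : `|f x| <= `|g x|.
  by case/andP: (fg x) => f0 h; rewrite !ger0_norm// (le_trans f0).
rewrite unlock; case: p p1 => [p| |//] p1; last first.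
  by case: ifP => // _; apply: le_ess_sup; apply: aeW => x /=; rewrite lee_fin.
rewrite lte_fin in p1; apply: (@gt0_ler_poweR R p^-1).
- by rewrite invr_ge0 ltW.
- by rewrite in_itv /= leey andbT integral_ge0// => x _; rewrite poweR_ge0.
- by rewrite in_itv /= leey andbT integral_ge0// => x _; rewrite poweR_ge0.
(* by definition of the integral, since [f] need not be measurable *)
rewrite !ge0_integralTE; [|by move=> x; exact: poweR_ge0..].
apply: ge_ereal_sup => _ [h /= hf <-]; apply: ereal_sup_ubound; exists h => // x.
by apply: le_trans (hf x) _; rewrite /= lee_fin ge0_ler_powR ?nnegrE// ltW.
Qed.

Lemma Lnorm_sum_le (p : \bar R) (n : nat) (f : 'I_n -> R -> R) : (1 <= p)%E ->
  (forall i, measurable_fun setT (f i)) ->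
  (NN p (fun x => \sum_(i < n) f i x)%R <= \sum_(i < n) NN p (f i))%E.
Proof.
move=> p1; elim: n f => [|n IH] f mf.
  rewrite big_ord0 (_ : EFin \o _ = cst 0%E); last first.
    by apply/funext => x /=; rewrite big_ord0.
  by rewrite Lnorm0// gt_eqF// (lt_le_trans _ p1)// lte_fin.
rewrite big_ord_recl; set g := fun x => \sum_(i < n) f (lift ord0 i) x.
rewrite (_ : EFin \o _ = EFin \o (f ord0 \+ g)); last first.
  by apply/funext => x /=; rewrite big_ord_recl.
have mg : measurable_fun setT g by apply: measurable_sum => i; exact: mf.
apply: (le_trans (@eminkowski _ _ R mu _ _ _ (mf ord0) mg p1)).
by rewrite leeD2l//; apply: IH.
Qed.

Lemma Lnorm_onT (p : \bar R) (f : R -> R[i]) :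
  Lnorm_on setT p f = NN p (fun x => modulus (f x)).
Proof. by rewrite /Lnorm_on patch_setT. Qed.

Lemma modulus_sum_le (n : nat) (z : 'I_n -> R[i]) :
  modulus (\sum_(i < n) z i) <= \sum_(i < n) modulus (z i).
Proof.
elim/big_rec2: _ => [|i a b _ h]; first by rewrite modulus0.
by apply: le_trans (modulusD _ _) _; rewrite lerD2l.
Qed.

End NormBounds.

Theorem theorem2p2 (R : realType) :
  exists2 eps0 : R, 0 < eps0 &
  forall eps : R, 0 < eps < eps0 ->
  forall (T : R) (r r' : \bar R),
    0 < T -> (2%:E <= r)%E -> (r^-1 + r'^-1 = 1)%E ->
  exists2 C : R, 0 < C &
  forall g0 g1 : R -> R[i], boundary_data eps T g0 g1 ->
  forall t : R, 0 < t <= 1 ->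
    (Lnorm_on `]0%R, +oo[ r (fun x => Wb eps T g0 g1 x t)
     <= (C * t `^ (- (1 / 4 - fine ((2%:E * r)^-1)%E)))%:E
        * \sum_(i < 5) Lnorm_on setT r' (Psi eps T g0 g1 i))%E.
Proof.
exists 1 => // eps _ T r r' _ r2 rr'.
have A0 : 0 < 2 * (3 + 2 * pi) :> R by have := pi_gt0 R; lra.
have B0 : 0 <= 2 * pi * (2 * pi) :> R by rewrite !mulr_ge0// pi_ge0.
have [C C0 HC] := dispersive_Lnorm A0 B0 r2 rr'.
exists C => // g0 g1 [_ _ fi] t /andP[t0 t1].
(* $\tau=t^{1/4}$, and $t\le1$ gives the bound $\tau\le1$ required by the oscillatory estimate. *)
pose tau := Num.sqrt (Num.sqrt t).
have tauE : tau ^+ 4 = t.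
  by rewrite (exprM _ 2 2) !sqr_sqrtr ?sqrtr_ge0// ltW.
have tau01 : 0 < tau <= 1.
  by rewrite !sqrtr_gt0 t0 -[leRHS]sqrtr1 ler_wsqrtr// -[leRHS]sqrtr1 ler_wsqrtr.
have [tau0 _] := andP tau01.
have /choice[V HV] (j : 'I_5) : exists V : R -> R[i],
    dispersive_bounds (2 * (3 + 2 * pi) / tau) (2 * pi * (2 * pi)) (Psi eps T g0 g1 j) V /\
    forall x, 0 <= x -> modulus (arc_integral (bnd_arc j)
      (fun k => E k x t * G eps g0 g1 k T)) <= modulus (V x).
  have [V HV1 HV2] := bnd_arc_dispersive tau01 (fi j).
  by exists V; rewrite -mulrA -tauE.
have r1 : (1 <= r)%E by apply: le_trans r2; rewrite lee_fin; lra.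
have mV j : measurable_fun setT (fun x => modulus (V j x)).
  by apply: cmeas_modulus; exact: dispersive_meas (HV j).1.
pose S x := \sum_(j < 5) modulus (V j x).
apply: (@le_trans _ _ ('N[@lebesgue_measure R]_r[ (EFin \o S) ])%E).
  rewrite /Lnorm_on restrict_EFin; apply: Lnorm_le; first exact: lt_le_trans r1.
  move=> x; rewrite patchE; case: ifPn => [|_]; last by rewrite lexx sumr_ge0// => j _; exact: modulus_ge0.
  rewrite inE /= in_itv /= andbT => x0; rewrite modulus_ge0 /=.
  apply: le_trans (modulus_sum_le _) _; apply: ler_sum => j _.
  exact: (HV j).2 (ltW x0).
apply: le_trans (Lnorm_sum_le r1 mV) _.
rewrite ge0_sume_distrr; last by move=> j _; exact: Lnorm_ge0.
apply: lee_sum => j _; rewrite Lnorm_onT -{1}tauE.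
exact: HC tau0 (HV j).1.
Qed.
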